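(* Let $a,b,c:\mathbb R\to\mathbb R$ be smooth functions satisfying hypothesis (H), $m$ a smooth compactly supported symbol on $\mathbb R^2$, and $\phi(\xi,\eta)=-a(\xi+\eta)+b(\xi)+c(\eta)$. Assume that $(\partial_\xi-\partial_\eta)\phi$ never vanishes on $\operatorname{Supp}m$ (no space resonances). Let $q\in[2,\infty]$. Then for any $\delta>0$ the solution $u$ of the system in the context satisfies: (1) if $0\le s<\frac1q$, $\|u(t)\|_{L^q}\lesssim t^{\frac1{2q}+\frac12-\frac32s+\delta}\|f\|_{L^{2,s}}\|g\|_{L^{2,s}}$; (2) if $\frac1q<s<1-\frac1q$, $\|u(t)\|_{L^q}\lesssim t^{\frac12-s+\delta}\|f\|_{L^{2,s}}\|g\|_{L^{2,s}}$; (3) if $s>1-\frac1q$, $\|u(t)\|_{L^q}\lesssim t^{\frac1q-\frac12+\delta}\|f\|_{L^{2,s}}\|g\|_{L^{2,s}}$.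
   Context: Hypothesis (H): the second derivatives $a'',b'',c''$ are bounded away from zero. $T_m(f,g)(x)=\int_{\mathbb R^2}e^{ix(\xi+\eta)}\widehat f(\xi)\widehat g(\eta)m(\xi,\eta)\,d\xi\,d\eta$; $e^{ita(D)}$ is the Fourier multiplier with symbol $e^{ita(\xi)}$. $u$ solves $i\partial_tu+a(D)u=T_m(v,w)$, $i\partial_tv+b(D)v=0$, $i\partial_tw+c(D)w=0$ with $u(0)=0$, $v(0)=f$, $w(0)=g$. $\|f\|_{L^{2,s}}=\|\langle x\rangle^sf\|_{L^2}$, $\langle x\rangle=\sqrt{1+x^2}$. Implicit constants may depend on $\delta$.
   Formalization: The estimates are proved for t ≥ 1 (large times): as t → 0 one has u(t) ~ -it T_m(f,g), so the stated bounds fail for δ so large that the exponent of t exceeds 1. *)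

(* Defs.v *)
From HB Require Import structures.
From mathcomp Require Import all_boot all_order all_algebra.
From mathcomp Require Import all_classical all_reals all_analysis.
Set Implicit Arguments. Unset Strict Implicit. Unset Printing Implicit Defensive.
Import Order.TTheory GRing.Theory Num.Theory.
Import numFieldNormedType.Exports.
Local Open Scope classical_set_scope.
Local Open Scope ring_scope.

Section Defs.
Variable R : realType.
Local Notation mu := (@lebesgue_measure R).

Definition cmul (z w : R * R) : R * R :=
  (z.1 * w.1 - z.2 * w.2, z.1 * w.2 + z.2 * w.1).
Definition cexpi (th : R) : R * R := (cos th, sin th).
Definition cnorm (z : R * R) : R := Num.sqrt (z.1 ^+ 2 + z.2 ^+ 2).
Definition cI : R * R := (0, 1).
Definition cint (D : set R) (h : R -> R * R) : R * R :=
  (\int[mu]_(x in D) (h x).1, \int[mu]_(x in D) (h x).2).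

Definition cmeasurable (f : R -> R * R) :=
  measurable_fun setT (fun x => (f x).1) /\ measurable_fun setT (fun x => (f x).2).

Definition smooth1 (f : R -> R) := forall n x, derivable (derive1n n f) x 1.

Definition e1 : R * R := (1, 0).
Definition e2 : R * R := (0, 1).
Fixpoint iterD (l : seq bool) (f : R * R -> R * R) : R * R -> R * R :=
  match l with
  | [::] => f
  | d :: l' => fun p => 'D_(if d then e1 else e2) (iterD l' f) p
  end.
Definition smooth2 (m : R * R -> R * R) :=
  forall l p, differentiable (iterD l m) p.

Definition supp (m : R * R -> R * R) := closure [set p | m p != 0].

Definition hypH (a b c : R -> R) :=
  exists k : R, 0 < k /\ forall x,
    k <= `|derive1n 2 a x| /\ k <= `|derive1n 2 b x| /\ k <= `|derive1n 2 c x|.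

Definition phase (a b c : R -> R) (p : R * R) : R := - a (p.1 + p.2) + b p.1 + c p.2.

Definition no_space_res (a b c : R -> R) (m : R * R -> R * R) :=
  forall p, supp m p -> 'D_e1 (phase a b c) p - 'D_e2 (phase a b c) p != 0.

(* Fourier transform, convention hat f(xi) = (2 pi)^{-1} int e^{-i x xi} f(x) dx,
   so that f(x) = int e^{i x xi} hat f(xi) dxi, consistent with the T_m formula.
   For f in L^2 the transform is defined by Plancherel as the L^2 limit of the
   truncated transforms. *)
Definition Ftrunc (f : R -> R * R) (r : R) (xi : R) : R * R :=
  let z := cint [set x | - r <= x <= r] (fun x => cmul (cexpi (- (x * xi))) (f x)) in
  ((2 * pi)^-1 * z.1, (2 * pi)^-1 * z.2).

Definition is_L2_fourier (f fh : R -> R * R) :=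
  cmeasurable fh /\
  (fun n : nat => Lnorm mu 2%:E (fun xi =>
      (cnorm ((Ftrunc f n%:R xi).1 - (fh xi).1, (Ftrunc f n%:R xi).2 - (fh xi).2))%:E))
    @ \oo --> 0%E.

Definition wnorm (s : R) (f : R -> R * R) : \bar R :=
  Lnorm mu 2%:E (fun x => ((1 + x ^+ 2) `^ (s / 2) * cnorm (f x))%:E).

(* Fourier side of the linear flows: hat v(s, xi) = e^{i s b(xi)} hat f(xi) *)
Definition vhat (b : R -> R) (fh : R -> R * R) (s xi : R) : R * R :=
  cmul (cexpi (s * b xi)) (fh xi).

Definition Tm_hat (b c : R -> R) (m : R * R -> R * R) (fh gh : R -> R * R)
    (s zeta : R) : R * R :=
  cint setT (fun xi =>
    cmul (cmul (vhat b fh s xi) (vhat c gh s (zeta - xi))) (m (xi, zeta - xi))).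

(* Duhamel: hat u(t, zeta) = -i int_0^t e^{i(t-s)a(zeta)} hat{T_m(v,w)}(s,zeta) ds *)
Definition uhat (a b c : R -> R) (m : R * R -> R * R) (fh gh : R -> R * R)
    (t zeta : R) : R * R :=
  cmul (0, -1) (cint [set s | 0 <= s <= t] (fun s =>
    cmul (cexpi ((t - s) * a zeta)) (Tm_hat b c m fh gh s zeta))).

Definition usol (a b c : R -> R) (m : R * R -> R * R) (fh gh : R -> R * R)
    (t x : R) : R * R :=
  cint setT (fun zeta => cmul (cexpi (x * zeta)) (uhat a b c m fh gh t zeta)).

Definition inv_exp (q : \bar R) : R :=
  match q with r%:E => r^-1 | _ => 0 end.

Definition uLq (a b c : R -> R) (m : R * R -> R * R) (fh gh : R -> R * R)
    (q : \bar R) (t : R) : \bar R :=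
  Lnorm mu q (fun x => (cnorm (usol a b c m fh gh t x))%:E).

End Defs.

(* Main.v *)
Require Import Defs.
From HB Require Import structures.
From mathcomp Require Import all_boot all_order all_algebra.
From mathcomp Require Import all_classical all_reals all_analysis.
From mathcomp Require Import ring lra measurable_realfun ess_sup_inf.
Set Implicit Arguments. Unset Strict Implicit. Unset Printing Implicit Defensive.
Import Order.TTheory GRing.Theory Num.Theory.
Import numFieldNormedType.Exports.
Local Open Scope classical_set_scope.
Local Open Scope ring_scope.

(* Cut [f] and [g] into finitely many pieces living at distance about [t^mu1] and [t^mu2]
   from the origin, and let [M] be the larger exponent. Without space resonances,
   nonstationary phase makes [T_m(v, w)(s)] negligible once [s] exceeds [t^(M + eps)], so only
   the times [s <= tau], with [tau] about [min(t, t^(M + eps))], matter. On these the curvature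
   of [a] gives the dispersive sup bound [tau t^(-1/2)] and the Strichartz-type L^2 bound
   [tau^(3/4)], while the curvature of [b] or [c] gives the L^2 bound [(tau r)^(1/2)] when [f]
   or [g] lives in the ball of radius [r]. Interpolating between L^2 and L^oo, and using that
   the piece at distance [r] has mass at most [r^(-s)] times the weighted norm, gives (1) and
   (2); (3) is (2) at [s = 1 - 1/q].

   The L^2 bounds are Schur tests on [T T^*] kernels, so they need only integrals of bounded
   functions over bounded sets. General data are reached by truncation: as [m] has compact
   support, [T_m(v, w)] depends uniformly continuously on the restrictions of the Fourier
   transforms of [f] and [g], in L^2, to a bounded interval. *)

(** * Integrals of bounded measurable functions *)

(** Why there are three regimes: write [p = 1/q], and let [k <= M <= 1] be the exponents of a pair
    of pieces. Up to small losses, the times up to [t^M] contribute [t^(M - 1/2)] in L^oo and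
    [t^((M + min(M/2, k))/2)] in L^2. Interpolation and the masses of the pieces then give the power
    [M(1 - p) - 1/2 + p + p min(M/2, k) - (M + k)s], to be maximised over [k] and [M]. In [k] the
    slope is [p - s] up to [M/2] and [-s] beyond, so the worst [k] is [M/2] if [s < p] and [0] if
    [s > p]. The slope in [M] is then [1 - p/2 - 3s/2] in the first case and [1 - p - s] in the
    second, so the worst [M] is [1] until [s] passes [1 - p], and [0] afterwards. The three maxima
    are the three exponents of the theorem, reached at the pairs of scales [(t, t^(1/2))], [(t, 1)]
    and [(1, 1)]. The exponents run through the multiples of a fixed step [eta], so the number of
    pieces is independent of [t], and crude constants in each addition are harmless. *)

Section BoundedMeasurable.
Context (R : realType).
Local Notation mu := (@lebesgue_measure R).

(* On sets of finite measure, bounded measurable functions are integrable: linearity and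
   Fubini's theorem then hold without integrability conditions. *)
Definition finm (D : set R) := measurable D /\ (mu D < +oo)%E.

Definition bm d (T : measurableType d) (h : T -> R) :=
  measurable_fun setT h /\ exists M : R, forall x, `|h x| <= M.

Section Closure.
Context d (T : measurableType d).
Implicit Types h k : T -> R.

Lemma bm_meas h : bm h -> measurable_fun setT h.
Proof. by case. Qed.

Lemma bm_bound h : bm h -> exists2 M : R, 0 < M & forall x, `|h x| <= M.
Proof.
move=> [_ [M hM]]; exists (`|M| + 1); first by rewrite ltr_wpDl.
by move=> x; rewrite (le_trans (hM x))// (le_trans (ler_norm M))// lerDl.
Qed.

Lemma bm_cst (c : R) : bm (fun _ : T => c).
Proof. by split; [exact: measurable_cst|exists `|c|]. Qed.

Lemma bmD h k : bm h -> bm k -> bm (fun x => h x + k x).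
Proof.
move=> [mh [M hM]] [mk [N kN]]; split; first exact: measurable_funD.
by exists (M + N) => x; rewrite (le_trans (ler_normD _ _))// lerD.
Qed.

Lemma bmN h : bm h -> bm (fun x => - h x).
Proof.
move=> [mh [M hM]]; split; first exact: measurableT_comp.
by exists M => x; rewrite normrN.
Qed.

Lemma bmB h k : bm h -> bm k -> bm (fun x => h x - k x).
Proof. by move=> bh bk; apply: bmD => //; exact: bmN. Qed.

Lemma bmM h k : bm h -> bm k -> bm (fun x => h x * k x).
Proof.
move=> [mh [M hM]] [mk [N kN]]; split; first exact: measurable_funM.
by exists (M * N) => x; rewrite normrM ler_pM.
Qed.

Lemma bmX h n : bm h -> bm (fun x => h x ^+ n).
Proof.
move=> bh; elim: n => [|n ih]; first exact: bm_cst.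
rewrite (_ : (fun _ => _) = (fun x => h x * h x ^+ n)); last first.
  by apply/funext => x; rewrite exprS.
exact: bmM.
Qed.

Lemma bm_norm h : bm h -> bm (fun x => `|h x|).
Proof.
move=> [mh [M hM]]; split; first exact: measurableT_comp.
by exists M => x; rewrite normr_id.
Qed.

Lemma bm_cos h : measurable_fun setT h -> bm (fun x => cos (h x)).
Proof.
move=> mh; split; last by exists 1 => x; rewrite ler_norml cos_geN1 cos_le1.
apply: measurableT_comp => //; apply: continuous_measurable_fun.
exact: continuous_cos.
Qed.

Lemma bm_sin h : measurable_fun setT h -> bm (fun x => sin (h x)).
Proof.
move=> mh; split; last by exists 1 => x; rewrite ler_norml sin_geN1 sin_le1.
apply: measurableT_comp => //; apply: continuous_measurable_fun.
exact: continuous_sin.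
Qed.

Lemma bm_comp d' (T' : measurableType d') h (g : T' -> T) :
  bm h -> measurable_fun setT g -> bm (fun x => h (g x)).
Proof.
move=> [mh [M hM]] mg; split; first exact: measurableT_comp.
by exists M.
Qed.

End Closure.

Lemma bm_integrable (h : R -> R) D :
  bm h -> finm D -> mu.-integrable D (EFin \o h).
Proof.
move=> [mh [M hM]] [mD fD]; apply: measurable_bounded_integrable => //.
  exact: measurable_funTS.
exists M; split; first exact: num_real.
by move=> y My x _ /=; rewrite (le_trans (hM x))// ltW.
Qed.

Section Linear.
Context (D : set R).
Hypothesis fD : finm D.
Implicit Types h k : R -> R.

Let mD : measurable D. Proof. by case: fD. Qed.

Lemma rID h k : bm h -> bm k ->
  \int[mu]_(x in D) (h x + k x) = \int[mu]_(x in D) h x + \int[mu]_(x in D) k x.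
Proof. by move=> bh bk; apply: RintegralD => //; exact: bm_integrable. Qed.

Lemma rIB h k : bm h -> bm k ->
  \int[mu]_(x in D) (h x - k x) = \int[mu]_(x in D) h x - \int[mu]_(x in D) k x.
Proof. by move=> bh bk; apply: RintegralB => //; exact: bm_integrable. Qed.

Lemma rIZ h (r : R) : bm h ->
  \int[mu]_(x in D) (r * h x) = r * \int[mu]_(x in D) h x.
Proof. by move=> bh; apply: RintegralZl => //; exact: bm_integrable. Qed.

Lemma rIZr h (r : R) : bm h ->
  \int[mu]_(x in D) (h x * r) = (\int[mu]_(x in D) h x) * r.
Proof. by move=> bh; apply: RintegralZr => //; exact: bm_integrable. Qed.

Lemma rI_le h k : bm h -> bm k -> (forall x, D x -> h x <= k x) ->
  \int[mu]_(x in D) h x <= \int[mu]_(x in D) k x.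
Proof. by move=> bh bk hk; apply: (@le_Rintegral _ _ _ mu D h k mD) => //; exact: bm_integrable. Qed.

Lemma rI_abs h : bm h ->
  `|\int[mu]_(x in D) h x| <= \int[mu]_(x in D) `|h x|.
Proof. by move=> bh; apply: le_normr_Rintegral => //; exact: bm_integrable. Qed.

Lemma rI_cst (c : R) : \int[mu]_(x in D) c = c * fine (mu D).
Proof. exact: Rintegral_cst. Qed.

End Linear.

Lemma bm_rI d (T : measurableType d) (k : T * R -> R) D :
  bm k -> finm D -> bm (fun p => \int[mu]_(y in D) k (p, y)).
Proof.
move=> bk fD; have [M M0 hM] := bm_bound bk; have [mD mDoo] := fD.
have bs p : bm (fun y => k (p, y)).
  by apply: (bm_comp bk); exact: measurable_pair1.
split; last first.
  exists (M * fine (mu D)) => p; rewrite (le_trans (rI_abs fD (bs p)))//.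
  rewrite -(rI_cst fD); apply: rI_le => //; first exact: bm_norm.
  exact: bm_cst.
(* Adding [M] makes the integrand nonnegative, so that Tonelli's theorem gives measurability in [p];
   the constant is subtracted again at the end. *)
pose f (z : T * R) := ((k z + M) * \1_D z.2)%:E.
have mf : measurable_fun setT f.
  apply/measurable_EFinP; apply: measurable_funM.
    by apply: measurable_funD => //; case: bk.
  by apply: measurableT_comp => //; exact: measurable_indic.
have f0 z : (0 <= f z)%E.
  rewrite lee_fin mulr_ge0// -lerBlDr sub0r.
  by have := hM z; rewrite ler_norml => /andP[].
have mF : measurable_fun setT (fubini_F mu f) by exact: measurable_fun_fubini_tonelli_F.
have FE p : fubini_F mu f p = (\int[mu]_(y in D) k (p, y) + M * fine (mu D))%:E.
  rewrite /fubini_F /f -(rI_cst fD) -rID//; last exact: bm_cst.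
  rewrite /Rintegral fineK; last first.
    by apply: integrable_fin_num => //; apply: bm_integrable => //;
      apply: bmD => //; exact: bm_cst.
  rewrite [RHS]integral_mkcond; apply: eq_integral => y _.
  by rewrite patchE indicE; case: ifPn => _; rewrite ?mulr1 ?mulr0.
have -> : (fun p => \int[mu]_(y in D) k (p, y)) =
    (fun p => fine (fubini_F mu f p) - M * fine (mu D)).
  by apply/funext => p; rewrite FE/= addrK.
apply: measurable_funB; last exact: measurable_cst.
by apply/measurable_EFinP; apply: eq_measurable_fun mF => p _; rewrite /= FE.
Qed.

Lemma bm_restr (k : R * R -> R) D1 D2 : bm k -> finm D1 -> finm D2 ->
  (mu \x mu)%E.-integrable setT
    (fun z => (k z * (\1_D1 z.1 * \1_D2 z.2))%:E).
Proof.
move=> bk [mD1 f1] [mD2 f2]; have [M M0 hM] := bm_bound bk.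
have mi : measurable_fun setT (fun z : R * R => \1_D1 z.1 * \1_D2 z.2 : R).
  by apply: measurable_funM; apply: measurableT_comp => //; exact: measurable_indic.
apply/integrableP; split.
  by apply/measurable_EFinP; apply: measurable_funM => //; case: bk.
have ae1 (x : R) (A : set R) : 0 <= \1_A x :> R by rewrite indicE.
apply: (@le_lt_trans _ _ (\int[(mu \x mu)%E]_z (M%:E * (\1_D1 z.1 * \1_D2 z.2)%:E))%E).
  apply: ge0_le_integral => //.
  - apply: measurableT_comp => //; apply/measurable_EFinP.
    by apply: measurable_funM => //; case: bk.
  - by apply/measurable_funeM/measurable_EFinP.
  - by move=> z _; rewrite lee_fin normrM (@ger0_norm _ (_ * _)) ?mulr_ge0// ler_wpM2r// mulr_ge0.
rewrite fubini_tonelli1//=; last 2 first.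
- by apply/measurable_funeM/measurable_EFinP.
- by move=> z; rewrite mule_ge0// ?lee_fin ?mulr_ge0// ltW.
have mD (D : set R) : measurable D -> measurable_fun setT (fun y : R => (\1_D y)%:E : \bar R).
  by move=> mD; apply/measurable_EFinP; exact: measurable_indic.
have E (c : R) (D : set R) : measurable D -> 0 <= c ->
    (\int[mu]_y (c%:E * (\1_D y)%:E) = c%:E * mu D)%E.
  move=> mD' c0; rewrite ge0_integralZl//; last exact: mD.
  by rewrite integral_indic// setIT.
have mu0 : (0 <= M%:E * mu D2)%E by rewrite mule_ge0// lee_fin ltW.
have muf : (M%:E * mu D2 < +oo)%E by rewrite lte_mul_pinfty// lee_fin ltW.
rewrite /fubini_F.
rewrite [X in (X < _)%E](_ : _ = \int[mu]_x ((fine (M%:E * mu D2))%:E * (\1_D1 x)%:E)%E)%E.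
  rewrite E//; last exact: fine_ge0.
  by rewrite lte_mul_pinfty// lee_fin fine_ge0.
apply: eq_integral => x _; rewrite fineK ?ge0_fin_numE//.
rewrite muleAC -EFinM -E ?mulr_ge0 ?(ltW M0)//.
by apply: eq_integral => y _; rewrite /= -!EFinM mulrA.
Qed.

Lemma rI_fubini (k : R * R -> R) D1 D2 : bm k -> finm D1 -> finm D2 ->
  \int[mu]_(x in D1) \int[mu]_(y in D2) k (x, y) =
  \int[mu]_(y in D2) \int[mu]_(x in D1) k (x, y).
Proof.
move=> bk fD1 fD2.
have b1 x : bm (fun y => k (x, y)) by apply: (bm_comp bk); exact: measurable_pair1.
have b2 y : bm (fun x => k (x, y)) by apply: (bm_comp bk); exact: measurable_pair2.
have Fi := bm_restr bk fD1 fD2.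
have := Fubini Fi; rewrite /fubini_F /fubini_G => E.
congr fine.
rewrite [LHS]integral_mkcond [RHS]integral_mkcond.
transitivity (\int[mu]_x \int[mu]_y (k (x, y) * (\1_D1 x * \1_D2 y))%:E)%E.
  apply: eq_integral => x _; rewrite patchE; case: ifPn => xD.
    rewrite /Rintegral fineK; last first.
      by apply: integrable_fin_num; [case: fD2|exact: bm_integrable].
    rewrite integral_mkcond; apply: eq_integral => y _.
    by rewrite patchE [\1_D1 x]indicE xD mul1r indicE; case: ifPn; rewrite ?mulr1 ?mulr0.
  by apply/esym/integral0_eq => y _; rewrite indicE (negbTE xD) mul0r mulr0.
rewrite E; apply: eq_integral => y _; rewrite patchE; case: ifPn => yD.
  rewrite /Rintegral fineK; last first.
    by apply: integrable_fin_num; [case: fD1|exact: bm_integrable].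
  rewrite integral_mkcond; apply: eq_integral => x _.
  by rewrite patchE [\1_D2 y]indicE yD mulr1 indicE; case: ifPn; rewrite ?mulr1 ?mulr0.
by apply/integral0_eq => x _; rewrite [\1_D2 y]indicE (negbTE yD) !mulr0.
Qed.

Lemma lebesgue_measure_shift (c : R) (A : set R) : measurable A ->
  pushforward mu ((fun x => x + c) : R -> measurableTypeR R) A = mu A.
Proof.
move=> mA.
have mc : measurable_fun [set: measurableTypeR R] ((fun x : R => x + c) : measurableTypeR R -> measurableTypeR R).
  by apply: measurable_funD.
apply/esym/(@lebesgue_measure_unique R
  (measure_function_pushforward__canonical__measure_function_Measure mu mc))
  => //= _ [[a b]] _ <-.
rewrite /pushforward.
have -> : (fun x => x + c) @^-1` `]a, b]%classic = `]a - c, b - c]%classic.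
  by apply/seteqP; split => x; rewrite /= !in_itv/= ltrBlDr lerBrDr.
rewrite !lebesgue_measure_itv/= !lte_fin ltrD2r.
by case: ifPn => // _; rewrite -!EFinB; congr EFin; ring.
Qed.

Lemma rI_shift (h : R -> R) (c : R) (D : set R) : bm h -> finm D ->
  \int[mu]_(x in (fun x => x + c) @^-1` D) h (x + c) = \int[mu]_(x in D) h x.
Proof.
move=> bh fD; have [mD muD] := fD; congr fine.
have mc : measurable_fun [set: measurableTypeR R] ((fun x : R => x + c) : measurableTypeR R -> measurableTypeR R).
  by apply: measurable_funD.
have mD' : measurable ((fun x => x + c) @^-1` D).
  by rewrite -[X in measurable X]setTI; exact: mc.
transitivity (\int[measure_function_pushforward__canonical__measure_function_Measure mu mc]_(x in D) (h x)%:E)%E.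
  have mh : measurable_fun [set: measurableTypeR R] (EFin \o h) by apply/measurable_EFinP; case: bh.
  apply/esym/(@integral_pushforward _ _ _ _ R _ mc mu D (EFin \o h) mh) => //.
  apply: (@bm_integrable (fun x => h (x + c)) ((fun x => x + c) @^-1` D)).
    by apply: (bm_comp bh); exact: measurable_funD.
  split => //; have := lebesgue_measure_shift c mD.
  by rewrite /pushforward => ->.
by apply: eq_measure_integral => A mA _; exact: lebesgue_measure_shift.
Qed.

Lemma rI_oppr (h : R -> R) (D : set R) : bm h -> finm D ->
  \int[mu]_(x in -%R @^-1` D) h (- x) = \int[mu]_(x in D) h x.
Proof.
move=> bh fD; have [mD muD] := fD; congr fine.
have mc : measurable_fun [set: measurableTypeR R] (-%R : measurableTypeR R -> measurableTypeR R) by [].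
have mD' : measurable (-%R @^-1` D : set R).
  by rewrite -[X in measurable X]setTI; exact: mc.
transitivity (\int[measure_function_pushforward__canonical__measure_function_Measure mu mc]_(x in D) (h x)%:E)%E.
  have mh : measurable_fun [set: measurableTypeR R] (EFin \o h) by apply/measurable_EFinP; case: bh.
  apply/esym/(@integral_pushforward _ _ _ _ R _ mc mu D (EFin \o h) mh) => //.
  apply: (@bm_integrable (fun x => h (- x)) (-%R @^-1` D)); first exact: (bm_comp bh).
  split => //; have := lebesgue_measureN mD.
  by rewrite /pushforward => ->.
by apply: eq_measure_integral => A mA _; exact: lebesgue_measureN.
Qed.

End BoundedMeasurable.

(** * Complex numbers as pairs of reals, and their integrals *)

Ltac cring := rewrite /cmul /=; congr (_, _); rewrite /=; ring.

Section ComplexPairs.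
Context (R : realType).
Local Notation C := (R * R)%type.
Implicit Types z w : C.

Definition cconj z : C := (z.1, - z.2).

Lemma cmulC z w : cmul z w = cmul w z. Proof. by cring. Qed.
Lemma cmulA z w v : cmul z (cmul w v) = cmul (cmul z w) v. Proof. by cring. Qed.
Lemma cmulCA z w v : cmul z (cmul w v) = cmul w (cmul z v). Proof. by cring. Qed.
Lemma cmulAC z w v : cmul (cmul z w) v = cmul (cmul z v) w. Proof. by cring. Qed.
Lemma cmulACA z w v u : cmul (cmul z w) (cmul v u) = cmul (cmul z v) (cmul w u).
Proof. by cring. Qed.
Lemma cmul1 z : cmul (1, 0) z = z. Proof. by case: z => x y; cring. Qed.
Lemma cmul0 z : cmul 0 z = 0. Proof. by cring. Qed.
Lemma cmulz0 z : cmul z 0 = 0. Proof. by cring. Qed.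

Lemma cconjM z w : cconj (cmul z w) = cmul (cconj z) (cconj w).
Proof. by rewrite /cconj; cring. Qed.

Lemma cexpiD (x y : R) : cexpi (x + y) = cmul (cexpi x) (cexpi y).
Proof. by rewrite /cexpi /cmul /= cosD sinD; congr (_, _); ring. Qed.

Lemma cconj_expi (x : R) : cconj (cexpi x) = cexpi (- x).
Proof. by rewrite /cconj /cexpi /= cosN sinN. Qed.

Lemma cnorm_ge0 z : 0 <= cnorm z. Proof. exact: sqrtr_ge0. Qed.
Hint Extern 0 (is_true (0 <= cnorm _)) => solve [exact: cnorm_ge0] : core.

Lemma cnorm_sq z : cnorm z ^+ 2 = z.1 ^+ 2 + z.2 ^+ 2.
Proof. by rewrite sqr_sqrtr// addr_ge0// sqr_ge0. Qed.

Lemma cnormM z w : cnorm (cmul z w) = cnorm z * cnorm w.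
Proof.
rewrite /cnorm -sqrtrM ?addr_ge0 ?sqr_ge0//; congr Num.sqrt.
by rewrite /cmul /=; ring.
Qed.

Lemma cnorm_expi (x : R) : cnorm (cexpi x) = 1.
Proof. by rewrite /cnorm /cexpi /= cos2Dsin2 sqrtr1. Qed.

Lemma cnorm_expiM (x : R) z : cnorm (cmul (cexpi x) z) = cnorm z.
Proof. by rewrite cnormM cnorm_expi mul1r. Qed.

Lemma cnorm_conj z : cnorm (cconj z) = cnorm z.
Proof. by rewrite /cnorm /= sqrrN. Qed.

Lemma cnormN z : cnorm (- z) = cnorm z.
Proof. by rewrite /cnorm /= !sqrrN. Qed.

Lemma cnorm0 : cnorm (0 : C) = 0.
Proof. by rewrite /cnorm /= expr0n /= addr0 sqrtr0. Qed.

Lemma cnorm_real (x : R) : cnorm (x, 0) = `|x|.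
Proof. by rewrite /cnorm /= expr0n /= addr0 sqrtr_sqr. Qed.

Lemma cnorm_mi z : cnorm (cmul (0, -1) z) = cnorm z.
Proof.
rewrite cnormM (_ : cnorm (0, -1) = 1) ?mul1r//.
by rewrite /cnorm /= expr0n /= add0r sqrrN expr1n sqrtr1.
Qed.

Lemma cmul_conj z : cmul z (cconj z) = (cnorm z ^+ 2, 0).
Proof. by rewrite cnorm_sq; case: z => x y; rewrite /cconj; cring. Qed.

Lemma re_le_cnorm z : `|z.1| <= cnorm z.
Proof. by rewrite -sqrtr_sqr ler_wsqrtr// lerDl sqr_ge0. Qed.

Lemma im_le_cnorm z : `|z.2| <= cnorm z.
Proof. by rewrite -sqrtr_sqr ler_wsqrtr// lerDr sqr_ge0. Qed.

Lemma cnorm_le z : cnorm z <= `|z.1| + `|z.2|.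
Proof.
rewrite -(@ler_pXn2r _ 2) ?nnegrE ?addr_ge0// cnorm_sq sqrrD !real_normK ?num_real//.
by rewrite lerD2r lerDl mulrn_wge0// mulr_ge0.
Qed.

Lemma re_mul_le z w : z.1 * w.1 + z.2 * w.2 <= cnorm z * cnorm w.
Proof.
have := re_le_cnorm (cmul (cconj z) w); rewrite cnormM cnorm_conj; apply: le_trans.
by apply: le_trans (ler_norm _); rewrite /cmul /=; lra.
Qed.

Lemma cnormD z w : cnorm (z + w) <= cnorm z + cnorm w.
Proof.
rewrite -(@ler_pXn2r _ 2) ?nnegrE ?addr_ge0// sqrrD (cnorm_sq (z + w)) !cnorm_sq.
by have := re_mul_le z w; rewrite -mulr_natr /=; lra.
Qed.

Lemma cnormB z w : cnorm (z - w) <= cnorm z + cnorm w.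
Proof. by rewrite -(cnormN w) cnormD. Qed.

Lemma cnormBC z w : cnorm (z - w) = cnorm (w - z).
Proof. by rewrite -cnormN opprB. Qed.

End ComplexPairs.
#[global] Hint Extern 0 (is_true (0 <= cnorm _)) => solve [exact: cnorm_ge0] : core.

Section ComplexIntegral.
Context (R : realType).
Local Notation C := (R * R)%type.
Local Notation mu := (@lebesgue_measure R).

Definition cbm d (T : measurableType d) (h : T -> C) :=
  bm (fun x => (h x).1) /\ bm (fun x => (h x).2).

Section Closure.
Context d (T : measurableType d).
Implicit Types h k : T -> C.

Lemma cbm_cst (c : C) : cbm (fun _ : T => c).
Proof. by split; exact: bm_cst. Qed.

Lemma cbmD h k : cbm h -> cbm k -> cbm (fun x => h x + k x).
Proof. by move=> [h1 h2] [k1 k2]; split => /=; exact: bmD. Qed.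

Lemma cbmB h k : cbm h -> cbm k -> cbm (fun x => h x - k x).
Proof. by move=> [h1 h2] [k1 k2]; split => /=; exact: bmB. Qed.

Lemma cbmM h k : cbm h -> cbm k -> cbm (fun x => cmul (h x) (k x)).
Proof.
move=> [h1 h2] [k1 k2]; split => /=.
  by apply: bmB; exact: bmM.
by apply: bmD; exact: bmM.
Qed.

Lemma cbm_conj h : cbm h -> cbm (fun x => cconj (h x)).
Proof. by move=> [h1 h2]; split => //=; exact: bmN. Qed.

Lemma cbm_expi (th : T -> R) : measurable_fun setT th -> cbm (fun x => cexpi (th x)).
Proof. by move=> mth; split => /=; [exact: bm_cos|exact: bm_sin]. Qed.

Lemma cbm_real (h : T -> R) : bm h -> cbm (fun x => (h x, 0)).
Proof. by move=> bh; split => //=; exact: bm_cst. Qed.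

Lemma cbm_comp d' (T' : measurableType d') h (g : T' -> T) :
  cbm h -> measurable_fun setT g -> cbm (fun x => h (g x)).
Proof. by move=> [h1 h2] mg; split; [apply: (bm_comp h1)|apply: (bm_comp h2)]. Qed.

Lemma cbm_bound h : cbm h -> exists2 M : R, 0 < M & forall x, cnorm (h x) <= M.
Proof.
move=> [/bm_bound[M M0 hM] /bm_bound[N N0 hN]]; exists (M + N); first exact: addr_gt0.
by move=> x; rewrite (le_trans (cnorm_le _))// lerD.
Qed.

Lemma cbm_norm h : cbm h -> bm (fun x => cnorm (h x)).
Proof.
move=> bh; split; last first.
  have [M M0 hM] := cbm_bound bh; exists M => x.
  by rewrite ger0_norm//; exact: cnorm_ge0.
apply: (measurableT_comp (f := @Num.sqrt R)).
  by apply: continuous_measurable_fun; exact: sqrt_continuous.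
by case: bh => b1 b2; apply: measurable_funD; apply: bm_meas; exact: bmX.
Qed.

Lemma cbm_norm2 h : cbm h -> bm (fun x => cnorm (h x) ^+ 2).
Proof. by move=> bh; apply: bmX; exact: cbm_norm. Qed.

End Closure.

Definition n2 (D : set R) (h : R -> C) := \int[mu]_(x in D) (cnorm (h x) ^+ 2).

Lemma n2_ge0 D h : 0 <= n2 D h.
Proof. by apply: Rintegral_ge0 => x _; exact: sqr_ge0. Qed.

Lemma eq_cint D (h k : R -> C) : (forall x, D x -> h x = k x) -> cint D h = cint D k.
Proof.
by move=> hk; congr (_, _); apply: eq_Rintegral => x /set_mem Dx; rewrite hk.
Qed.

Lemma cint_mkcond D (h : R -> C) : cint D h = cint setT (h \_ D).
Proof.
rewrite /cint; congr (_, _); rewrite Rintegral_mkcond; apply: eq_Rintegral => x _;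
 by rewrite !patchE; case: ifPn.
Qed.

Lemma cint_supp D D' (h : R -> C) : D `<=` D' -> (forall x, D' x -> ~ D x -> h x = 0) ->
  cint D h = cint D' h.
Proof.
move=> DD' h0; rewrite cint_mkcond [RHS]cint_mkcond; apply: eq_cint => x _.
rewrite !patchE; case: ifPn => [/set_mem/DD'/mem_set->//|xD].
by case: ifPn => // /set_mem xD'; rewrite h0// => /mem_set; apply/negP.
Qed.

Section Linear.
Context (D : set R).
Hypothesis fD : finm D.
Implicit Types h k : R -> C.

Lemma cintD h k : cbm h -> cbm k ->
  cint D (fun x => h x + k x) = cint D h + cint D k.
Proof. by move=> [h1 h2] [k1 k2]; rewrite /cint /= !rID. Qed.

Lemma cintB h k : cbm h -> cbm k ->
  cint D (fun x => h x - k x) = cint D h - cint D k.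
Proof. by move=> [h1 h2] [k1 k2]; rewrite /cint /= !rIB. Qed.

Lemma cintZ h z : cbm h -> cint D (fun x => cmul z (h x)) = cmul z (cint D h).
Proof.
move=> [h1 h2]; rewrite /cint /cmul /= rIB ?rID ?rIZ//;
 by apply: bmM => //; exact: bm_cst.
Qed.

Lemma cintZr h z : cbm h -> cint D (fun x => cmul (h x) z) = cmul (cint D h) z.
Proof. by move=> bh; rewrite cmulC -cintZ//; apply: eq_cint => x _; rewrite cmulC. Qed.

Lemma cint_conj h : cbm h -> cint D (fun x => cconj (h x)) = cconj (cint D h).
Proof.
move=> [h1 h2]; rewrite /cint /cconj /=; congr (_, _).
rewrite -mulN1r -rIZ//; apply: eq_Rintegral => x _; by rewrite mulN1r.
Qed.

Lemma cint_real (h : R -> R) : bm h ->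
  cint D (fun x => (h x, 0)) = (\int[mu]_(x in D) h x, 0).
Proof. by move=> bh; rewrite /cint /= rI_cst// mul0r. Qed.

Lemma cint_norm h : cbm h -> cnorm (cint D h) <= \int[mu]_(x in D) cnorm (h x).
Proof.
move=> bh; set z := cint D h.
have [z0|] := eqVneq (cnorm z) 0; first by rewrite z0; apply: Rintegral_ge0.
rewrite neq_lt ltNge cnorm_ge0 /= => z0.
(* Multiplied by [|z|], the left side becomes [|z|^2], the integral of the real part of [conj z]
   times [h]; what remains is a pointwise inequality. *)
rewrite -(ler_pM2l z0) -expr2 cnorm_sq.
have [h1 h2] := bh.
rewrite -rIZ//; last exact: cbm_norm.
have b1 : bm (fun x => z.1 * (h x).1) by apply: bmM => //; exact: bm_cst.
have b2 : bm (fun x => z.2 * (h x).2) by apply: bmM => //; exact: bm_cst.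
have -> : z.1 ^+ 2 + z.2 ^+ 2 =
    \int[mu]_(x in D) (z.1 * (h x).1 + z.2 * (h x).2).
  by rewrite rID// !rIZ.
apply: rI_le => //; first exact: bmD.
  by apply: bmM; [exact: bm_cst|exact: cbm_norm].
by move=> x _; exact: re_mul_le.
Qed.

Lemma cint_le h (M : R) : cbm h -> (forall x, D x -> cnorm (h x) <= M) ->
  cnorm (cint D h) <= M * fine (mu D).
Proof.
move=> bh hM; rewrite (le_trans (cint_norm bh))// -rI_cst//.
by apply: rI_le => //; [exact: cbm_norm|exact: bm_cst].
Qed.

(** The integral of [(r u + t v)^2] is a nonnegative quadratic form in [(r, t)]. Its value at
    [(E, -B)] settles the case [E > 0], its value at [(-B, A)] the case [A > 0], and its values at
    [(1, 1)] and [(1, -1)] force [B = 0] when both vanish. *)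
Lemma rI_cauchy_schwarz (u v : R -> R) : bm u -> bm v ->
  (\int[mu]_(x in D) (u x * v x)) ^+ 2 <=
  (\int[mu]_(x in D) (u x ^+ 2)) * (\int[mu]_(x in D) (v x ^+ 2)).
Proof.
move=> bu bv; set A := (\int[mu]_(x in D) (u x ^+ 2)); set B := \int[mu]_(x in D) _.
set E := (X in _ * X).
have key (r t : R) : 0 <= r ^+ 2 * A + (r * t *+ 2) * B + t ^+ 2 * E.
  have : 0 <= \int[mu]_(x in D) ((r * u x + t * v x) ^+ 2).
    by apply: Rintegral_ge0 => x _; exact: sqr_ge0.
  suff -> : \int[mu]_(x in D) ((r * u x + t * v x) ^+ 2) =
      r ^+ 2 * A + (r * t *+ 2) * B + t ^+ 2 * E by [].
  rewrite /A /B /E -!rIZ//; try by [exact: bmX|exact: bmM].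
  rewrite -!rID//; try by do ?[apply: bmD|apply: bmM|apply: bmX|exact: bm_cst].
  by apply: eq_Rintegral => x _; ring.
have A0 : 0 <= A by apply: Rintegral_ge0 => x _; exact: sqr_ge0.
have E0 : 0 <= E by apply: Rintegral_ge0 => x _; exact: sqr_ge0.
clearbody A B E.
have [Epos|] := ltP 0 E.
  have := key E (- B); rewrite -mulr_natr => h.
  have : 0 <= E * (A * E - B ^+ 2) by lra.
  by rewrite pmulr_rge0// subr_ge0.
move=> E0'; have EE : E = 0 by apply/eqP; rewrite eq_le E0'.
have [Apos|] := ltP 0 A.
  have := key (- B) A; rewrite -mulr_natr => h.
  have : 0 <= A * (A * E - B ^+ 2) by lra.
  by rewrite pmulr_rge0// subr_ge0.
move=> A0'; have AA : A = 0 by apply/eqP; rewrite eq_le A0'.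
have h1 := key 1 1; have h2 := key 1 (-1).
move: h1 h2; rewrite EE AA !mulr2n => h1 h2.
have -> : B = 0 by lra.
by rewrite expr0n /= mulr0.
Qed.

Lemma cint_cauchy_schwarz h k : cbm h -> cbm k ->
  cnorm (cint D (fun x => cmul (h x) (k x))) ^+ 2 <= n2 D h * n2 D k.
Proof.
move=> bh bk.
have b1 := cbm_norm bh; have b2 := cbm_norm bk.
apply: le_trans (rI_cauchy_schwarz b1 b2).
have P0 : 0 <= \int[mu]_(x in D) (cnorm (h x) * cnorm (k x)).
  by apply: Rintegral_ge0 => x _; exact: mulr_ge0.
apply: lerXn2r; rewrite ?nnegrE ?cnorm_ge0//.
rewrite (le_trans (cint_norm (cbmM bh bk)))//.
by under eq_Rintegral do rewrite cnormM.
Qed.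

End Linear.

Lemma cbm_cint d (T : measurableType d) (k : T * R -> C) D :
  cbm k -> finm D -> cbm (fun p => cint D (fun y => k (p, y))).
Proof. by move=> [k1 k2] fD; split; [exact: (bm_rI k1)|exact: (bm_rI k2)]. Qed.

Lemma cint_fubini (k : R * R -> C) D1 D2 : cbm k -> finm D1 -> finm D2 ->
  cint D1 (fun x => cint D2 (fun y => k (x, y))) =
  cint D2 (fun y => cint D1 (fun x => k (x, y))).
Proof.
move=> [k1 k2] f1 f2; rewrite {1 3}/cint /=; congr (_, _).
  exact: (rI_fubini k1).
exact: (rI_fubini k2).
Qed.

Lemma cbm1 (k : R * R -> C) y : cbm k -> cbm (fun x => k (x, y)).
Proof. by move=> bk; apply: (cbm_comp bk); exact: measurable_pair2. Qed.

Lemma cbm2 (k : R * R -> C) x : cbm k -> cbm (fun y => k (x, y)).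
Proof. by move=> bk; apply: (cbm_comp bk); exact: measurable_pair1. Qed.

Lemma bm_swap (k : R * R -> R) : bm k -> bm (fun p => k (p.2, p.1)).
Proof. by move=> bk; apply: (bm_comp bk); exact: measurable_swap. Qed.

Lemma cbm_swap (k : R * R -> C) : cbm k -> cbm (fun p => k (p.2, p.1)).
Proof. by move=> bk; apply: (cbm_comp bk); exact: measurable_swap. Qed.

End ComplexIntegral.

(** * The Schur test *)

Ltac mft_step :=
  match goal with
  | H : ?P |- ?P => exact: H
  | |- measurable_fun _ (fun x => x) => exact: measurable_id
  | |- measurable_fun _ (fun x => x.1) => exact: measurable_fst
  | |- measurable_fun _ (fun x => x.2) => exact: measurable_snd
  | |- measurable_fun _ (fun _ => ?c) => exact: measurable_cst
  | |- measurable_fun _ (fun x => (@?f x).1) => apply: (measurableT_comp measurable_fst)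
  | |- measurable_fun _ (fun x => (@?f x).2) => apply: (measurableT_comp measurable_snd)
  | |- measurable_fun _ (fun x => (@?f x, @?g x)) => apply: measurable_fun_pair
  | |- measurable_fun ?D (+%R ?c) => apply: (@measurable_funD _ _ _ D (fun _ => c) (fun x => x))
  | |- measurable_fun ?D ( *%R ?c) => apply: (@measurable_funM _ _ _ D (fun _ => c) (fun x => x))
  | |- measurable_fun _ (fun x => @?f x + @?g x) => apply: measurable_funD
  | |- measurable_fun _ (fun x => - (@?f x)) => apply: measurable_funN
  | |- measurable_fun _ (fun x => @?f x * @?g x) => apply: measurable_funM
  | |- measurable_fun _ (fun x => @?f x ^+ 2) => apply: measurable_funX
  | |- measurable_fun _ (fun x => ?a (@?g x)) =>
      match goal with H : measurable_fun _ a |- _ => apply: (measurableT_comp H) end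
  end.
Ltac mft := repeat mft_step.

Ltac bmt_step :=
  match goal with
  | H : ?P |- ?P => exact: H
  | |- cbm (fun _ => ?c) => exact: cbm_cst
  | |- bm (fun _ => ?c) => exact: bm_cst
  | |- cbm (fun x => cmul (@?f x) (@?g x)) => apply: cbmM
  | |- cbm (fun x => @?f x - @?g x) => apply: cbmB
  | |- cbm (fun x => @?f x + @?g x) => apply: cbmD
  | |- cbm (fun x => cconj (@?f x)) => apply: cbm_conj
  | |- cbm (fun x => cexpi (@?f x)) => apply: cbm_expi
  | |- cbm (fun x => (@?f x, 0)) => apply: cbm_real
  | |- bm (fun x => cnorm (@?f x) ^+ 2) => apply: cbm_norm2
  | |- bm (fun x => cnorm (@?f x)) => apply: cbm_norm
  | |- bm (fun x => `| @?f x |) => apply: bm_norm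
  | |- bm (fun x => @?f x - @?g x) => apply: bmB
  | |- bm (fun x => @?f x + @?g x) => apply: bmD
  | |- bm (fun x => @?f x * @?g x) => apply: bmM
  | |- bm (fun x => @?f x ^+ _) => apply: bmX
  | |- bm (fun x => - (@?f x)) => apply: bmN
  | |- bm (fun x => cos (@?f x)) => apply: bm_cos
  | |- bm (fun x => sin (@?f x)) => apply: bm_sin
  | |- cbm (fun x => ?h (@?g x)) =>
      match goal with H : cbm h |- _ => apply: (cbm_comp H) end
  | |- bm (fun x => ?h (@?g x)) =>
      match goal with H : bm h |- _ => apply: (bm_comp H) end
  end.
Ltac bmt := repeat (bmt_step || mft_step).

Section Schur.
Context (R : realType).
Local Notation C := (R * R)%type.
Local Notation mu := (@lebesgue_measure R).

Lemma cbm_cint1 (k : R * R -> C) D : cbm k -> finm D ->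
  cbm (fun x => cint D (fun y => k (x, y))).
Proof. exact: cbm_cint. Qed.

Lemma cbm_cint2 (k : R * R -> C) D : cbm k -> finm D ->
  cbm (fun y => cint D (fun x => k (x, y))).
Proof. by move=> bk; apply: (cbm_cint (cbm_swap bk)). Qed.

(* [W conj W] is expanded so that the [y]-integral falls on [k(x,y) conj k(x',y)];
   then [|Phi x||Phi x'| <= (|Phi x|^2 + |Phi x'|^2)/2]. *)
Lemma schur_test (D1 D2 : set R) (k : R * R -> C) (Phi : R -> C)
    (kap : R * R -> R) (B : R) :
  finm D1 -> finm D2 -> cbm k -> cbm Phi -> bm kap ->
  (forall x y, kap (x, y) = kap (y, x)) -> (forall p, 0 <= kap p) ->
  (forall x x', D1 x -> D1 x' ->
    cnorm (cint D2 (fun y => cmul (k (x, y)) (cconj (k (x', y))))) <= kap (x, x')) ->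
  (forall x, D1 x -> \int[mu]_(x' in D1) kap (x, x') <= B) ->
  n2 D2 (fun y => cint D1 (fun x => cmul (Phi x) (k (x, y)))) <= B * n2 D1 Phi.
Proof.
move=> f1 f2 bk bP bkap ksym k0 kle kB.
pose W y := cint D1 (fun x => cmul (Phi x) (k (x, y))).
have bPk : cbm (fun p : R * R => cmul (Phi p.1) (k (p.1, p.2))) by bmt.
have bW : cbm W by exact: (cbm_cint2 bPk).
pose G x := cint D2 (fun y => cmul (k (x, y)) (cconj (W y))).
have bkW : cbm (fun p : R * R => cmul (k (p.1, p.2)) (cconj (W p.2))) by bmt.
have bG : cbm G by exact: (cbm_cint1 bkW).
have E1 : (n2 D2 W, 0) = cint D1 (fun x => cmul (Phi x) (G x)).
  rewrite /n2 -cint_real//; last by bmt.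
  transitivity (cint D2 (fun y => cint D1 (fun x =>
      cmul (Phi x) (cmul (k (x, y)) (cconj (W y)))))).
    apply: eq_cint => y _; rewrite -cmul_conj {1}/W -cintZr//; last by bmt.
    by apply: eq_cint => x _; rewrite cmulA.
  rewrite -(@cint_fubini _ (fun p => cmul (Phi p.1) (cmul (k (p.1, p.2)) (cconj (W p.2)))))//=; last by bmt.
  by apply: eq_cint => x _; rewrite cintZ//; bmt.
have E2 x : G x = cint D1 (fun x' => cmul (cconj (Phi x'))
    (cint D2 (fun y => cmul (k (x, y)) (cconj (k (x', y)))))).
  transitivity (cint D2 (fun y => cint D1 (fun x' =>
      cmul (cconj (Phi x')) (cmul (k (x, y)) (cconj (k (x', y))))))).
    apply: eq_cint => y _; rewrite /W -cint_conj// -?cintZ//; try by bmt.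
    by apply: eq_cint => x' _; rewrite cconjM cmulCA.
  have b3 : cbm (fun p : R * R => cmul (cconj (Phi p.1)) (cmul (k (x, p.2)) (cconj (k (p.1, p.2))))).
    by bmt.
  rewrite -(cint_fubini b3 f1 f2) /=.
  by apply: eq_cint => x' _; rewrite cintZ//; bmt.
pose q x := \int[mu]_(x' in D1) (cnorm (Phi x') * kap (x, x')).
have bq : bm q.
  by apply: (@bm_rI _ _ _ (fun p => cnorm (Phi p.2) * kap (p.1, p.2))) => //; bmt.
have Gle x : D1 x -> cnorm (G x) <= q x.
  move=> Dx; rewrite E2.
  have bkk : cbm (fun x' => cint D2 (fun y => cmul (k (x, y)) (cconj (k (x', y))))).
    apply: (@cbm_cint1 (fun p => cmul (k (x, p.2)) (cconj (k (p.1, p.2))))) => //.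
    by bmt.
  apply: le_trans (cint_norm f1 _) _; first by bmt.
  apply: rI_le => //; try by bmt.
  by move=> x' Dx'; rewrite cnormM cnorm_conj ler_wpM2l// kle.
have -> : n2 D2 W = cnorm (n2 D2 W, 0) by rewrite cnorm_real ger0_norm// n2_ge0.
rewrite E1; apply: le_trans (cint_norm f1 _) _; first by bmt.
pose b1 x := \int[mu]_(x' in D1) kap (x, x').
have bb1 : bm b1 by apply: (@bm_rI _ _ _ (fun p => kap (p.1, p.2))) => //; bmt.
pose b2 x := \int[mu]_(x' in D1) (cnorm (Phi x') ^+ 2 * kap (x, x')).
have bb2 : bm b2.
  by apply: (@bm_rI _ _ _ (fun p => cnorm (Phi p.2) ^+ 2 * kap (p.1, p.2))) => //; bmt.
apply: (@le_trans _ _ (\int[mu]_(x in D1)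
    (2^-1 * (cnorm (Phi x) ^+ 2 * b1 x + b2 x)))).
  apply: rI_le => //; try by bmt.
  move=> x Dx; rewrite cnormM.
  apply: le_trans (ler_wpM2l (cnorm_ge0 _) (Gle x Dx)) _.
  rewrite /q /b1 /b2 -!rIZ -?rID -?rIZ//; try by bmt.
  apply: rI_le => //; try by bmt.
  move=> x' _.
  have := k0 (x, x'); have := sqr_ge0 (cnorm (Phi x) - cnorm (Phi x')); nra.
have bPb1 : bm (fun x => cnorm (Phi x) ^+ 2 * b1 x) by bmt.
rewrite rIZ ?rID//; last by bmt.
have I1 : \int[mu]_(x in D1) (cnorm (Phi x) ^+ 2 * b1 x) <= B * n2 D1 Phi.
  rewrite /n2 -rIZ//; last by bmt.
  apply: rI_le => //; try by bmt.
  by move=> x Dx; rewrite mulrC ler_wpM2r ?sqr_ge0// kB.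
(* By Fubini and the symmetry of [kap] this is the previous integral. *)
have I2 : \int[mu]_(x in D1) b2 x <= B * n2 D1 Phi.
  rewrite /b2 (@rI_fubini _ (fun p => cnorm (Phi p.2) ^+ 2 * kap (p.1, p.2)))//=; last by bmt.
  apply: le_trans I1; apply: rI_le => //; try by bmt.
    apply: (@bm_rI _ _ _ (fun p => cnorm (Phi p.1) ^+ 2 * kap (p.2, p.1))) => //.
    by bmt.
  move=> x Dx; rewrite rIZ//; last by bmt.
  rewrite ler_wpM2l ?sqr_ge0// /b1; under eq_Rintegral do rewrite ksym.
  exact: lexx.
lra.
Qed.

End Schur.

(** * Nonstationary phase *)

Section Derivatives.
Context (R : realType).
Local Notation mu := (@lebesgue_measure R).
Implicit Types f g : R -> R.

Definition der f x (d : R) := is_derive x (1 : R) f d.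

Lemma der_eq f x d e : der f x d -> d = e -> der f x e.
Proof. by move=> fd <-. Qed.

Lemma derD f g x d e : der f x d -> der g x e -> der (fun y => f y + g y) x (d + e).
Proof. by move=> fd ge; exact: is_deriveD. Qed.

Lemma derN f x d : der f x d -> der (fun y => - f y) x (- d).
Proof. by move=> fd; exact: is_deriveN. Qed.

Lemma derB f g x d e : der f x d -> der g x e -> der (fun y => f y - g y) x (d - e).
Proof. by move=> fd ge; exact: is_deriveB. Qed.

Lemma derM f g x d e : der f x d -> der g x e ->
  der (fun y => f y * g y) x (d * g x + f x * e).
Proof.
move=> fd ge; apply: (@der_eq _ _ (f x *: e + g x *: d)); first exact: is_deriveM.
by rewrite /GRing.scale /= addrC mulrC.
Qed.

Lemma der_cst (c x : R) : der (fun _ => c) x 0.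
Proof. exact: is_derive_cst. Qed.

Lemma der_id x : der (fun y => y) x 1.
Proof. exact: is_derive_id. Qed.

Lemma derZ f x d c : der f x d -> der (fun y => c * f y) x (c * d).
Proof.
by move=> fd; apply: der_eq (derM (der_cst c x) fd) _; rewrite mul0r add0r.
Qed.

Lemma der_comp f g x d e : der f (g x) d -> der g x e -> der (fun y => f (g y)) x (d * e).
Proof.
by move=> fd ge; exact: is_derive1_comp.
Qed.

Lemma derV f x d : f x != 0 -> der f x d -> der (fun y => (f y)^-1) x (- d / f x ^+ 2).
Proof.
move=> f0 fd; apply: (@der_eq _ _ (- (f x) ^- 2 *: d)); first exact: is_deriveV.
by rewrite /GRing.scale /= mulNr mulrC -mulNr.
Qed.

Lemma der_cos f x d : der f x d -> der (fun y => cos (f y)) x (- sin (f x) * d).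
Proof. by move=> fd; apply: der_comp fd; exact: is_derive_cos. Qed.

Lemma der_sin f x d : der f x d -> der (fun y => sin (f y)) x (cos (f x) * d).
Proof. by move=> fd; apply: der_comp fd; exact: is_derive_sin. Qed.

Lemma der_cont f x d : der f x d -> {for x, continuous f}.
Proof. by move=> [fd _]; exact/differentiable_continuous/derivable1_diffP. Qed.

Lemma der_continuous f f' : (forall x, der f x (f' x)) -> continuous f.
Proof. by move=> fd x; exact: (der_cont (fd x)). Qed.

Lemma finm_itv (a b : R) : finm `[a, b]%classic.
Proof.
split; first exact: measurable_itv.
by rewrite lebesgue_measure_itv /=; case: ifPn => // _; rewrite ltry.
Qed.

Lemma fine_mu_itv (a b : R) : a <= b -> fine (mu `[a, b]%classic) = b - a.
Proof.
move=> ab; rewrite lebesgue_measure_itv /= lte_fin; case: ltgtP ab => //= -> _.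
by rewrite subrr.
Qed.

Lemma FTC (F f : R -> R) (a b : R) : a <= b ->
  (forall x, der F x (f x)) -> continuous f ->
  \int[mu]_(x in `[a, b]) f x = F b - F a.
Proof.
rewrite le_eqVlt => /predU1P[-> _ _|ab dF cf].
  by rewrite set_itv1 Rintegral_set1 subrr.
have cF := der_continuous dF.
rewrite /Rintegral (@continuous_FTC2 _ _ F)//.
- exact: continuous_subspaceT.
- split => //.
  + by move=> x _; case: (dF x).
  + by apply: cvg_at_right_filter; exact: cF.
  + by apply: cvg_at_left_filter; exact: cF.
- by move=> x _; rewrite derive1E; case: (dF x).
Qed.

End Derivatives.

Section SmoothFamilies.
Context (R : realType) (P : Type) (K : P -> set R).
Hypothesis Kclosed : forall p, closed (K p).
Implicit Types A B h : P -> R -> R.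

(* [n] derivatives, with bounds uniform in the parameter on [K]. *)
Fixpoint smf (n : nat) A : Prop :=
  [/\ forall p, continuous (A p),
      exists C : R, forall p x, K p x -> `|A p x| <= C
    & if n is n'.+1 then exists2 A', (forall p x, der (A p) x (A' p x)) & smf n' A'
      else True].

Definition supK A := forall p x, ~ K p x -> A p x = 0.

Lemma smfW n A : smf n.+1 A -> smf n A.
Proof.
elim: n A => [|n ih] A [cA bA [A' dA sA]]; first by split.
by split => //; exists A' => //; exact: ih.
Qed.

Lemma smf_cont n A : smf n A -> forall p, continuous (A p).
Proof. by case: n => [|n] []. Qed.

Lemma smf_bound n A : smf n A -> exists C : R, forall p x, K p x -> `|A p x| <= C.
Proof. by case: n => [|n] []. Qed.

Lemma smf_cst n (c : R) : smf n (fun _ _ => c).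
Proof.
elim: n c => [|n ih] c; split => //; try by move=> p; exact: cst_continuous.
- by exists `|c|.
- by exists `|c|.
- by exists (fun _ _ => 0) => // p x; exact: der_cst.
Qed.

Lemma smfD n A B : smf n A -> smf n B -> smf n (fun p x => A p x + B p x).
Proof.
elim: n A B => [|n ih] A B [cA [C bA] dA] [cB [D bB] dB]; split.
- by move=> p x; apply: cvgD; [exact: cA|exact: cB].
- by exists (C + D) => p x Kx; rewrite (le_trans (ler_normD _ _))// lerD ?bA ?bB.
- by [].
- by move=> p x; apply: cvgD; [exact: cA|exact: cB].
- by exists (C + D) => p x Kx; rewrite (le_trans (ler_normD _ _))// lerD ?bA ?bB.
- case: dA dB => A' dA sA [B' dB sB].
  by exists (fun p x => A' p x + B' p x); [move=> p x; exact: derD|exact: ih].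
Qed.

Lemma smfM n A B : smf n A -> smf n B -> smf n (fun p x => A p x * B p x).
Proof.
elim: n A B => [|n ih] A B sA0 sB0; have [cA [C bA] dA] := sA0;
    have [cB [D bB] dB] := sB0; split.
- by move=> p x; apply: cvgM; [exact: cA|exact: cB].
- by exists (C * D) => p x Kx; rewrite normrM ler_pM ?bA ?bB.
- by [].
- by move=> p x; apply: cvgM; [exact: cA|exact: cB].
- by exists (C * D) => p x Kx; rewrite normrM ler_pM ?bA ?bB.
- case: dA dB => A' dA sA [B' dB sB].
  exists (fun p x => A' p x * B p x + A p x * B' p x).
    by move=> p x; exact: derM.
  by apply: smfD; apply: ih => //; exact: smfW.
Qed.

Lemma smfN n A : smf n A -> smf n (fun p x => - A p x).
Proof.
move=> sA; rewrite (_ : (fun _ _ => _) = (fun p x => -1 * A p x)).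
  by apply: smfM => //; exact: smf_cst.
by apply/funext => p; apply/funext => x; rewrite mulN1r.
Qed.

Lemma smfB n A B : smf n A -> smf n B -> smf n (fun p x => A p x - B p x).
Proof. by move=> sA sB; apply: smfD => //; exact: smfN. Qed.

Lemma supKMl A B : supK A -> supK (fun p x => A p x * B p x).
Proof. by move=> sA p x Kx; rewrite sA// mul0r. Qed.

Lemma near_notK p x : ~ K p x -> \near x, ~ K p x.
Proof. by move=> Kx; apply: open_nbhs_nbhs; split => //; exact: closed_openC. Qed.

(** Off the closed set [K p] the function is zero on a whole neighbourhood. *)
Lemma supK_der A A' : supK A -> (forall p x, der (A p) x (A' p x)) -> supK A'.
Proof.
move=> sA dA p x Kx.
have d0 : der (A p) x 0.
  apply: near_eq_is_derive (der_cst 0 x).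
  by near do rewrite sA//; exact: near_notK.
have [_ <-] := dA p x; by have [_ ->] := d0.
Unshelve. all: by end_near. Qed.

Lemma der_div A A' h h' : supK A ->
  (forall p x, der (A p) x (A' p x)) -> (forall p x, der (h p) x (h' p x)) ->
  (forall p x, K p x -> h p x != 0) ->
  forall p x, der (fun x => A p x / h p x) x
    (A' p x / h p x - (A p x * h' p x) / h p x / h p x).
Proof.
move=> sA dA dh h0 p x; have [Kx|Kx] := pselect (K p x).
  apply: der_eq (derM (dA p x) (derV (h0 _ _ Kx) (dh p x))) _.
  by have := h0 _ _ Kx => hx; field.
(* Off [K p] the divisor may vanish, but there the quotient is locally zero. *)
rewrite (supK_der sA dA Kx) sA// !mul0r subr0.
apply: near_eq_is_derive (der_cst 0 x).
by near do rewrite sA ?mul0r//; exact: near_notK.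
Unshelve. all: by end_near. Qed.

(** The derivative is kept as [A'/h - (A h'/h)/h]: every quotient in it is again a function
    supported in [K] divided by the same [h], so the induction closes without a separate treatment
    of [1/h^2]. *)
Lemma smf_div n A h (kappa : R) : 0 < kappa -> supK A -> smf n A -> smf n h ->
  (forall p x, K p x -> kappa <= `|h p x|) -> smf n (fun p x => A p x / h p x).
Proof.
move=> k0 + + + hk.
have h0 p x : K p x -> h p x != 0.
  by move=> Kx; rewrite -normr_gt0 (lt_le_trans k0)// hk.
have bd B : (exists C : R, forall p x, K p x -> `|B p x| <= C) ->
    exists C : R, forall p x, K p x -> `|B p x / h p x| <= C.
  move=> [C bC]; exists (C / kappa) => p x Kx; rewrite normrM normfV.
  by rewrite ler_pM ?invr_ge0 ?bC// lef_pV2 ?hk// posrE ?(lt_le_trans k0)// hk.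
elim: n A => [|n ih] A sA smA smh; have [cA bA dA] := smA; have [ch bh dh] := smh.
  split => //; last exact: bd.
  move=> p x; have [Kx|Kx] := pselect (K p x).
    by apply: cvgM; [exact: cA|apply: cvgV; [exact: h0|exact: ch]].
  rewrite /continuous_at sA// mul0r.
  by apply: cvg_near_cst; near do rewrite sA ?mul0r//; exact: near_notK.
case: dA dh => A' dA sA' [h' dh sh'].
have dd := der_div sA dA dh h0.
have sAh : supK (fun p x => A p x * h' p x) by exact: supKMl.
split; [by move=> p; exact: (der_continuous (dd p))|exact: bd|].
eexists; first exact: dd.
have IA : smf n (fun p x => A p x * h' p x / h p x).
  by apply: ih => //; [apply: smfM => //; exact: smfW|exact: smfW].
apply: smfB.
  by apply: ih => //; [exact: (supK_der sA dA)|exact: smfW].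
by apply: ih => //; [exact: supKMl|exact: smfW].
Unshelve. all: by end_near. Qed.

End SmoothFamilies.

Section Nonstationary.
Context (R : realType) (P : Type) (K : P -> set R) (T : R).
Local Notation mu := (@lebesgue_measure R).
Local Notation I := (`[- (T + 1), T + 1]%classic).
Hypothesis T0 : 0 <= T.
Hypothesis Kclosed : forall p, closed (K p).
Hypothesis KT : forall p x, K p x -> `|x| <= T.
Implicit Types A B h psi : P -> R -> R.

Lemma smf_bm n A p : smf K n A -> supK K A -> bm (A p).
Proof.
move=> sA s0; split.
  by apply: continuous_measurable_fun; exact: (smf_cont sA).
have [C bC] := smf_bound sA; exists `|C| => x.
have [Kx|Kx] := pselect (K p x); first by rewrite (le_trans (bC _ _ Kx))// ler_norm.
by rewrite s0// normr0.
Qed.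

Lemma cont_meas (f : R -> R) : continuous f -> measurable_fun setT f.
Proof. exact: continuous_measurable_fun. Qed.

Lemma nonstationary0 A : supK K A -> smf K 0 A ->
  exists2 C : R, 0 <= C & forall p (f : R -> R), continuous f ->
    `|\int[mu]_(x in I) (cos (f x) * A p x)| <= C.
Proof.
move=> s0 sA; have [C bC] := smf_bound sA.
exists (`|C| * fine (mu I)); first by rewrite mulr_ge0// fine_ge0.
move=> p f cf; have bA := smf_bm p sA s0; have mf := cont_meas cf.
have fI := finm_itv (- (T + 1)) (T + 1).
apply: le_trans (rI_abs fI _) _; first by bmt.
rewrite -(rI_cst fI); apply: rI_le => //; try by bmt.
move=> x _; rewrite normrM -[leRHS]mul1r ler_pM//.
  by rewrite ler_norml cos_geN1 cos_le1.
have [Kx|Kx] := pselect (K p x); last by rewrite s0// normr0.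
by rewrite (le_trans (bC _ _ Kx))// ler_norm.
Qed.

(** The margin [1] of the window over [T] puts its end points outside [K p], which removes the
    boundary terms of the integrations by parts. *)
Lemma boundary0 A p : supK K A -> A p (T + 1) = 0 /\ A p (- (T + 1)) = 0.
Proof.
move=> s0; split; apply: s0 => /KT.
  by rewrite ger0_norm ?addr_ge0// leNgt ltrDl ltr01.
by rewrite normrN ger0_norm ?addr_ge0// leNgt ltrDl ltr01.
Qed.

(* Integration by parts against [(sin (lam psi + th) A / h)' ], whose integral vanishes. *)
Lemma nonstationary n A h psi (kappa : R) : 0 < kappa -> supK K A ->
  smf K n A -> smf K n h -> (forall p x, K p x -> kappa <= `|h p x|) ->
  (forall p x, der (psi p) x (h p x)) ->
  exists2 C : R, 0 <= C & forall p (lam th : R), lam != 0 ->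
    `|\int[mu]_(x in I) (cos (lam * psi p x + th) * A p x)| <= C / `|lam| ^+ n.
Proof.
move=> k0 + + + hk dpsi.
have cph p (lam th : R) : continuous (fun x => lam * psi p x + th).
  apply: (@der_continuous _ _ (fun x => lam * h p x + 0)) => x.
  by apply: derD (der_cst _ _); exact: derZ.
elim: n A => [|n ih] A s0 sA sh.
  have [C C0 bC] := nonstationary0 s0 sA; exists C => // p lam th _.
  by rewrite expr0 divr1; apply: bC.
have sB := smf_div Kclosed k0 s0 sA sh hk.
set B := (fun p x => A p x / h p x) in sB.
have s0B : supK K B by move=> p x Kx; rewrite /B s0// mul0r.
have [cB _ [B' dB sB']] := sB.
have s0B' := supK_der Kclosed s0B dB.
have [C C0 bC] := ih B' s0B' sB' (smfW sh).
exists C => // p lam th l0.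
have hB x : h p x * B p x = A p x.
  have [Kx|Kx] := pselect (K p x); last by rewrite s0B// s0// mulr0.
  rewrite /B mulrC divfK// -normr_gt0 (lt_le_trans k0)//; exact: hk.
have mph := cont_meas (cph p lam th).
have mph' := cont_meas (cph p lam (th - pi / 2)).
have bA : bm (A p) by exact: smf_bm sA s0.
have bB' : bm (B' p) by exact: smf_bm sB' s0B'.
(* The term with [B'] carries a sine, written as a cosine with [th - pi / 2], so that the induction
   hypothesis, which covers all [th], applies to it. *)
pose g x := lam * (cos (lam * psi p x + th) * A p x) +
  cos (lam * psi p x + (th - pi / 2)) * B' p x.
have dS x : der (fun x => sin (lam * psi p x + th) * B p x) x (g x).
  apply: der_eq (derM (der_sin (derD (derZ _ (dpsi p x)) (der_cst th x))) (dB p x)) _.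
  by rewrite /g addrA cosBpihalf -hB; ring.
have cg : continuous g.
  move=> x; apply: cvgD; apply: cvgM.
  - exact: cvg_cst.
  - apply: cvgM; last exact: (smf_cont sA).
    apply: (@continuous_comp _ _ _ (fun x => lam * psi p x + th) cos).
      exact: cph.
    exact: continuous_cos.
  - apply: (@continuous_comp _ _ _ (fun x => lam * psi p x + (th - pi / 2)) cos).
      exact: cph.
    exact: continuous_cos.
  - exact: (smf_cont sB').
have fI := finm_itv (- (T + 1)) (T + 1).
have := FTC _ dS cg; move=> /(_ (- (T + 1)) (T + 1)).
have [-> ->] := boundary0 p s0B; rewrite !mulr0 subrr => F0.
have {}F0 : \int[mu]_(x in I) g x = 0.
  by apply: F0; have := T0; lra.
have b1 : bm (fun x => cos (lam * psi p x + th) * A p x) by bmt.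
have b2 : bm (fun x => cos (lam * psi p x + (th - pi / 2)) * B' p x) by bmt.
move: F0; rewrite /g rID//; last by bmt.
rewrite rIZ// => /eqP; rewrite addr_eq0 => /eqP F0.
rewrite exprS invfM mulrCA ler_pdivlMl ?normr_gt0// -normrM F0 normrN.
exact: bC.
Qed.

(** The real and imaginary parts are combinations of four real integrals, taken with [th = 0] and
    [th = - pi / 2]. *)
Lemma nonstationary_cplx n A1 A2 h psi (kappa : R) : 0 < kappa ->
  supK K A1 -> supK K A2 -> smf K n A1 -> smf K n A2 -> smf K n h ->
  (forall p x, K p x -> kappa <= `|h p x|) ->
  (forall p x, der (psi p) x (h p x)) ->
  exists2 C : R, 0 <= C & forall p (lam : R), lam != 0 ->
    cnorm (cint I (fun x => cmul (cexpi (lam * psi p x)) (A1 p x, A2 p x)))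
      <= C / `|lam| ^+ n.
Proof.
move=> k0 s1 s2 sA1 sA2 sh hk dpsi.
have [C1 C10 b1] := nonstationary k0 s1 sA1 sh hk dpsi.
have [C2 C20 b2] := nonstationary k0 s2 sA2 sh hk dpsi.
exists (2 * (C1 + C2)); first by rewrite mulr_ge0// addr_ge0.
move=> p lam l0.
have bA1 : bm (A1 p) by exact: smf_bm sA1 s1.
have bA2 : bm (A2 p) by exact: smf_bm sA2 s2.
have mpsi : measurable_fun setT (fun x => psi p x).
  by apply: cont_meas; exact: der_continuous (dpsi p).
have fI := finm_itv (- (T + 1)) (T + 1).
have bt (A : P -> R -> R) th : bm (A p) ->
    bm (fun x => cos (lam * psi p x + th) * A p x) by move=> bA; bmt.
have := b1 p lam 0 l0; have := b1 p lam (- (pi / 2)) l0.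
have := b2 p lam 0 l0; have := b2 p lam (- (pi / 2)) l0.
set J1 := \int[mu]_(x in I) _; set J2 := \int[mu]_(x in I) _.
set J3 := \int[mu]_(x in I) _; set J4 := \int[mu]_(x in I) _.
move=> h1 h2 h3 h4.
apply: le_trans (cnorm_le _) _.
have -> : (cint I (fun x => cmul (cexpi (lam * psi p x)) (A1 p x, A2 p x))).1 = J4 - J1.
  rewrite /cint /J4 /J1 /= -rIB//; try exact: bt.
  by apply: eq_Rintegral => x _; rewrite addr0 -cosBpihalf.
have -> : (cint I (fun x => cmul (cexpi (lam * psi p x)) (A1 p x, A2 p x))).2 = J2 + J3.
  rewrite /cint /J2 /J3 /= -rID//; try exact: bt.
  by apply: eq_Rintegral => x _; rewrite addr0 -cosBpihalf.
have := ler_normB J4 J1; have := ler_normD J2 J3.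
have -> : 2 * (C1 + C2) / `|lam| ^+ n = (C1 / `|lam| ^+ n + C2 / `|lam| ^+ n) * 2 by ring.
lra.
Qed.

(** Two integrations by parts combined with the trivial bound at small [lam]: the result is
    integrable in [lam], as the Schur test demands. *)
Lemma nonstationary_cplx2 A1 A2 h psi (kappa : R) : 0 < kappa ->
  supK K A1 -> supK K A2 -> smf K 2 A1 -> smf K 2 A2 -> smf K 2 h ->
  (forall p x, K p x -> kappa <= `|h p x|) ->
  (forall p x, der (psi p) x (h p x)) ->
  exists2 C : R, 0 <= C & forall p (lam : R),
    cnorm (cint I (fun x => cmul (cexpi (lam * psi p x)) (A1 p x, A2 p x)))
      <= C / (1 + lam ^+ 2).
Proof.
move=> k0 s1 s2 sA1 sA2 sh hk dpsi.
have [C1 C10 b1] := nonstationary_cplx k0 s1 s2 sA1 sA2 sh hk dpsi.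
have [M1 bM1] := smf_bound sA1; have [M2 bM2] := smf_bound sA2.
have fI := finm_itv (- (T + 1)) (T + 1).
pose C0 := (`|M1| + `|M2|) * fine (mu I).
have C00 : 0 <= C0 by rewrite mulr_ge0 ?addr_ge0// fine_ge0.
have b0 p lam : cnorm (cint I (fun x => cmul (cexpi (lam * psi p x)) (A1 p x, A2 p x))) <= C0.
  have bA1 : bm (A1 p) by exact: smf_bm sA1 s1.
  have bA2 : bm (A2 p) by exact: smf_bm sA2 s2.
  have mpsi : measurable_fun setT (fun x => psi p x).
    by apply: cont_meas; exact: der_continuous (dpsi p).
  apply: cint_le => //.
    by apply: cbmM; [apply: cbm_expi; mft|split].
  move=> x _; rewrite cnorm_expiM (le_trans (cnorm_le _))//= lerD//.
    have [Kx|Kx] := pselect (K p x); last by rewrite s1// normr0.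
    by rewrite (le_trans (bM1 _ _ Kx))// ler_norm.
  have [Kx|Kx] := pselect (K p x); last by rewrite s2// normr0.
  by rewrite (le_trans (bM2 _ _ Kx))// ler_norm.
exists (C0 + C1); first exact: addr_ge0.
move=> p lam; have l1 : 0 < 1 + lam ^+ 2 by rewrite ltr_pwDl// sqr_ge0.
rewrite ler_pdivlMr// mulrDr mulr1 lerD ?b0//.
have [->|l0] := eqVneq lam 0; first by rewrite expr0n/= mulr0.
have := b1 p lam l0; rewrite real_normK ?num_real//.
by rewrite ler_pdivlMr// exprn_even_gt0.
Qed.

End Nonstationary.

(** * Oscillatory integral operators *)

Section Calculus.
Context (R : realType).
Local Notation mu := (@lebesgue_measure R).

Lemma continuous_bounded_itv (f : R -> R) (S : R) : continuous f ->
  exists2 C : R, 0 <= C & forall u, `|u| <= S -> `|f u| <= C.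
Proof.
move=> cf; have [S0|S0] := leP 0 S; last first.
  by exists 0 => // u; rewrite leNgt (lt_le_trans S0).
have SS : - S <= S by lra.
have cn : {within `[- S, S], continuous (fun x => `|f x|)}.
  by apply: continuous_subspaceT => x; apply: continuous_comp; [exact: cf|exact: norm_continuous].
have [c _ hc] := EVT_max SS cn.
exists `|f c| => // u; rewrite ler_norml => hu.
by apply: hc; rewrite in_itv.
Qed.

Lemma mvt (g g' : R -> R) (u v S : R) : (forall x, der g x (g' x)) ->
  `|u| <= S -> `|v| <= S -> exists2 c, `|c| <= S & g u - g v = g' c * (u - v).
Proof.
move=> dg; wlog uv : u v / v <= u => [hw|] hu hv.
  have [vu|uv] := leP v u; first exact: hw.
  have [c hc e] := hw v u (ltW uv) hv hu; exists c => //.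
  by rewrite -opprB e; ring.
have cg : {within `[v, u], continuous g}.
  by apply: continuous_subspaceT; exact: der_continuous dg.
have [c] := MVT_segment uv (fun x _ => dg x) cg.
rewrite in_itv /= => /andP[vc cu] e; exists c => //.
by move: hu hv; rewrite !ler_norml => /andP[? ?] /andP[? ?]; apply/andP; split; lra.
Qed.

Lemma mvt_global (g g' : R -> R) (u v : R) : (forall x, der g x (g' x)) ->
  exists c, g u - g v = g' c * (u - v).
Proof.
move=> dg; have [||c _ e] := @mvt g g' u v (`|u| + `|v|) dg; first by rewrite lerDl.
  by rewrite lerDr.
by exists c.
Qed.

Lemma smooth1_der (a : R -> R) n x : smooth1 a -> der (derive1n n a) x (derive1n n.+1 a x).
Proof. by move=> sa; split; [exact: sa|rewrite derive1nS derive1E]. Qed.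

Lemma smooth1_cont (a : R -> R) n : smooth1 a -> continuous (derive1n n a).
Proof. by move=> sa; apply: der_continuous => x; exact: smooth1_der. Qed.

Section Lorentz.
Context (x l T : R).
Hypothesis T0 : 0 <= T.
Local Notation w := (fun y => (1 + l ^+ 2 * (x - y) ^+ 2)^-1).

Let d0 y : 0 < 1 + l ^+ 2 * (x - y) ^+ 2.
Proof. by rewrite ltr_pwDl// mulr_ge0// sqr_ge0. Qed.

Let cJ : continuous w.
Proof.
have dd (y : R) : der (fun y => 1 + l ^+ 2 * (x - y) ^+ 2) y (- (l ^+ 2 * (x - y) *+ 2)).
  have e : der (fun y => x - y) y (- 1).
    by apply: der_eq (derB (der_cst x y) (der_id y)) _; rewrite sub0r.
  apply: der_eq (derD (der_cst 1 y) (derZ (l ^+ 2) (derM e e))) _.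
  by rewrite mulr2n; ring.
apply: (@der_continuous _ _ (fun y => - (- (l ^+ 2 * (x - y) *+ 2)) / (1 + l ^+ 2 * (x - y) ^+ 2) ^+ 2)) => y.
by apply: derV; [rewrite gt_eqF|exact: dd].
Qed.

Lemma rI_lorentz_pi : `|l| * \int[mu]_(y in `[- T, T]) w y <= pi.
Proof.
have TT : - T <= T by have := T0; lra.
set J := \int[mu]_(y in _) _.
have J0 : 0 <= J by apply: Rintegral_ge0 => y _; rewrite invr_ge0 ltW.
have [->|l0] := eqVneq l 0; first by rewrite normr0 mul0r pi_ge0.
have E : J = l^-1 * atan (l * (T - x)) - l^-1 * atan (l * (- T - x)).
  apply: (FTC TT _ cJ (F := fun y => l^-1 * atan (l * (y - x)))) => y.
  have e : der (fun y => l * (y - x)) y l.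
    by apply: der_eq (derZ l (derB (der_id y) (der_cst x y))) _; rewrite subr0 mulr1.
  apply: der_eq (derZ l^-1 (der_comp (is_derive1_atan _) e)) _.
  rewrite mulrCA mulVf// mulr1; congr (_^-1); ring.
rewrite -{1}(ger0_norm J0) -normrM E -mulrBr mulrA mulfV// mul1r.
have := atan_gtNpi2 (l * (T - x)); have := atan_ltpi2 (l * (T - x)).
have := atan_gtNpi2 (l * (- T - x)); have := atan_ltpi2 (l * (- T - x)).
by rewrite ler_norml => *; apply/andP; split; lra.
Qed.

(** The integrand is at most [1], which serves for small [l]; the arctangent primitive serves for
    large [l]. The two bounds are added. *)
Lemma rI_lorentz : \int[mu]_(y in `[- T, T]) w y <= (2 * T + pi) / (1 + `|l|).
Proof.
have TT : - T <= T by have := T0; lra.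
set J := \int[mu]_(y in _) _.
have J1 : J <= 2 * T.
  have -> : 2 * T = 1 * fine (mu `[- T, T]%classic) by rewrite fine_mu_itv// mul1r; lra.
  rewrite -rI_cst; last exact: finm_itv.
  apply: rI_le; [exact: finm_itv| |exact: bm_cst|]; last first.
    by move=> y _ /=; rewrite invf_le1// lerDl mulr_ge0// sqr_ge0.
  split; first exact: cont_meas.
  exists 1 => y; rewrite ger0_norm ?invr_ge0; last exact/ltW/d0.
  by rewrite invf_le1// lerDl mulr_ge0// sqr_ge0.
have l1 : 0 < 1 + `|l| by rewrite ltr_pwDl.
rewrite ler_pdivlMr// mulrDr mulr1 lerD// mulrC; exact: rI_lorentz_pi.
Qed.

End Lorentz.

End Calculus.

Section FamilyTools.
Context (R : realType).

Lemma smf_sub (P P' : Type) (K : P -> set R) (K' : P' -> set R) (g : P' -> P) n A :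
  (forall p, K' p `<=` K (g p)) -> smf K n A -> smf K' n (fun p => A (g p)).
Proof.
move=> KK; elim: n A => [|n ih] A [cA [C bA] dA]; split=> //.
- by exists C => p x /KK; exact: bA.
- by exists C => p x /KK; exact: bA.
- by case: dA => A' dA sA; exists (fun p => A' (g p)) => //; exact: ih.
Qed.

Lemma smf_param (P : Type) (K : P -> set R) n (c : P -> R) (C : R) :
  (forall p x, K p x -> `|c p| <= C) -> smf K n (fun p _ => c p).
Proof.
move=> bc; case: n => [|n]; split => //.
- by move=> p; exact: cst_continuous.
- by exists C => p x; exact: bc.
- by move=> p; exact: cst_continuous.
- by exists C => p x; exact: bc.
- exists (fun _ _ => 0); first by move=> p x; exact: der_cst.
  exact: smf_cst.
Qed.

End FamilyTools.

Section Hormander.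
Context (R : realType) (T eps kap : R) (al : R -> R).
Local Notation mu := (@lebesgue_measure R).
Local Notation I := (`[- (T + 1), T + 1]%classic).
Local Notation C := (R * R)%type.
Hypothesis T0 : 0 <= T.
Hypothesis eps1 : `|eps| = 1.
Hypothesis sal : smooth1 al.
Hypothesis kap0 : 0 < kap.
Hypothesis kal : forall x, kap <= `|derive1n 2 al x|.

Definition hK (p : R * R) : set R :=
  [set y | [/\ `|y| <= T, `|p.1| <= T & `|p.2| <= T]].

(* parameters [(sig, x, x')] with [x != x'] *)
Definition hK2 (p : R * R * R) : set R :=
  [set y | [/\ `|y| <= T, `|p.1.1| <= T, `|p.1.2| <= T, `|p.2| <= T & p.1.2 != p.2]].

Lemma closed_and (Q : Prop) (S : set R) : closed S -> closed [set y | S y /\ Q].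
Proof.
move=> cS; have [q|nq] := pselect Q.
  have -> : [set y | S y /\ Q] = S by apply/seteqP; split => [y []|y].
  by [].
have -> : [set y | S y /\ Q] = set0 by apply/seteqP; split => [y []|y].
exact: closed0.
Qed.

Lemma closed_norm_le : closed [set y : R | `|y| <= T].
Proof.
apply: (@preimage_closed _ _ (fun y : R => `|y|) [set y | y <= T]) => [x _|].
  exact: norm_continuous.
exact: closed_le.
Qed.

Lemma hK2_closed p : closed (hK2 p).
Proof.
rewrite (_ : hK2 p = [set y | `|y| <= T /\
    [/\ `|p.1.1| <= T, `|p.1.2| <= T, `|p.2| <= T & p.1.2 != p.2]]).
  exact: (@closed_and _ [set y | `|y| <= T]) closed_norm_le.
by apply/seteqP; split => [y []|y [? []]].
Qed.

(** The phase difference in a [T T^*] kernel is [lam (x - x')] times this divided difference. It is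
    therefore a phase with large parameter [lam (x - x')], whose derivative in [y] is the divided
    difference of [al'] and is controlled from below by [al'']. *)
Definition hdiff (g : R -> R) (p : R * R * R) (y : R) :=
  (g (eps * p.1.2 + y + p.1.1) - g (eps * p.2 + y + p.1.1)) / (p.1.2 - p.2).

Lemma der_hdiff (g g' : R -> R) p y : (forall x, der g x (g' x)) ->
  der (hdiff g p) y (hdiff g' p y).
Proof.
move=> dg.
have d1 (c e : R) : der (fun y => g (c + y + e)) y (g' (c + y + e)).
  apply: der_eq (der_comp (dg _) (derD (derD (der_cst c y) (der_id y)) (der_cst e y))) _.
  by rewrite addr0 add0r mulr1.
apply: der_eq (derM (derB (d1 (eps * p.1.2) p.1.1) (d1 (eps * p.2) p.1.1)) (der_cst _ y)) _.
by rewrite mulr0 addr0.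
Qed.

Lemma hK2_arg p y : hK2 p y -> `|eps * p.1.2 + y + p.1.1| <= 3 * T /\
  `|eps * p.2 + y + p.1.1| <= 3 * T.
Proof.
move=> [hy hs hx hx' _].
have ex z : `|z| <= T -> `|eps * z| <= T by rewrite normrM eps1 mul1r.
have := ex _ hx; have := ex _ hx'; move: hy hs; rewrite !ler_norml.
by move=> /andP[? ?] /andP[? ?] /andP[? ?] /andP[? ?]; split; apply/andP; split; lra.
Qed.

(** By the mean value theorem a divided difference of one derivative is a value of the next, so the
    bounds are uniform as [x'] approaches [x]. *)
Lemma smf_hdiff n j : smf hK2 n (hdiff (derive1n j al)).
Proof.
elim: n j => [|n ih] j.
  split => //.
    by move=> p; apply: der_continuous => y; apply: der_hdiff => x; exact: smooth1_der.
  have [D D0 bD] := continuous_bounded_itv (3 * T) (@smooth1_cont _ _ j.+1 sal).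
  exists D => p y Ky; have [h1 h2] := hK2_arg Ky; have [_ _ _ _ xx] := Ky.
  have [c hc e] := mvt (fun x => smooth1_der j x sal) h1 h2.
  rewrite /hdiff e (_ : _ - _ = eps * (p.1.2 - p.2)); last by ring.
  by rewrite mulrA mulfK ?subr_eq0// normrM eps1 mulr1 bD.
split; [exact: smf_cont (ih j)|exact: smf_bound (ih j)|].
exists (hdiff (derive1n j.+1 al)); last exact: ih.
by move=> p y; apply: der_hdiff => x; exact: smooth1_der.
Qed.

Lemma hdiff_lower (p : R * R * R) y : hK2 p y -> kap <= `|hdiff (derive1n 1 al) p y|.
Proof.
case=> _ _ _ _ xx; rewrite /hdiff.
set u := eps * p.1.2 + _ + _; set v := eps * p.2 + _ + _.
have [c ->] := mvt_global u v (fun x => smooth1_der 1 x sal).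
have -> : u - v = eps * (p.1.2 - p.2) by rewrite /u /v; ring.
by rewrite mulrA mulfK ?subr_eq0// normrM eps1 mulr1.
Qed.

Context (M1 M2 : R * R -> R -> R).
Hypothesis sM1 : smf hK 2 M1.
Hypothesis sM2 : smf hK 2 M2.
Hypothesis zM1 : supK hK M1.
Hypothesis zM2 : supK hK M2.

Definition hker (sig lam : R) (p : R * R) : C :=
  cmul (cexpi (lam * al (eps * p.1 + p.2 + sig)))
       (M1 (sig, p.1) p.2, M2 (sig, p.1) p.2).

(** Off the diagonal, nonstationary phase with parameter [lam (x - x')] applies to the divided
    difference of [al]; on the diagonal the trivial bound is enough, since there the right side is
    [D]. *)
Lemma hker_TT : exists2 D : R, 0 <= D & forall sig lam x x',
  cnorm (cint I (fun y => cmul (hker sig lam (x, y)) (cconj (hker sig lam (x', y)))))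
    <= D * (1 + lam ^+ 2 * (x - x') ^+ 2)^-1.
Proof.
(* On the diagonal the divided difference is [0], by division by zero, and has no lower bound; the
   factor [ind] makes the amplitude vanish there, hence supported in [hK2]. *)
pose ind (p : R * R * R) : R := (p.1.2 != p.2)%:R.
pose g1 (p : R * R * R) : R * R := (p.1.1, p.1.2).
pose g2 (p : R * R * R) : R * R := (p.1.1, p.2).
pose A1 p y := ind p * (M1 (g1 p) y * M1 (g2 p) y + M2 (g1 p) y * M2 (g2 p) y).
pose A2 p y := ind p * (M2 (g1 p) y * M1 (g2 p) y - M1 (g1 p) y * M2 (g2 p) y).
have K1 p : hK2 p `<=` hK (g1 p) by move=> y [].
have K2 p : hK2 p `<=` hK (g2 p) by move=> y [].
have s11 := smf_sub K1 sM1; have s12 := smf_sub K2 sM1.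
have s21 := smf_sub K1 sM2; have s22 := smf_sub K2 sM2.
have sind : smf hK2 2 (fun p _ => ind p).
  by apply: (@smf_param _ _ _ _ _ 1) => p x _; rewrite /ind; case: eqP => _; rewrite ?normr0 ?normr1.
have sA1 : smf hK2 2 A1 by apply: smfM => //; apply: smfD; exact: smfM.
have sA2 : smf hK2 2 A2 by apply: smfM => //; apply: smfB; exact: smfM.
have z0 p y : ~ hK2 p y -> ind p = 0 \/ ((M1 (g1 p) y = 0 /\ M2 (g1 p) y = 0) \/
    (M1 (g2 p) y = 0 /\ M2 (g2 p) y = 0)).
  move=> nK; rewrite /ind; case: eqP => [_|xx]; [by left|right].
  have [k1|k1] := pselect (hK (g1 p) y); last by left; rewrite zM1// zM2.
  have [k2|k2] := pselect (hK (g2 p) y); last by right; rewrite zM1// zM2.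
  by exfalso; apply: nK; case: k1 k2 => ? ? ? [? ? ?]; split => //; apply/eqP.
have zA1 : supK hK2 A1.
  by move=> p y /z0[e|[[e1 e2]|[e1 e2]]]; rewrite /A1 ?e ?e1 ?e2; ring.
have zA2 : supK hK2 A2.
  by move=> p y /z0[e|[[e1 e2]|[e1 e2]]]; rewrite /A2 ?e ?e1 ?e2; ring.
have KT p y : hK2 p y -> `|y| <= T by case.
have dpsi p y : der (hdiff al p) y (hdiff (derive1n 1 al) p y).
  by apply: der_hdiff => x; exact: (smooth1_der 0 x sal).
have [D D0 bD] := nonstationary_cplx2 T0 hK2_closed KT kap0 zA1 zA2 sA1 sA2
  (smf_hdiff 2 1) hdiff_lower dpsi.
have [N1 bN1] := smf_bound sM1; have [N2 bN2] := smf_bound sM2.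
have NM sig x y : cnorm (M1 (sig, x) y, M2 (sig, x) y) <= `|N1| + `|N2|.
  rewrite (le_trans (cnorm_le _))//= lerD//.
    have [Kx|Kx] := pselect (hK (sig, x) y); last by rewrite zM1// normr0.
    by rewrite (le_trans (bN1 _ _ Kx))// ler_norm.
  have [Kx|Kx] := pselect (hK (sig, x) y); last by rewrite zM2// normr0.
  by rewrite (le_trans (bN2 _ _ Kx))// ler_norm.
have fI := finm_itv (- (T + 1)) (T + 1).
have cal : continuous al by exact: (@smooth1_cont _ al 0).
have mal := cont_meas cal.
have bk sig lam x : cbm (fun y => hker sig lam (x, y)).
  apply: cbmM; first by apply: cbm_expi => /=; mft.
  by split => /=; [exact: (smf_bm (sig, x) sM1 zM1)|exact: (smf_bm (sig, x) sM2 zM2)].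
exists (D + (`|N1| + `|N2|) ^+ 2 * fine (mu I)).
  by apply: addr_ge0 => //; apply: mulr_ge0; [exact: sqr_ge0|exact: fine_ge0].
move=> sig lam x x'; have [->|xx] := eqVneq x x'.
  rewrite subrr expr0n/= mulr0 addr0 invr1 mulr1 ler_wpDl//.
  apply: cint_le => //; first by apply: cbmM; [exact: bk|apply: cbm_conj; exact: bk].
  move=> y _; rewrite cnormM cnorm_conj !cnorm_expiM expr2 ler_pM//; exact: NM.
rewrite mulrDl ler_wpDr//.
  apply: mulr_ge0; first by apply: mulr_ge0; [exact: sqr_ge0|exact: fine_ge0].
  by rewrite invr_ge0 addr_ge0// mulr_ge0// sqr_ge0.
have := bD (sig, x, x') (lam * (x - x')); rewrite exprMn; congr (cnorm _ <= _).
apply: eq_cint => y _; rewrite /hker /hdiff /A1 /A2 /ind /g1 /g2 /= xx !mul1r.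
rewrite cconjM cconj_expi cmulACA -cexpiD; congr cmul; last by rewrite /cconj; cring.
congr cexpi; rewrite -mulrA [(x - x') * _]mulrCA mulfV ?subr_eq0// mulr1; ring.
Qed.

(** Schur test with the kernel bound just obtained, whose integral in [x'] is of size
    [1 / (1 + |lam|)]. This is the L^2 decay of an oscillatory integral operator whose phase has
    mixed derivative [eps al''], bounded away from zero. *)
Lemma hormander (bM : forall sig, cbm (fun p : R * R => (M1 (sig, p.1) p.2, M2 (sig, p.1) p.2))) :
  exists2 D : R, 0 <= D & forall sig lam Phi, cbm Phi ->
  n2 I (fun y => cint `[- T, T] (fun x => cmul (Phi x) (hker sig lam (x, y)))) <=
    D / (1 + `|lam|) * n2 `[- T, T] Phi.
Proof.
have [D D0 bD] := hker_TT.
have cal : continuous al by exact: (@smooth1_cont _ al 0).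
have mal := cont_meas cal.
exists (D * (2 * T + pi)); first by rewrite mulr_ge0// addr_ge0 ?pi_ge0// mulr_ge0.
move=> sig lam Phi bP.
have d0 (u : R) : 0 < 1 + lam ^+ 2 * u ^+ 2 by rewrite ltr_pwDl// mulr_ge0// sqr_ge0.
pose w (u : R) := (1 + lam ^+ 2 * u ^+ 2)^-1.
have bq : bm w.
  split; last first.
    exists 1 => u; rewrite ger0_norm ?invr_ge0; last exact/ltW/d0.
    by rewrite invf_le1// lerDl mulr_ge0// sqr_ge0.
  apply: cont_meas => u; apply: cvgV; first by rewrite gt_eqF.
  apply: cvgD; first exact: cvg_cst.
  by apply: cvgM; [exact: cvg_cst|apply: exprn_continuous].
apply: (schur_test (kap := fun p => D * w (p.1 - p.2))) => //=.
- exact: finm_itv.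
- exact: finm_itv.
- by have b := bM sig; apply: cbmM => //; apply: cbm_expi => /=; mft.
- by bmt.
- by move=> x y; congr (_ * (_ + _ * _)^-1); ring.
- by move=> p; rewrite mulr_ge0// invr_ge0 ltW.
move=> x _; rewrite rIZ; last 2 first.
- exact: finm_itv.
- by bmt.
rewrite -mulrA ler_wpM2l//; exact: rI_lorentz.
Qed.

End Hormander.

(** * Plancherel bounds on a bounded frequency window *)

Section Plancherel.
Context (R : realType).
Local Notation mu := (@lebesgue_measure R).
Local Notation C := (R * R)%type.

Lemma rI_subset (D D' : set R) (h : R -> R) : finm D -> finm D' -> D `<=` D' ->
  bm h -> (forall x, 0 <= h x) ->
  \int[mu]_(x in D) h x <= \int[mu]_(x in D') h x.
Proof.
move=> fD fD' DD' bh h0; apply: fine_le.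
- by apply: integrable_fin_num; [case: fD|exact: bm_integrable].
- by apply: integrable_fin_num; [case: fD'|exact: bm_integrable].
apply: ge0_subset_integral => //; [by case: fD|by case: fD'| |].
  by apply/measurable_EFinP; apply: measurable_funTS; case: bh.
by move=> x _; rewrite lee_fin.
Qed.

Lemma n2_le (D D' : set R) (h k : R -> C) : finm D -> finm D' -> D `<=` D' ->
  cbm h -> cbm k -> (forall x, D x -> cnorm (h x) <= cnorm (k x)) ->
  n2 D h <= n2 D' k.
Proof.
move=> fD fD' DD' bh bk hk; apply: (@le_trans _ _ (n2 D k)).
  apply: rI_le => //; try by bmt.
  by move=> x Dx; rewrite lerXn2r ?nnegrE ?hk.
by apply: rI_subset => //; [bmt|move=> x; exact: sqr_ge0].
Qed.

Lemma der_lin (v th x : R) : der (fun y => v * y + th) x v.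
Proof.
by apply: der_eq (derD (derZ v (der_id x)) (der_cst th x)) _; rewrite mulr1 addr0.
Qed.

Lemma der_lin0 (v x : R) : der (fun y => v * y) x v.
Proof. by apply: der_eq (derZ v (der_id x)) _; rewrite mulr1. Qed.

(* Fourier transform of the raised cosine squared on [[-S,S]]: the weight vanishes to
   second order at the end points, so two integrations by parts are free of boundary terms. *)
Lemma raised_cosine (S : R) : 0 < S -> exists2 D : R, 0 <= D & forall v th,
  `|\int[mu]_(x in `[- S, S]) (cos (v * x + th) * (1 + cos (pi / S * x)) ^+ 2)|
    <= D * (1 + v ^+ 2)^-1.
Proof.
move=> S0; set w := pi / S.
pose A x := (1 + cos (w * x)) ^+ 2.
pose A1 x := - (w * sin (w * x) * (1 + cos (w * x)) *+ 2).
pose A2 x := w ^+ 2 * (sin (w * x) ^+ 2 - cos (w * x) * (1 + cos (w * x))) *+ 2.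
have dA x : der A x (A1 x).
  have e := derD (der_cst 1 x) (der_cos (der_lin0 w x)).
  apply: der_eq (derM e e) _; rewrite /A1 mulr2n; ring.
have dA1 x : der A1 x (A2 x).
  have e1 := derZ w (der_sin (der_lin0 w x)).
  have e := derD (der_cst 1 x) (der_cos (der_lin0 w x)).
  rewrite (_ : A1 = fun x => (-2) * (w * sin (w * x) * (1 + cos (w * x)))); last first.
    by apply/funext => y; rewrite /A1 mulr2n; ring.
  apply: der_eq (derZ (-2) (derM e1 e)) _; rewrite /A2 mulr2n; ring.
have mw : measurable_fun setT (fun x : R => w * x) by mft.
have bA : bm A by rewrite /A; bmt.
have bA2 : bm A2.
  rewrite (_ : A2 = fun x => 2 * (w ^+ 2 * (sin (w * x) ^+ 2 - cos (w * x) * (1 + cos (w * x))))); last first.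
    by apply/funext => y; rewrite /A2 mulr2n; ring.
  by bmt.
have [N N0 bN] := bm_bound bA; have [N2 N20 bN2] := bm_bound bA2.
have SS : - S <= S by lra.
have fS := finm_itv (- S) S.
have wS : w * S = pi by rewrite /w divfK// gt_eqF.
have wNS : w * - S = - pi by rewrite mulrN wS.
exists ((N + N2) * (2 * S)); first by rewrite mulr_ge0// ?addr_ge0// ?mulr_ge0// ltW.
move=> v th.
have mv : measurable_fun setT (fun x : R => v * x + th) by mft.
have bb (B : R -> R) M : bm B -> (forall x, `|B x| <= M) ->
    `|\int[mu]_(x in `[- S, S]) (cos (v * x + th) * B x)| <= M * (2 * S).
  move=> bB hB; apply: le_trans (rI_abs fS _) _; first by bmt.
  have -> : 2 * S = fine (mu `[- S, S]%classic) by rewrite fine_mu_itv//; lra.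
  rewrite -rI_cst//; apply: rI_le => //; try by bmt.
  move=> x _; rewrite normrM -[leRHS]mul1r ler_pM//.
  by rewrite ler_norml cos_geN1 cos_le1.
have J1 := bb _ _ bA bN; have J2 := bb _ _ bA2 bN2.
have v0 : 0 < 1 + v ^+ 2 by rewrite ltr_pwDl// sqr_ge0.
rewrite ler_pdivlMr// mulrDr mulr1 [leRHS]mulrDl lerD//.
suff -> : `|\int[mu]_(x in `[- S, S]) (cos (v * x + th) * A x)| * v ^+ 2 =
    `|\int[mu]_(x in `[- S, S]) (cos (v * x + th) * A2 x)| by [].
have b1 : bm (fun x => cos (v * x + th) * A x) by bmt.
have b2 : bm (fun x => cos (v * x + th) * A2 x) by bmt.
rewrite -[v ^+ 2]ger0_norm ?sqr_ge0// -normrM -[RHS]normrN; congr `|_|.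
apply/eqP; rewrite eq_sym -subr_eq0 -opprD oppr_eq0 mulrC -rIZ// -rID//; last by bmt.
(* The primitive behind two integrations by parts at once: its derivative is [cos A'' + v^2 cos A],
   and it vanishes at both end points because [A] and [A'] do. *)
have dF x : der (fun x => v * sin (v * x + th) * A x + cos (v * x + th) * A1 x) x
    (cos (v * x + th) * A2 x + v ^+ 2 * (cos (v * x + th) * A x)).
  apply: der_eq (derD (derM (derZ v (der_sin (der_lin v th x))) (dA x))
    (derM (der_cos (der_lin v th x)) (dA1 x))) _.
  by ring.
rewrite (FTC SS dF).
  by rewrite /A /A1 wS wNS cosN sinN cospi sinpi; apply/eqP; ring.
have cc : continuous (fun x => cos (v * x + th)).
  by apply: (der_continuous (f' := fun x => - sin (v * x + th) * v)) => x; exact/der_cos/der_lin.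
have cs : continuous (fun x => sin (w * x)).
  by apply: (der_continuous (f' := fun x => cos (w * x) * w)) => x; exact/der_sin/der_lin0.
have cw : continuous (fun x => cos (w * x)).
  by apply: (der_continuous (f' := fun x => - sin (w * x) * w)) => x; exact/der_cos/der_lin0.
move=> x; apply: cvgD; apply: cvgM.
- exact: cc.
- rewrite /A2; apply: cvgMn; apply: cvgM; first exact: cvg_cst.
  apply: cvgB.
    apply: (@continuous_comp _ _ _ (fun x => sin (w * x)) (fun u => u ^+ 2)).
      exact: cs.
    exact: exprn_continuous.
  by apply: cvgM; [exact: cw|apply: cvgD; [exact: cvg_cst|exact: cw]].
- exact: cvg_cst.
- by apply: cvgM; [exact: cc|exact: (der_continuous dA)].
Qed.

(* The raised cosine dominates a multiple of the indicator of the window, so the Schur test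
   applies and Plancherel's theorem is not needed. *)
Lemma half_plancherel (T : R) : 0 < T -> exists2 D : R, 0 <= D & forall (X e : R) f, 0 <= X ->
  `|e| = 1 -> cbm f ->
  n2 `[- T, T] (fun xi => cint `[- X, X] (fun x => cmul (f x) (cexpi (e * (x * xi)))))
    <= D * n2 `[- X, X] f.
Proof.
move=> T0; have S0 : 0 < 2 * T by rewrite mulr_gt0.
have [D D0 bD] := raised_cosine S0.
exists (2 * D * pi); first by rewrite mulr_ge0 ?mulr_ge0// pi_ge0.
move=> X e f X0 e1 bf.
have fS := finm_itv (- (2 * T)) (2 * T); have fT := finm_itv (- T) T.
have fX := finm_itv (- X) X.
pose chi (xi : R) := 1 + cos (pi / (2 * T) * xi).
have bchi : bm chi by rewrite /chi; bmt.
pose k (p : R * R) := cmul (cexpi (e * (p.1 * p.2))) (chi p.2, 0).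
have bk : cbm k by rewrite /k; bmt.
have bfk : cbm (fun p : R * R => cmul (f p.1) (k (p.1, p.2))) by bmt.
have bfe : cbm (fun p : R * R => cmul (f p.1) (cexpi (e * (p.1 * p.2)))) by bmt.
(* The weight lives on the doubled window. On [[-T, T]] its cosine has argument at most [pi / 2] in
   absolute value, so that [chi >= 1] there. *)
apply: (@le_trans _ _ (n2 `[- (2 * T), 2 * T] (fun xi => cint `[- X, X] (fun x => cmul (f x) (k (x, xi)))))).
  apply: n2_le => //; [|exact: (cbm_cint2 bfe)|exact: (cbm_cint2 bfk)|].
    by move=> y /=; rewrite !in_itv /= => /andP[? ?]; apply/andP; split; lra.
  move=> y /=; rewrite in_itv /= => /andP[y1 y2].
  have -> : cint `[- X, X] (fun x => cmul (f x) (k (x, y))) =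
      cmul (cint `[- X, X] (fun x => cmul (f x) (cexpi (e * (x * y))))) (chi y, 0).
    rewrite -cintZr//; last by bmt.
    by apply: eq_cint => x _; rewrite cmulA.
  rewrite cnormM cnorm_real ler_peMr// (le_trans _ (ler_norm _))// lerDl.
  have pT : pi / (2 * T) * T = pi / 2 by field; rewrite gt_eqF.
  have p0 : 0 <= pi / (2 * T) by rewrite divr_ge0 ?pi_ge0// ltW.
  apply: cos_ge0_pihalf; rewrite -pT -mulrN.
  by apply/andP; split; rewrite ler_wpM2l.
(* The [T T^*] kernel is the transform of [chi^2] at [x - x']; the factor [2] adds its real and
   imaginary parts. *)
apply: (schur_test (kap := fun p => 2 * D * (1 + (p.1 - p.2) ^+ 2)^-1)) => //=.
- have bq : bm (fun u : R => (1 + u ^+ 2)^-1).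
    have d0 (u : R) : 0 < 1 + u ^+ 2 by rewrite ltr_pwDl// sqr_ge0.
    split; last first.
      exists 1 => u; rewrite ger0_norm ?invr_ge0; last exact/ltW/d0.
      by rewrite invf_le1// lerDl sqr_ge0.
    apply: cont_meas => u; apply: cvgV; first by rewrite gt_eqF.
    by apply: cvgD; [exact: cvg_cst|apply: exprn_continuous].
  apply: bmM; first exact: bm_cst.
  by apply: (@bm_comp _ _ _ _ _ _ (fun p : R * R => p.1 - p.2) bq); mft.
- by move=> x y; congr (_ * (_ + _)^-1); ring.
- by move=> p; rewrite mulr_ge0 ?mulr_ge0// invr_ge0 addr_ge0// sqr_ge0.
- move=> x x' _ _.
  have b1 := bD (e * (x - x')) 0; have b2 := bD (e * (x - x')) (- (pi / 2)).
  apply: le_trans (cnorm_le _) _.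
  have e2 : e ^+ 2 = 1 by rewrite -real_normK ?num_real// e1 expr1n.
  move: b1 b2; rewrite exprMn e2 mul1r.
  set I1 := \int[mu]_(x in _) _; set I2 := \int[mu]_(x in _) _ => b1 b2.
  rewrite [X in cint _ X](_ : _ = fun y => (cos (e * (x - x') * y + 0) * chi y ^+ 2,
      cos (e * (x - x') * y - (pi / 2)) * chi y ^+ 2)).
    by rewrite /= -/I1 -/I2; move: b1 b2; lra.
  apply/funext => y; rewrite /k /= cconjM cconj_expi cmulACA -cexpiD.
  rewrite /cexpi addr0 cosBpihalf (_ : e * (x * y) + - _ = e * (x - x') * y); last by ring.
  by rewrite /cconj /cmul /=; congr (_, _); ring.
move=> x _.
have bq : bm (fun u : R => (1 + (x - u) ^+ 2)^-1).
  have d0 (u : R) : 0 < 1 + (x - u) ^+ 2 by rewrite ltr_pwDl// sqr_ge0.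
  split; last first.
    exists 1 => u; rewrite ger0_norm ?invr_ge0; last exact/ltW/d0.
    by rewrite invf_le1// lerDl sqr_ge0.
  apply: cont_meas => u; apply: cvgV; first by rewrite gt_eqF.
  apply: cvgD; first exact: cvg_cst.
  apply: (@continuous_comp _ _ _ (fun u => x - u) (fun u => u ^+ 2)).
    by apply: cvgB; [exact: cvg_cst|exact: cvg_id].
  exact: exprn_continuous.
rewrite rIZ// ler_wpM2l ?mulr_ge0//.
have := @rI_lorentz_pi _ x 1 X X0; rewrite normr1 mul1r.
by under eq_Rintegral do rewrite expr1n mul1r.
Qed.

(** Duality with the previous bound: [N], the squared norm of [u], is the pairing of [U] with the
    transform [V] of [conj u]. Cauchy-Schwarz gives [N^2 <= n2 U * (D N)], and one factor [N] is
    cancelled. *)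
Lemma half_plancherel_dual (T : R) : 0 < T -> exists2 D : R, 0 <= D & forall (X : R) U, 0 <= X ->
  cbm U ->
  n2 `[- X, X] (fun x => cint `[- T, T] (fun z => cmul (cexpi (x * z)) (U z)))
    <= D * n2 `[- T, T] U.
Proof.
move=> T0; have [D D0 bD] := half_plancherel T0; exists D => // X U X0 bU.
have fT := finm_itv (- T) T; have fX := finm_itv (- X) X.
pose u x := cint `[- T, T] (fun z => cmul (cexpi (x * z)) (U z)).
have bk : cbm (fun p : R * R => cmul (cexpi (p.1 * p.2)) (U p.2)) by bmt.
have bu : cbm u by exact: (cbm_cint1 bk).
have bku : cbm (fun p : R * R => cmul (cconj (u p.1)) (cmul (cexpi (p.1 * p.2)) (U p.2))).
  by bmt.
rewrite -/u; set N := n2 _ u.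
have N0 : 0 <= N by exact: n2_ge0.
pose V z := cint `[- X, X] (fun x => cmul (cconj (u x)) (cexpi (1 * (x * z)))).
have bk' : cbm (fun p : R * R => cmul (cconj (u p.1)) (cexpi (1 * (p.1 * p.2)))) by bmt.
have bV : cbm V by exact: (cbm_cint2 bk').
have E : (N, 0) = cint `[- T, T] (fun z => cmul (U z) (V z)).
  rewrite /N /n2 -cint_real//; last by bmt.
  transitivity (cint `[- X, X] (fun x => cint `[- T, T] (fun z =>
      cmul (cconj (u x)) (cmul (cexpi (x * z)) (U z))))).
    apply: eq_cint => x _; rewrite -cmul_conj cmulC cintZ//; by bmt.
  rewrite (cint_fubini bku fX fT) /=; apply: eq_cint => z _.
  rewrite /V -cintZ//; last by bmt.
  by apply: eq_cint => x _; rewrite mul1r cmulA cmulC.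
have := cint_cauchy_schwarz fT bU bV; rewrite -E cnorm_real ger0_norm// => h.
have bcu : cbm (fun x => cconj (u x)) by bmt.
have h2 : n2 `[- T, T] V <= D * N.
  have := bD X 1 _ X0 (normr1 _) bcu; congr (_ <= _ * _).
  by apply: eq_Rintegral => x _; rewrite cnorm_conj.
have [->|Nn0] := eqVneq N 0; first by rewrite mulr_ge0// n2_ge0.
have Np : 0 < N by rewrite lt0r Nn0.
clearbody N.
rewrite -(ler_pM2r Np) -expr2 (le_trans h)// -mulrA mulrCA.
by rewrite ler_wpM2l ?n2_ge0.
Qed.

End Plancherel.

(** * Continuous and smooth functions of two variables *)

Section Plane.
Context (R : realType).
Local Notation mu := (@lebesgue_measure R).
Local Notation C := (R * R)%type.

(** Measurability refers to the product sigma-algebra: an open set of the plane is a countable union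
    of boxes with rational centres and radii. *)
Lemma cont2_meas (f : R * R -> R) : continuous f -> measurable_fun setT f.
Proof.
move=> cf mD; apply: (measurability _ (RGenOInfty.measurableE R)) => //.
move=> /= _ [_ [a ->] <-]; rewrite setTI.
set U := f @^-1` _.
have oU : open U by apply: open_comp => // p _; exact: cf.
pose box (q1 q2 q3 : rat) : set (R * R) := [set p | `|p.1 - ratr q1| < ratr q3 /\ `|p.2 - ratr q2| < ratr q3].
have mbox q1 q2 q3 : measurable (box q1 q2 q3).
  have e (q r : rat) : measurable [set x : R | `|x - ratr q| < ratr r].
    apply: open_measurable.
    apply: (@open_comp _ _ (fun x : R => `|x - ratr q|) [set x | x < ratr r]) => [x _|].
      apply: (@continuous_comp _ _ _ (fun x : R => x - ratr q) Num.norm).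
        by apply: cvgB; [exact: cvg_id|exact: cvg_cst].
      exact: norm_continuous.
    exact: open_lt.
  rewrite (_ : box q1 q2 q3 = (fst @^-1` [set x : R | `|x - ratr q1| < ratr q3])
      `&` (snd @^-1` [set x : R | `|x - ratr q2| < ratr q3])) //.
  apply: measurableI; rewrite -[X in measurable X]setTI.
    exact: measurable_fst.
  exact: measurable_snd.
rewrite (_ : U = \bigcup_(q1 : rat) \bigcup_(q2 : rat) \bigcup_(q3 : rat)
    (if `[< box q1 q2 q3 `<=` U >] then box q1 q2 q3 else set0)).
  apply: bigcupT_measurable_rat => q1; apply: bigcupT_measurable_rat => q2.
  by apply: bigcupT_measurable_rat => q3; case: ifPn.
apply/seteqP; split => [p Up|p [q1 _ [q2 _ [q3 _]]]]; last first.
  by case: asboolP => [bU /bU|].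
have /nbhs_ballP[e /= e0 be] : nbhs p U by apply: open_nbhs_nbhs.
have [q3 q3e] := @rat_in_itvoo _ 0 (e / 2) (divr_gt0 e0 (ltr0n _ 2)).
move: q3e; rewrite in_itv /= => /andP[q30 q3e].
have ex (x : R) : exists q : rat, `|x - ratr q| < ratr q3.
  have [|q] := @rat_in_itvoo _ (x - ratr q3) (x + ratr q3); first by lra.
  rewrite in_itv /= => /andP[? ?]; exists q; rewrite ltr_norml; apply/andP; split; lra.
have [q1 h1] := ex p.1; have [q2 h2] := ex p.2.
exists q1 => //; exists q2 => //; exists q3 => //.
case: asboolP => // nb; exfalso; apply: nb => z [z1 z2]; apply: be.
have d (x y q : R) : `|x - q| < ratr q3 -> `|y - q| < ratr q3 -> `|x - y| < e.
  move=> hx hy; rewrite (_ : x - y = (x - q) - (y - q)); last by ring.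
  by rewrite (le_lt_trans (ler_normB _ _))//; lra.
by split; rewrite /ball /=; [exact: d h1 z1|exact: d h2 z2].
Qed.

(** Differentiability is recorded as the chain rule along affine paths. This is the only way in
    which symbols get differentiated later, and it is stable under exchanging the variables. *)
Fixpoint sm2 (n : nat) (f : R * R -> R) : Prop :=
  continuous f /\
  if n is n'.+1 then exists f1 f2, [/\ forall x0 y0 a b t,
      der (fun t => f (x0 + a * t, y0 + b * t)) t
        (a * f1 (x0 + a * t, y0 + b * t) + b * f2 (x0 + a * t, y0 + b * t)),
      sm2 n' f1 & sm2 n' f2]
  else True.

Lemma sm2_cont n f : sm2 n f -> continuous f.
Proof. by case: n => [|n] []. Qed.

Lemma der_path (f : R * R -> C) (pr : C -> R) x0 y0 a b t :
  linear pr -> continuous pr -> (forall p, differentiable f p) ->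
  der (fun t => pr (f (x0 + a * t, y0 + b * t))) t
     (a * pr ('D_(e1 R) f (x0 + a * t, y0 + b * t)) +
      b * pr ('D_(e2 R) f (x0 + a * t, y0 + b * t))).
Proof.
move=> lpr cpr df.
pose prM := GRing.isLinear.Build _ _ _ _ _ lpr.
pose prL : {linear C -> R} := HB.pack pr prM.
pose g1 t := x0 + a * t; pose g2 t := y0 + b * t.
pose g t := (g1 t, g2 t).
have dg1 : der g1 t a.
  by apply: der_eq (derD (der_cst x0 t) (der_lin0 a t)) _; rewrite add0r.
have dg2 : der g2 t b.
  by apply: der_eq (derD (der_cst y0 t) (der_lin0 b t)) _; rewrite add0r.
have fg1 : differentiable g1 t by apply/derivable1_diffP; case: dg1.
have fg2 : differentiable g2 t by apply/derivable1_diffP; case: dg2.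
have fg : differentiable g t by exact: differentiable_pair.
have ffg : differentiable (f \o g) t by exact: differentiable_comp.
have fp : differentiable prL (f (g t)) by exact: linear_differentiable.
have D : differentiable (prL \o (f \o g)) t by exact: differentiable_comp.
split; first exact/derivable1_diffP.
have E1 : 'd (prL \o (f \o g)) t 1 = prL ('d f (g t) ('d g t 1)).
  have dc1 := diff_comp ffg fp; have dc2 := diff_comp fg (df (g t)).
  have dl : 'd prL (f (g t)) = prL :> (C -> R) by exact: diff_lin.
  apply: etrans (congr1 (fun F : R -> R => F 1) dc1) _.
  apply: etrans (congr1 (fun F : C -> R => F ('d (f \o g) t 1)) dl) _.
  exact: (congr1 (fun F : R -> C => prL (F 1)) dc2).
have E2 : 'd g t 1 = ('D_1 g1 t, 'D_1 g2 t) by rewrite diff_pair// !deriveE.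
rewrite -[LHS]/('D_1 (prL \o (f \o g)) t) deriveE// E1 E2.
case: dg1 => _ ->; case: dg2 => _ ->.
have -> : (a, b) = a *: (e1 R) + b *: (e2 R) :> C.
  transitivity ((a * 1 + b * 0, a * 0 + b * 1) : C) => //.
  by rewrite !mulr0 !mulr1 addr0 add0r.
rewrite linearP linearZ -!deriveE//.
have lz c z : pr (c *: z) = c * pr z by exact: (linearZ_LR prL).
by rewrite [LHS]lpr lz.
Qed.

Lemma fst_lin : linear (fun z : C => z.1). Proof. by []. Qed.
Lemma snd_lin : linear (fun z : C => z.2). Proof. by []. Qed.

Lemma sm2_smooth2 (m : R * R -> C) : smooth2 m ->
  forall n, sm2 n (fun p => (m p).1) /\ sm2 n (fun p => (m p).2).
Proof.
move=> sm n.
(* The induction on [n] has to cover all iterated derivatives of [m] together; [pr] stands for the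
   real or the imaginary part. *)
have main (pr : C -> R) : linear pr -> continuous pr -> forall l, sm2 n (fun p => pr (Defs.iterD l m p)).
  move=> lpr cpr; elim: n => [|n ih] l.
    split => // p; apply: continuous_comp; last exact: cpr.
    exact: differentiable_continuous.
  split.
    move=> p; apply: continuous_comp; last exact: cpr.
    exact: differentiable_continuous.
  exists (fun p => pr (Defs.iterD (true :: l) m p)), (fun p => pr (Defs.iterD (false :: l) m p)).
  split; [|exact: ih|exact: ih] => x0 y0 a b t; exact: der_path.
split.
  by apply: (main (fun z => z.1) fst_lin _ [::]) => z; exact: cvg_fst.
by apply: (main (fun z => z.2) snd_lin _ [::]) => z; exact: cvg_snd.
Qed.

Lemma sm2_swap n f : sm2 n f -> sm2 n (fun p => f (p.2, p.1)).
Proof.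
have cs : continuous (fun p : R * R => (p.2, p.1)).
  exact: swap_continuous.
elim: n f => [|n ih] f [cf sf]; split => //.
- by move=> p; apply: (@continuous_comp _ _ _ (fun p => (p.2, p.1)) f); [exact: cs|exact: cf].
- by move=> p; apply: (@continuous_comp _ _ _ (fun p => (p.2, p.1)) f); [exact: cs|exact: cf].
- case: sf => f1 [f2 [df sf1 sf2]].
  exists (fun p => f2 (p.2, p.1)), (fun p => f1 (p.2, p.1)); split; [|exact: ih|exact: ih].
  by move=> x0 y0 a b t /=; apply: der_eq (df y0 x0 b a t) _; rewrite addrC.
Qed.

Lemma cont2_bounded (f : R * R -> R) (B : R) : continuous f ->
  exists D : R, forall x y, `|x| <= B -> `|y| <= B -> `|f (x, y)| <= D.
Proof.
move=> cf.
have cB : compact (`[- B, B]%classic `*` `[- B, B]%classic : set (R * R)).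
  by apply: compact_setX; exact: segment_compact.
have /compact_bounded[D [_ bD]] : compact (f @` (`[- B, B]%classic `*` `[- B, B]%classic)).
  by apply: continuous_compact => //; exact: continuous_subspaceT.
exists (D + 1) => x y hx hy.
have h : D < D + 1 by rewrite ltrDl.
by apply: (bD _ h (f (x, y))); exists (x, y) => //=; rewrite !in_itv /= -!ler_norml.
Qed.

Lemma cont_pair (f g : R -> R) : continuous f -> continuous g ->
  continuous (fun y => (f y, g y) : R * R).
Proof. by move=> cf cg y; exact: (cvg_pair (cf y) (cg y)). Qed.

Lemma cont_affine (a b : R) : continuous (fun y => a + b * y).
Proof.
by apply: (der_continuous (f' := fun _ => 0 + b)) => y; exact: derD (der_cst a y) (der_lin0 b y).
Qed.

Lemma smf_sm2 (P : Type) (K : P -> set R) n f (x0 y0 : P -> R) (a b B : R) :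
  sm2 n f -> (forall p y, K p y -> `|x0 p + a * y| <= B /\ `|y0 p + b * y| <= B) ->
  smf K n (fun p y => f (x0 p + a * y, y0 p + b * y)).
Proof.
move=> + KB; elim: n f => [|n ih] f [cf sf]; split => //.
- move=> p y; apply: (@continuous_comp _ _ _ (fun y => (x0 p + a * y, y0 p + b * y)) f); last exact: cf.
  by apply: cont_pair; exact: cont_affine.
- have [D bD] := cont2_bounded B cf; exists D => p y /KB[? ?]; exact: bD.
- case: sf => f1 [f2 [df _ _]] p; apply: der_continuous => y; exact: df.
- have [D bD] := cont2_bounded B cf; exists D => p y /KB[? ?]; exact: bD.
- case: sf => f1 [f2 [df sf1 sf2]].
  eexists; first by move=> p y; exact: df.
  by apply: smfD; apply: smfM; [exact: smf_cst|exact: ih|exact: smf_cst|exact: ih].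
Qed.

End Plane.

(** * Bilinear estimates at a fixed time *)

Section Symbols.
Context (R : realType).
Local Notation mu := (@lebesgue_measure R).
Local Notation C := (R * R)%type.

Definition symb (L : R) (m : R * R -> C) :=
  [/\ forall n, sm2 n (fun p => (m p).1), forall n, sm2 n (fun p => (m p).2)
    & forall x y, ~ (`|x| <= L /\ `|y| <= L) -> m (x, y) = 0].

Lemma symb_swap L m : symb L m -> symb L (fun p => m (p.2, p.1)).
Proof.
move=> [s1 s2 z]; split.
- by move=> n; exact: (sm2_swap (s1 n)).
- by move=> n; exact: (sm2_swap (s2 n)).
- by move=> x y nxy; apply: z => -[? ?]; apply: nxy.
Qed.

Lemma symb_cbm L m : symb L m -> cbm m.
Proof.
move=> [s1 s2 z].
have bb (f : R * R -> R) : continuous f ->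
    (forall x y, ~ (`|x| <= L /\ `|y| <= L) -> f (x, y) = 0) -> bm f.
  move=> cf zf; split; first exact: cont2_meas.
  have [D bD] := cont2_bounded L cf; exists `|D| => -[x y].
  have [[hx hy]|nxy] := pselect (`|x| <= L /\ `|y| <= L).
    by rewrite (le_trans (bD _ _ hx hy))// ler_norm.
  by rewrite zf// normr0.
split; apply: bb.
- exact: sm2_cont (s1 0%N).
- by move=> x y /z ->.
- exact: sm2_cont (s2 0%N).
- by move=> x y /z ->.
Qed.

Lemma le_of_eq (x y : R) : x = y -> x <= y.
Proof. by move=> ->. Qed.

Lemma in_sym (S x : R) : `[- S, S]%classic x <-> `|x| <= S.
Proof. by rewrite /= in_itv /= ler_norml. Qed.

Lemma notin_sym (S x : R) : ~ `[- S, S]%classic x -> S < `|x|.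
Proof. by move=> h; rewrite ltNge; apply/negP => /in_sym. Qed.

Lemma sub_sym (S S' : R) : S <= S' -> `[- S, S]%classic `<=` `[- S', S']%classic.
Proof. by move=> SS x /in_sym h; apply/in_sym; exact: le_trans h _. Qed.

(** Both windows contain the support of their integrand, so a translation does not have to carry the
    domain along. *)
Lemma cint_shift (h : R -> C) (v S S' : R) : cbm h ->
  (forall x, S < `|x| -> h x = 0) -> (forall x, S' < `|x| -> h (x + v) = 0) ->
  cint `[- S, S] h = cint `[- S', S'] (fun x => h (x + v)).
Proof.
move=> [h1 h2] z z'; have fS := finm_itv (- S) S.
transitivity (cint ((fun x => x + v) @^-1` `[- S, S]) (fun x => h (x + v))).
  by rewrite /cint (rI_shift v h1 fS) (rI_shift v h2 fS).
rewrite (@cint_supp _ _ setT)//; last first.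
  move=> x _ nx; apply: z; apply: notin_sym; exact: nx.
symmetry; apply: cint_supp => // x _ /notin_sym; exact: z'.
Qed.

Lemma cint_oppr (h : R -> C) (S : R) : cbm h ->
  cint `[- S, S] h = cint `[- S, S] (fun x => h (- x)).
Proof.
move=> [h1 h2]; have fS := finm_itv (- S) S.
transitivity (cint (-%R @^-1` `[- S, S]%classic) (fun x => h (- x))).
  by rewrite /cint (rI_oppr h1 fS) (rI_oppr h2 fS).
congr (cint _ _); apply/seteqP; split => x /=.
  by move=> /in_sym; rewrite normrN => hx; apply/in_sym.
by move=> /in_sym hx; apply/in_sym; rewrite normrN.
Qed.

(** Two cases are used. With [eps = 1] and [p = 0], the variables are the two input frequencies and
    the phase is [a] at their sum. With [eps = -1] and [p = -1], they are one input frequency and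
    the output frequency, and the phase is [c] at their difference. *)
Lemma hormander_symb (L eps p kap : R) (al : R -> R) (m : R * R -> C) :
  0 <= L -> `|eps| = 1 -> `|p| <= 1 -> smooth1 al -> 0 < kap ->
  (forall x, kap <= `|derive1n 2 al x|) -> symb L m ->
  let T := 2 * L in
  exists2 D : R, 0 <= D & forall lam Phi, cbm Phi ->
  n2 `[- (T + 1), T + 1] (fun y => cint `[- T, T] (fun x => cmul (Phi x)
      (cmul (cexpi (lam * al (eps * x + y))) (m (x, p * x + y))))) <=
    D / (1 + `|lam|) * n2 `[- T, T] Phi.
Proof.
move=> L0 e1 p1 sal k0 kal sm T.
have bm_ := symb_cbm sm.
have T0 : 0 <= T by rewrite mulr_ge0.
pose M1 (q : R * R) y := (q.1 == 0)%:R * (m (q.2, p * q.2 + y)).1.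
pose M2 (q : R * R) y := (q.1 == 0)%:R * (m (q.2, p * q.2 + y)).2.
have px (x : R) : `|x| <= T -> `|p * x| <= T.
  by move=> hx; rewrite normrM (le_trans (ler_wpM2r _ p1))// mul1r.
have sind : smf (hK T) 2 (fun q _ => ((q.1 : R) == 0)%:R : R).
  by apply: (@smf_param _ _ _ _ _ 1) => q x _; case: eqP => _; rewrite ?normr0 ?normr1.
have sM (f : R * R -> R) : sm2 2 f ->
    smf (hK T) 2 (fun q y => (q.1 == 0)%:R * f (q.2, p * q.2 + y)).
  move=> sf; apply: smfM => //.
  rewrite (_ : (fun _ _ => _) = (fun (q : R * R) y => f (q.2 + 0 * y, p * q.2 + 1 * y))); last first.
    by apply/funext => q; apply/funext => y; rewrite mul0r addr0 mul1r.
  apply: (@smf_sm2 _ _ _ _ _ _ _ _ _ (2 * T)) => // q y [hy _ hx].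
  rewrite mul0r addr0 mul1r; split; first lra.
  by rewrite (le_trans (ler_normD _ _))//; have := px _ hx; lra.
have z0 (q : R * R) y : ~ hK T q y -> (q.1 == 0)%:R = 0 :> R \/ m (q.2, p * q.2 + y) = 0.
  move=> nK; case: eqP => [q0|]; [right|by left].
  case: sm => _ _; apply => -[h1 h2]; apply: nK; rewrite /hK /= q0 normr0.
  have h3 : `|q.2| <= T by rewrite /T; lra.
  split => //; rewrite (_ : y = (p * q.2 + y) - p * q.2); last by ring.
  rewrite (le_trans (ler_normB _ _))// /T mulrDl mul1r lerD//.
  by rewrite normrM (le_trans (ler_wpM2r _ p1))// mul1r.
have zM1 : supK (hK T) M1 by move=> q y /z0[e|e]; rewrite /M1 e ?mul0r ?mulr0.
have zM2 : supK (hK T) M2 by move=> q y /z0[e|e]; rewrite /M2 e ?mul0r ?mulr0.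
case: (sm) => s1 s2 _.
have sM1 : smf (hK T) 2 M1 by exact: sM (s1 2).
have sM2 : smf (hK T) 2 M2 by exact: sM (s2 2).
have bM sig : cbm (fun q : R * R => (M1 (sig, q.1) q.2, M2 (sig, q.1) q.2)).
  have mg : measurable_fun setT (fun q : R * R => (q.1, p * q.1 + q.2)) by mft.
  have [b1 b2] := bm_.
  have b1' := bm_comp b1 mg; have b2' := bm_comp b2 mg.
  rewrite /M1 /M2 /=; split => /=.
    exact: (bmM (bm_cst _ _) b1').
  exact: (bmM (bm_cst _ _) b2').
have [D D0 bD] := hormander T0 e1 sal k0 kal sM1 sM2 zM1 zM2 bM.
exists D; first exact: D0.
move=> lam Phi bP; apply: le_trans (bD 0 lam Phi bP); apply: le_of_eq.
apply: eq_Rintegral => y _; congr (cnorm _ ^+ 2); apply: eq_cint => x _.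
rewrite /hker /M1 /M2 /= eqxx !mul1r addr0; congr (cmul _ (cmul _ _)).
by case: (m _).
Qed.

End Symbols.

Section FixedTime.
Context (R : realType) (L : R) (b c : R -> R) (m : R * R -> R * R).
Local Notation mu := (@lebesgue_measure R).
Local Notation C := (R * R)%type.
Hypothesis L0 : 0 <= L.
Hypothesis mb : measurable_fun setT b.
Hypothesis mc : measurable_fun setT c.
Hypothesis sm : symb L m.
Local Notation T := (2 * L).
Local Notation IT := (`[- (2 * L), 2 * L]%classic).
Local Notation W := (`[- (2 * L + 1), 2 * L + 1]%classic).
Implicit Types F G : R -> C.

Let bm_ : cbm m. Proof. exact: symb_cbm sm. Qed.
Let fT : finm IT. Proof. exact: finm_itv. Qed.
Let fW : finm W. Proof. exact: finm_itv. Qed.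

Lemma symb0 x y : ~ (`|x| <= L /\ `|y| <= L) -> m (x, y) = 0.
Proof. by case: sm => _ _; apply. Qed.

Lemma vhat_cbm (d : R -> R) F s : measurable_fun setT d -> cbm F -> cbm (vhat d F s).
Proof. by move=> md bF; rewrite (_ : vhat d F s = fun x => cmul (cexpi (s * d x)) (F x))//; bmt. Qed.

Lemma n2_vhat D (d : R -> R) F s : n2 D (vhat d F s) = n2 D F.
Proof. by apply: eq_Rintegral => x _; rewrite cnorm_expiM. Qed.

Lemma TmE S F G s z : L <= S -> Tm_hat b c m F G s z =
  cint `[- S, S] (fun xi =>
    cmul (cmul (vhat b F s xi) (vhat c G s (z - xi))) (m (xi, z - xi))).
Proof.
move=> LS; symmetry; apply: cint_supp => // xi _ /notin_sym h.
by rewrite symb0 ?cmulz0// => -[h' _]; move: h; rewrite ltNge (le_trans h').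
Qed.

Lemma Tm_supp F G s z : T < `|z| -> Tm_hat b c m F G s z = 0.
Proof.
move=> hz; rewrite (TmE _ _ _ _ (lexx L)); transitivity (cint `[- L, L] (fun _ : R => 0 : C)).
  apply: eq_cint => xi _; rewrite symb0 ?cmulz0// => -[h1 h2].
  move: hz; rewrite ltNge; case/negP; rewrite (_ : z = xi + (z - xi)); last by ring.
  by rewrite (le_trans (ler_normD _ _))//; lra.
by rewrite /cint rI_cst ?mul0r//; exact: finm_itv.
Qed.

Lemma cbm_Tm F G : cbm F -> cbm G -> cbm (fun p : R * R => Tm_hat b c m F G p.1 p.2).
Proof.
move=> bF bG.
rewrite (_ : (fun _ => _) = fun p : R * R => cint IT (fun xi =>
   cmul (cmul (cmul (cexpi (p.1 * b xi)) (F xi))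
     (cmul (cexpi (p.1 * c (p.2 - xi))) (G (p.2 - xi)))) (m (xi, p.2 - xi)))); last first.
  by apply/funext => p; rewrite (@TmE T)//; have := L0; lra.
apply: (@cbm_cint _ _ _ (fun q : (R * R) * R =>
   cmul (cmul (cmul (cexpi (q.1.1 * b q.2)) (F q.2))
     (cmul (cexpi (q.1.1 * c (q.1.2 - q.2))) (G (q.1.2 - q.2)))) (m (q.2, q.1.2 - q.2)))) => //.
by bmt.
Qed.

Lemma cbm_Tm2 F G s : cbm F -> cbm G -> cbm (Tm_hat b c m F G s).
Proof. by move=> bF bG; exact: (cbm2 s (cbm_Tm bF bG)). Qed.

(** In terms of the input frequencies [xi] and [y = z - xi], the left side is a bilinear form in the
    two data with kernel [cexpi (r a(xi + y)) m(xi, y)], and [x] merely modulates the data. Its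
    operator norm decays like [|r|^(-1/2)], uniformly in [x] and in the time [s]. *)
Lemma dispersive_bound (a : R -> R) (kap : R) :
  smooth1 a -> 0 < kap -> (forall x, kap <= `|derive1n 2 a x|) ->
  exists2 D : R, 0 <= D & forall r s x F G, cbm F -> cbm G ->
    cnorm (cint IT (fun z => cmul (cexpi (x * z))
      (cmul (cexpi (r * a z)) (Tm_hat b c m F G s z)))) ^+ 2
    <= D / (1 + `|r|) * (n2 W F * n2 W G).
Proof.
move=> sa k0 ka.
have n01 : `|0 : R| <= 1 by rewrite normr0.
have [D D0 bD] := hormander_symb L0 (normr1 R) n01 sa k0 ka sm.
have ca : continuous a by exact: (@smooth1_cont _ a 0).
have ma := cont_meas ca.
exists D => // r s x F G bF bG.
have bFs := vhat_cbm s mb bF; have bGs := vhat_cbm s mc bG.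
pose e z := cmul (cexpi (x * z)) (cexpi (r * a z)).
have be : cbm e by rewrite /e; bmt.
have bH : cbm (fun p : R * R => cmul (vhat b F s p.2) (cmul (e p.1)
   (cmul (vhat c G s (p.1 - p.2)) (m (p.2, p.1 - p.2))))) by bmt.
have bK : cbm (fun p : R * R => cmul (cmul (vhat c G s p.2) (cexpi (x * p.2)))
   (cmul (cmul (vhat b F s p.1) (cexpi (x * p.1)))
     (cmul (cexpi (r * a (1 * p.1 + p.2))) (m (p.1, 0 * p.1 + p.2))))) by bmt.
have -> : cint IT (fun z => cmul (cexpi (x * z))
      (cmul (cexpi (r * a z)) (Tm_hat b c m F G s z))) =
  cint W (fun y => cmul (cmul (vhat c G s y) (cexpi (x * y)))
    (cint IT (fun xi => cmul (cmul (vhat b F s xi) (cexpi (x * xi)))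
     (cmul (cexpi (r * a (1 * xi + y))) (m (xi, 0 * xi + y)))))).
  transitivity (cint IT (fun z => cint IT (fun xi => cmul (vhat b F s xi) (cmul (e z)
     (cmul (vhat c G s (z - xi)) (m (xi, z - xi))))))).
    apply: eq_cint => z _; rewrite cmulA -/(e z) (@TmE T); last by have := L0; lra.
    rewrite -cintZ//; last by bmt.
    by apply: eq_cint => xi _; rewrite [RHS]cmulCA !cmulA.
  rewrite (cint_fubini bH fT fT) /=.
  transitivity (cint IT (fun xi => cint W (fun y => cmul (cmul (vhat c G s y) (cexpi (x * y)))
   (cmul (cmul (vhat b F s xi) (cexpi (x * xi)))
     (cmul (cexpi (r * a (1 * xi + y))) (m (xi, 0 * xi + y))))))).
    apply: eq_cint => xi /in_sym hxi.
    rewrite (@cint_shift _ _ xi T (T + 1)).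
    - apply: eq_cint => y _; rewrite addrK mul0r add0r mul1r /e.
      rewrite mulrDr cexpiD (addrC y xi).
      by rewrite !cmulA [cmul (vhat b F s xi) _]cmulC !cmulA; cring.
    - exact: (cbm1 xi bH).
    - move=> z hz; rewrite symb0 ?cmulz0// => -[h1 h2].
      move: hz; rewrite ltNge; case/negP; rewrite (_ : z = xi + (z - xi)); last by ring.
      by rewrite (le_trans (ler_normD _ _))//; lra.
    - move=> z hz; rewrite addrK symb0 ?cmulz0// => -[h1 h2].
      by move: hz; rewrite ltNge; case/negP; have := L0; lra.
  rewrite (cint_fubini bK fT fW) /=; apply: eq_cint => y _.
  by rewrite cintZ//; bmt.
have bV : cbm (fun y => cint IT (fun xi => cmul (cmul (vhat b F s xi) (cexpi (x * xi)))
     (cmul (cexpi (r * a (1 * xi + y))) (m (xi, 0 * xi + y))))).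
  apply: (@cbm_cint2 _ (fun p : R * R => cmul (cmul (vhat b F s p.1) (cexpi (x * p.1)))
     (cmul (cexpi (r * a (1 * p.1 + p.2))) (m (p.1, 0 * p.1 + p.2))))) => //.
  by bmt.
apply: le_trans (cint_cauchy_schwarz fW _ bV) _; first by bmt.
have nG : n2 W (fun y => cmul (vhat c G s y) (cexpi (x * y))) = n2 W G.
  by rewrite -(n2_vhat W c G s); apply: eq_Rintegral => y _; rewrite cmulC cnorm_expiM.
have bP : cbm (fun xi => cmul (vhat b F s xi) (cexpi (x * xi))) by bmt.
have nF : n2 IT (fun xi => cmul (vhat b F s xi) (cexpi (x * xi))) <= n2 W F.
  apply: n2_le => //; first by apply: sub_sym; lra.
  by move=> y _; rewrite cmulC !cnorm_expiM.
rewrite nG [leRHS]mulrA mulrC ler_wpM2r ?n2_ge0//.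
apply: le_trans (bD r _ bP) _; rewrite ler_wpM2l// divr_ge0// addr_ge0//.
Qed.

End FixedTime.

Section FixedTime2.
Context (R : realType) (L : R) (b c : R -> R) (m : R * R -> R * R).
Local Notation mu := (@lebesgue_measure R).
Local Notation C := (R * R)%type.
Hypothesis L0 : 0 <= L.
Hypothesis mb : measurable_fun setT b.
Hypothesis mc : measurable_fun setT c.
Hypothesis sm : symb L m.
Local Notation T := (2 * L).
Local Notation IT := (`[- (2 * L), 2 * L]%classic).
Local Notation W := (`[- (2 * L + 1), 2 * L + 1]%classic).
Implicit Types F G : R -> C.

Let bm_ : cbm m. Proof. exact: symb_cbm sm. Qed.
Let fT : finm IT. Proof. exact: finm_itv. Qed.
Let fW : finm W. Proof. exact: finm_itv. Qed.

Lemma set_sym (X : R) : [set x | - X <= x <= X] = `[- X, X]%classic.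
Proof. by apply/seteqP; split => x /=; rewrite in_itv. Qed.

Lemma FtruncE (g : R -> C) X xi : Ftrunc g X xi =
  cmul ((2 * pi)^-1, 0) (cint `[- X, X] (fun x => cmul (cexpi (- (x * xi))) (g x))).
Proof. by rewrite /Ftrunc set_sym; cring. Qed.

Lemma cbm_Ftrunc (g : R -> C) X : cbm g -> cbm (Ftrunc g X).
Proof.
move=> bg; rewrite (_ : Ftrunc g X = fun xi => cmul ((2 * pi)^-1, 0)
    (cint `[- X, X] (fun x => cmul (cexpi (- (x * xi))) (g x)))); last first.
  by apply/funext => xi; rewrite FtruncE.
have bk : cbm (fun p : R * R => cmul (cexpi (- (p.1 * p.2))) (g p.1)) by bmt.
by apply: cbmM; [exact: cbm_cst|exact: (cbm_cint2 bk (finm_itv _ _))].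
Qed.

Lemma rI_sym_le (h : R -> R) (M X : R) : 0 <= X -> bm h ->
  (forall x, `[- X, X]%classic x -> h x <= M) ->
  \int[mu]_(x in `[- X, X]) h x <= M * (2 * X).
Proof.
move=> X0 bh hM; have fX := finm_itv (- X) X.
apply: (@le_trans _ _ (\int[mu]_(x in `[- X, X]) M)).
  by apply: rI_le => //; exact: bm_cst.
by rewrite (rI_cst fX) fine_mu_itv; lra.
Qed.

(** Once the transform of [g] is expanded over positions [|z| <= X], each [z] contributes an
    oscillatory operator in the pair (input, output frequency) with phase [s c(y - xi)], whose
    squared norm decays like [1 / |s|]. Cauchy-Schwarz in [z] costs the length [2 X] of the
    interval. *)
Lemma localized_bound (kap : R) :
  smooth1 c -> 0 < kap -> (forall x, kap <= `|derive1n 2 c x|) ->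
  exists2 D : R, 0 <= D & forall s X F g, 0 <= X -> cbm F -> cbm g ->
    n2 IT (Tm_hat b c m F (Ftrunc g X) s)
    <= D / (1 + `|s|) * X * (n2 W F * n2 `[- X, X] g).
Proof.
move=> sc k0 kc.
have n11 : `|- 1 : R| = 1 by rewrite normrN normr1.
have n11' : `|- 1 : R| <= 1 by rewrite n11.
have [D D0 bD] := hormander_symb L0 n11 n11' sc k0 kc sm.
set kp := (2 * pi)^-1 : R.
exists (2 * kp ^+ 2 * D); first by rewrite mulr_ge0// mulr_ge0// sqr_ge0.
move=> s X F g X0 bF bg.
have bFs := vhat_cbm s mb bF; have bG := cbm_Ftrunc X bg; have bGs := vhat_cbm s mc bG.
have fX := finm_itv (- X) X.
pose k z xi y := cmul (cmul (vhat b F s xi) (cexpi (z * xi)))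
  (cmul (cexpi (s * c (-1 * xi + y))) (m (xi, -1 * xi + y))).
pose V z y := cint IT (fun xi => k z xi y).
have bV : cbm (fun p : R * R => V p.1 p.2).
  apply: (@cbm_cint _ _ _ (fun q : (R * R) * R => k q.1.1 q.2 q.1.2)) => //.
  by rewrite /k; bmt.
have bVz z : cbm (V z) by exact: (cbm2 z bV).
have bVy y : cbm (V ^~ y) by exact: (cbm1 y bV).
pose gz y z := cmul (cmul (kp, 0) (cexpi (- (z * y)))) (g z).
have bgz y : cbm (gz y) by rewrite /gz; bmt.
have E y : Tm_hat b c m F (Ftrunc g X) s y = cint `[- X, X] (fun z => cmul (gz y z) (V z y)).
  rewrite (@TmE _ L b c m sm (2 * L)); last by have := L0; lra.
  have bH : cbm (fun p : R * R => cmul (gz y p.2) (k p.2 p.1 y)) by rewrite /gz /k; bmt.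
  transitivity (cint IT (fun xi => cint `[- X, X] (fun z => cmul (gz y z) (k z xi y)))).
    apply: eq_cint => xi _; rewrite {2}/vhat FtruncE -/kp.
    have b1 : cbm (fun x : R => cmul (cexpi (- (x * (y - xi)))) (g x)) by bmt.
    rewrite cmulAC -[in LHS]cintZ// -!cintZ//; try by bmt.
    apply: eq_cint => z _; rewrite /gz /k !mulN1r (addrC (- xi) y).
    have -> : cexpi (- (z * (y - xi))) = cmul (cexpi (- (z * y))) (cexpi (z * xi)).
      by rewrite -cexpiD; congr cexpi; ring.
    by cring.
  rewrite (cint_fubini bH fT fX) /=; apply: eq_cint => z _.
  rewrite /V cintZ//; rewrite /k; bmt.
pose q y := \int[mu]_(z in `[- X, X]) (cnorm (V z y) ^+ 2).
have bq2 : bm (fun p : R * R => cnorm (V p.2 p.1) ^+ 2).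
  by apply: cbm_norm2; exact: (cbm_swap bV).
have bq : bm q by exact: (bm_rI bq2 fX).
have ngz y : n2 `[- X, X] (gz y) = kp ^+ 2 * n2 `[- X, X] g.
  rewrite /n2 -rIZ//; last by bmt.
  apply: eq_Rintegral => z _; rewrite /gz !cnormM cnorm_expi mulr1 cnorm_real.
  by rewrite exprMn real_normK ?num_real.
have bT := cbm_Tm2 L0 mb mc sm s bF bG.
apply: (@le_trans _ _ (\int[mu]_(y in IT) (kp ^+ 2 * n2 `[- X, X] g * q y))).
  apply: rI_le => //; try by bmt.
  move=> y _; rewrite E; apply: le_trans (cint_cauchy_schwarz fX (bgz y) (bVy y)) _.
  rewrite ngz; exact: lexx.
rewrite rIZ// /q (rI_fubini bq2 fT fX) /=.
have s1 : 0 < 1 + `|s| by rewrite ltr_pwDl.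
have Vb z : n2 IT (V z) <= D / (1 + `|s|) * n2 W F.
  have bP : cbm (fun xi => cmul (vhat b F s xi) (cexpi (z * xi))) by bmt.
  apply: (@le_trans _ _ (n2 W (V z))).
    by apply: n2_le => //; apply: sub_sym; lra.
  apply: le_trans (bD s _ bP) _; rewrite ler_wpM2l ?divr_ge0 ?(ltW s1)//.
  apply: n2_le => //; first by apply: sub_sym; lra.
  by move=> y _; rewrite cmulC !cnorm_expiM.
have : \int[mu]_(z in `[- X, X]) n2 IT (V z) <= D / (1 + `|s|) * n2 W F * (2 * X).
  apply: rI_sym_le; [exact: X0| |by move=> z _; exact: Vb].
  have bV2 : bm (fun p : R * R => cnorm (V p.1 p.2) ^+ 2) by exact: cbm_norm2.
  exact: (bm_rI bV2 fT).
move=> h; rewrite [X in _ * X <= _](_ : _ = \int[mu]_(z in `[- X, X]) n2 IT (V z))//.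
have kg : 0 <= kp ^+ 2 * n2 `[- X, X] g by rewrite mulr_ge0 ?sqr_ge0// n2_ge0.
apply: le_trans (ler_wpM2l kg h) _; apply: le_of_eq; ring.
Qed.

Lemma rI_shift_le (h : R -> R) (x S S' : R) : bm h -> (forall y, 0 <= h y) ->
  S + `|x| <= S' ->
  \int[mu]_(y in `[- S, S]) h (x + y) <= \int[mu]_(y in `[- S', S']) h y.
Proof.
move=> bh h0 SS.
have -> : \int[mu]_(y in `[- S, S]) h (x + y) = \int[mu]_(y in `[x - S, x + S]) h y.
  rewrite -(rI_shift x bh (finm_itv _ _)).
  have -> : (fun y => y + x) @^-1` `[x - S, x + S]%classic = `[- S, S]%classic.
    by apply/seteqP; split => y /=; rewrite !in_itv/= => /andP[? ?]; apply/andP; split; lra.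
  by apply: eq_Rintegral => y _; rewrite addrC.
apply: rI_subset => //; [exact: finm_itv|exact: finm_itv|].
move=> y /=; rewrite !in_itv /= => /andP[h1 h2].
have := ler_norm x; have := ler_norm (- x); rewrite normrN => h3 h4.
by apply/andP; split; lra.
Qed.

(** These products make up the amplitude [m(x, y + sig) conj m(y, x + sig)] of the kernel treated
    below, with [q = (sig, x)]. *)
Lemma smf_product (f g : R * R -> R) : sm2 2 f -> sm2 2 g ->
  smf (hK T) 2 (fun q y => f (q.2, y + q.1) * g (y, q.2 + q.1)).
Proof.
move=> sf sg; apply: smfM.
  rewrite (_ : (fun _ _ => _) = (fun (q : R * R) y => f (q.2 + 0 * y, q.1 + 1 * y))); last first.
    by apply/funext => q; apply/funext => y; rewrite mul0r addr0 mul1r addrC.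
  apply: (@smf_sm2 _ _ _ _ _ _ _ _ _ (2 * T)) => // q y [hy hs hx].
  rewrite mul0r addr0 mul1r; split; first by have := L0; lra.
  by apply: le_trans (ler_normD _ _) _; have := L0; lra.
rewrite (_ : (fun _ _ => _) = (fun (q : R * R) y => g (0 + 1 * y, q.2 + q.1 + 0 * y))); last first.
  by apply/funext => q; apply/funext => y; rewrite add0r mul1r mul0r addr0.
apply: (@smf_sm2 _ _ _ _ _ _ _ _ _ (2 * T)) => // q y [hy hs hx].
rewrite mul0r addr0 mul1r add0r; split; first by have := L0; lra.
by apply: le_trans (ler_normD _ _) _; have := L0; lra.
Qed.

End FixedTime2.

Lemma half_sum_le (R : realType) (u v w : R) : u <= w -> v <= w -> (u + v) * 2^-1 <= w.
Proof. lra. Qed.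

Section Strichartz.
Context (R : realType) (L : R) (b c : R -> R) (m : R * R -> R * R).
Local Notation mu := (@lebesgue_measure R).
Local Notation C := (R * R)%type.
Hypothesis L0 : 0 <= L.
Hypothesis mb : measurable_fun setT b.
Hypothesis mc : measurable_fun setT c.
Hypothesis sm : symb L m.
Local Notation T := (2 * L).
Local Notation IT := (`[- (2 * L), 2 * L]%classic).
Local Notation W := (`[- (2 * L + 1), 2 * L + 1]%classic).
Local Notation W2 := (`[- (2 * (2 * L + 1)), 2 * (2 * L + 1)]%classic).
Implicit Types F G : R -> C.

Let bm_ : cbm m. Proof. exact: symb_cbm sm. Qed.
Let fT : finm IT. Proof. exact: finm_itv. Qed.
Let fW : finm W. Proof. exact: finm_itv. Qed.

(** The substitution of [z - xi] for [xi]. It lets every estimate that rests on the curvature of [c]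
    serve for [b] as well. *)
Lemma Tm_swap F G s z : cbm F -> cbm G ->
  Tm_hat b c m F G s z = Tm_hat c b (fun p => m (p.2, p.1)) G F s z.
Proof.
move=> bF bG; have S0 : 0 <= L + `|z| by rewrite addr_ge0.
have LS : L <= L + `|z| by rewrite lerDl.
have bFs := vhat_cbm s mb bF; have bGs := vhat_cbm s mc bG.
rewrite (TmE b c sm F G s z LS) (TmE c b (symb_swap sm) G F s z LS).
pose h xi := cmul (cmul (vhat b F s xi) (vhat c G s (z - xi))) (m (xi, z - xi)).
have bh : cbm h by rewrite /h; bmt.
have hz xi : L < `|xi| -> h xi = 0.
  by move=> lx; rewrite /h (symb0 sm) ?cmulz0// => -[h1 _]; move: lx; rewrite ltNge h1.
rewrite -/h (cint_oppr _ bh).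
have bh' : cbm (fun x : R => h (- x)) by bmt.
rewrite (@cint_shift _ _ (- z) _ (L + `|z|) bh').
- apply: eq_cint => xi _; rewrite /h /= (_ : - (xi - z) = z - xi); last by ring.
  by rewrite (_ : z - (z - xi) = xi) ?[cmul (vhat b F s _) _]cmulC//; ring.
- by move=> x hx; apply: hz; rewrite normrN (le_lt_trans LS).
move=> x hx; rewrite /h (symb0 sm) ?cmulz0// => -[h1 h2].
move: h2 hx; rewrite (_ : z - - (x - z) = x); last by ring.
by move=> h2; rewrite ltNge (le_trans h2).
Qed.

Lemma cint_triple (K : (R * R) * R -> C) (D1 D2 D3 : set R) : finm D1 -> finm D2 -> finm D3 ->
  cbm K ->
  cint D1 (fun x => cint D2 (fun y => cint D3 (fun z => K (x, y, z)))) =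
  cint D2 (fun y => cint D3 (fun z => cint D1 (fun x => K (x, y, z)))).
Proof.
move=> f1 f2 f3 bK.
have b1 : cbm (fun p : R * R => cint D3 (fun z => K (p.1, p.2, z))).
  by apply: (@cbm_cint _ _ _ (fun q : (R * R) * R => K (q.1.1, q.1.2, q.2))) => //; bmt.
rewrite (cint_fubini b1 f1 f2) /=; apply: eq_cint => y _.
have b2 : cbm (fun p : R * R => K (p.1, y, p.2)) by bmt.
exact: (cint_fubini b2 f1 f3).
Qed.

(* The change of variables [z = sig + xi + xi'] makes, for each fixed [sig], the phase
   [r a(z)] depend on [xi + xi'] alone, which is the form handled by [hormander]. *)
Lemma strichartz_kernel (a : R -> R) (kap : R) :
  smooth1 a -> 0 < kap -> (forall x, kap <= `|derive1n 2 a x|) ->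
  exists2 D : R, 0 <= D & forall r s s' F G, cbm F -> cbm G ->
    cnorm (cint IT (fun z => cmul (cexpi (r * a z))
      (cmul (Tm_hat b c m F G s z) (cconj (Tm_hat b c m F G s' z)))))
    <= D * (Num.sqrt (1 + `|r|))^-1 * (n2 W2 F * n2 W2 G).
Proof.
move=> sa k0 ka.
have ca : continuous a by exact: (@smooth1_cont _ a 0).
have ma := cont_meas ca.
have T0 : 0 <= T by rewrite mulr_ge0.
pose N (q : R * R) y := cmul (m (q.2, y + q.1)) (cconj (m (y, q.2 + q.1))).
pose M1 q y := (N q y).1; pose M2 q y := (N q y).2.
have [D D0 bD] : exists2 D : R, 0 <= D & forall sig lam Phi, cbm Phi ->
  n2 W (fun y => cint IT (fun x => cmul (Phi x) (hker 1 a M1 M2 sig lam (x, y)))) <=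
    D / (1 + `|lam|) * n2 IT Phi.
  have [s1 s2 _] := sm.
  have sM1 : smf (hK T) 2 M1.
    rewrite (_ : M1 = fun q y => (m (q.2, y + q.1)).1 * (m (y, q.2 + q.1)).1 +
        (m (q.2, y + q.1)).2 * (m (y, q.2 + q.1)).2).
      exact: (smfD (smf_product L0 (s1 2) (s1 2)) (smf_product L0 (s2 2) (s2 2))).
    by apply/funext => q; apply/funext => y; rewrite /M1 /N /cmul /=; ring.
  have sM2 : smf (hK T) 2 M2.
    rewrite (_ : M2 = fun q y => (m (q.2, y + q.1)).2 * (m (y, q.2 + q.1)).1 -
        (m (q.2, y + q.1)).1 * (m (y, q.2 + q.1)).2).
      exact: (smfB (smf_product L0 (s2 2) (s1 2)) (smf_product L0 (s1 2) (s2 2))).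
    by apply/funext => q; apply/funext => y; rewrite /M2 /N /cmul /=; ring.
  (* A nonzero product forces [|y| <= L] and [|y + sig| <= L], hence [|sig| <= 2 L]: the amplitude
     has bounded support in [sig] too. *)
  have zN q y : ~ hK T q y -> N q y = 0.
    move=> nK; rewrite /N.
    have [[h1 h2]|h] := pselect (`|q.2| <= L /\ `|y + q.1| <= L); last by rewrite (symb0 sm h) cmul0.
    have [[h3 h4]|h] := pselect (`|y| <= L /\ `|q.2 + q.1| <= L).
      exfalso; apply: nK; split; [lra| |lra].
      rewrite (_ : q.1 = (y + q.1) - y); last by ring.
      by apply: le_trans (ler_normB _ _) _; lra.
    by rewrite (symb0 sm h) /cconj /= oppr0 cmulz0.
  apply: (hormander T0 (normr1 _) sa k0 ka sM1 sM2).
  - by move=> q y /zN h; rewrite /M1 h.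
  - by move=> q y /zN h; rewrite /M2 h.
  - move=> sig; have -> : (fun p : R * R => (M1 (sig, p.1) p.2, M2 (sig, p.1) p.2)) =
        fun p : R * R => cmul (m (p.1, p.2 + sig)) (cconj (m (p.2, p.1 + sig))).
      by apply/funext => p; rewrite /M1 /M2 -surjective_pairing.
    by bmt.
exists (Num.sqrt D); first exact: sqrtr_ge0.
move=> r s s' F G bF bG.
have bFs := vhat_cbm s mb bF; have bGs := vhat_cbm s mc bG.
have bFt := vhat_cbm s' mb bF; have bGt := vhat_cbm s' mc bG.
pose P s z x := cmul (cmul (vhat b F s x) (vhat c G s (z - x))) (m (x, z - x)).
pose K (q : (R * R) * R) := cmul (cexpi (r * a q.1.1))
   (cmul (P s q.1.1 q.1.2) (cconj (P s' q.1.1 q.2))).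
have bK : cbm K by rewrite /K /P; bmt.
(* With [z = sig + x + y] one has [z - x = y + sig] and [z - y = x + sig]. For fixed [sig] the four
   data thus split into a function [Phi] of [x] and a function [Psi] of [y], joined by the
   oscillatory kernel. *)
pose Phi sig x := cmul (vhat b F s x) (cconj (vhat c G s' (x + sig))).
pose Psi sig y := cmul (cconj (vhat b F s' y)) (vhat c G s (y + sig)).
have bPhi sig : cbm (Phi sig) by rewrite /Phi; bmt.
have bPsi sig : cbm (Psi sig) by rewrite /Psi; bmt.
pose V sig y := cint IT (fun x => cmul (Phi sig x) (hker 1 a M1 M2 sig r (x, y))).
have hkE sig x y : hker 1 a M1 M2 sig r (x, y) =
    cmul (cexpi (r * a (1 * x + y + sig))) (cmul (m (x, y + sig)) (cconj (m (y, x + sig)))).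
  by rewrite /hker /M1 /M2 -surjective_pairing.
have bV sig : cbm (V sig).
  rewrite (_ : V sig = fun y => cint IT (fun x => cmul (Phi sig x)
      (cmul (cexpi (r * a (1 * x + y + sig))) (cmul (m (x, y + sig)) (cconj (m (y, x + sig))))))).
    apply: (@cbm_cint2 _ (fun p : R * R => cmul (Phi sig p.1)
      (cmul (cexpi (r * a (1 * p.1 + p.2 + sig))) (cmul (m (p.1, p.2 + sig)) (cconj (m (p.2, p.1 + sig)))))) IT _ fT).
    have bP := bPhi sig; by bmt.
  by apply/funext => y; apply: eq_cint => x _; rewrite hkE.
have E : cint IT (fun z => cmul (cexpi (r * a z))
      (cmul (Tm_hat b c m F G s z) (cconj (Tm_hat b c m F G s' z)))) =
   cint IT (fun sig => cint W (fun y => cmul (Psi sig y) (V sig y))).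
  transitivity (cint IT (fun z => cint IT (fun x => cint W (fun y => K (z, x, y))))).
    apply: eq_cint => z _; rewrite (@TmE _ L b c m sm (2 * L)); last by have := L0; lra.
    rewrite (@TmE _ L b c m sm (2 * L + 1)); last by have := L0; lra.
    rewrite -/(P s z) -/(P s' z).
    have b1 : cbm (P s z) by rewrite /P; bmt.
    have b2 : cbm (P s' z) by rewrite /P; bmt.
    rewrite -cint_conj// -cintZr// -cintZ//; last first.
      have b3 : cbm (fun _ : R => cint W (fun x => cconj (P s' z x))) by exact: cbm_cst.
      exact: (cbmM b1 b3).
    apply: eq_cint => x _; rewrite cmulA -cintZ//; last by bmt.
    by apply: eq_cint => y _; rewrite /K /= cmulA.
  rewrite (cint_triple fT fT fW bK) /=.
  pose K' (q : (R * R) * R) := K (q.1.1 + (q.1.2 + q.2), q.1.2, q.2).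
  have bK' : cbm K' by rewrite /K'; bmt.
  transitivity (cint IT (fun x => cint W (fun y => cint IT (fun sig => K' (sig, x, y))))).
    apply: eq_cint => x _; apply: eq_cint => y _.
    apply: (@cint_shift _ (fun z => K (z, x, y)) (x + y)).
    - by bmt.
    - move=> z hz; rewrite /K /P /= (symb0 sm) ?cmulz0 ?cmul0 ?cmulz0// => -[h1 h2].
      move: hz; rewrite ltNge; case/negP; rewrite (_ : z = x + (z - x)); last by ring.
      by apply: le_trans (ler_normD _ _) _; lra.
    - move=> z hz; rewrite /K /P /=.
      have [[h1 h2]|h] := pselect (`|x| <= L /\ `|z + (x + y) - x| <= L); last first.
        by rewrite (symb0 sm h) cmulz0 cmul0 cmulz0.
      have [[h3 h4]|h] := pselect (`|y| <= L /\ `|z + (x + y) - y| <= L); last first.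
        by rewrite (symb0 sm h) cmulz0 /cconj /= oppr0 !cmulz0.
      exfalso; move: hz; rewrite ltNge; case/negP.
      rewrite (_ : z = (z + (x + y) - x) - y); last by ring.
      by apply: le_trans (ler_normB _ _) _; lra.
  rewrite -(cint_triple fT fT fW bK') /=.
  apply: eq_cint => sig _.
  pose H (p : R * R) := cmul (Psi sig p.2) (cmul (Phi sig p.1)
      (cmul (cexpi (r * a (1 * p.1 + p.2 + sig))) (cmul (m (p.1, p.2 + sig)) (cconj (m (p.2, p.1 + sig)))))).
  have bH : cbm H.
    by rewrite /H; have b1 := bPsi sig; have b2 := bPhi sig; bmt.
  transitivity (cint IT (fun x => cint W (fun y => H (x, y)))).
    apply: eq_cint => x _; apply: eq_cint => y _; rewrite /K' /K /P /H /Psi /Phi /=.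
    rewrite (_ : sig + (x + y) - x = y + sig); last by ring.
    rewrite (_ : sig + (x + y) - y = x + sig); last by ring.
    rewrite (_ : 1 * x + y + sig = sig + (x + y)); last by ring.
    by rewrite !cconjM; cring.
  rewrite (cint_fubini bH fT fW); apply: eq_cint => y _.
  by rewrite /H /= cintZ//; have b2 := bPhi sig; bmt.
have r1 : 0 < 1 + `|r| by rewrite ltr_pwDl.
pose A sig := n2 IT (Phi sig); pose B sig := n2 W (Psi sig).
pose k := Num.sqrt (D / (1 + `|r|)).
have k00 : 0 <= k by exact: sqrtr_ge0.
have kE : k = Num.sqrt D * (Num.sqrt (1 + `|r|))^-1.
  by rewrite /k sqrtrM// sqrtrV// ltW.
(* Cauchy-Schwarz in [y], the operator bound applied to [Phi], and the inequality between geometric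
   and arithmetic means. *)
have pt sig : cnorm (cint W (fun y => cmul (Psi sig y) (V sig y))) <= k * ((A sig + B sig) / 2).
  have A0 : 0 <= A sig by exact: n2_ge0.
  have B0 : 0 <= B sig by exact: n2_ge0.
  rewrite -(@ler_pXn2r _ 2) ?nnegrE//; last by rewrite mulr_ge0// divr_ge0// addr_ge0.
  apply: le_trans (cint_cauchy_schwarz fW (bPsi sig) (bV sig)) _.
  apply: le_trans (ler_wpM2l B0 (bD sig r _ (bPhi sig))) _.
  rewrite exprMn /k sqr_sqrtr; last by rewrite divr_ge0// ltW.
  rewrite mulrCA ler_wpM2l ?divr_ge0 ?(ltW r1)// -/(A sig).
  by have := sqr_ge0 (A sig - B sig); nra.
have bA : bm A.
  apply: (@bm_rI _ _ _ (fun q : R * R => cnorm (Phi q.1 q.2) ^+ 2)) => //.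
  by rewrite /Phi; bmt.
have bB : bm B.
  apply: (@bm_rI _ _ _ (fun q : R * R => cnorm (Psi q.1 q.2) ^+ 2)) => //.
  by rewrite /Psi; bmt.
(* Integrating in [sig] first separates the product. For [x] in [W] the points [x + sig] stay in
   [W2], which is the reason for the doubled window. *)
have nFG (D' : set R) (F1 G1 : R -> C) : finm D' -> D' `<=` W -> cbm F1 -> cbm G1 ->
    n2 W2 F1 = n2 W2 F -> n2 W2 G1 = n2 W2 G ->
    \int[mu]_(sig in IT) \int[mu]_(x in D') (cnorm (F1 x) ^+ 2 * cnorm (G1 (x + sig)) ^+ 2)
      <= n2 W2 F * n2 W2 G.
  move=> fD' DW bF1 bG1 eF eG.
  have bk : bm (fun p : R * R => cnorm (F1 p.2) ^+ 2 * cnorm (G1 (p.2 + p.1)) ^+ 2) by bmt.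
  rewrite (rI_fubini bk fT fD') /=.
  apply: (@le_trans _ _ (\int[mu]_(x in D') (cnorm (F1 x) ^+ 2 * n2 W2 G))).
    apply: rI_le => //; try by bmt.
      exact: (bm_rI (bm_swap bk) fT).
    move=> x /DW /in_sym hx; rewrite rIZ//; last by bmt.
    rewrite ler_wpM2l ?sqr_ge0// -eG.
    apply: (@rI_shift_le _ (fun y => cnorm (G1 y) ^+ 2)); first by bmt.
      by move=> y; exact: sqr_ge0.
    by have := L0; lra.
  rewrite rIZr//; last by bmt.
  rewrite ler_wpM2r ?n2_ge0// -eF; apply: rI_subset => //.
  - exact: finm_itv.
  - by apply: subset_trans DW _; apply: sub_sym; have := L0; lra.
  - by bmt.
  - by move=> x; exact: sqr_ge0.
have IA : \int[mu]_(sig in IT) A sig <= n2 W2 F * n2 W2 G.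
  rewrite -[leLHS](_ : \int[mu]_(sig in IT) \int[mu]_(x in IT)
      (cnorm (vhat b F s x) ^+ 2 * cnorm (vhat c G s' (x + sig)) ^+ 2) = _); last first.
    apply: eq_Rintegral => sig _; apply: eq_Rintegral => x _.
    by rewrite /Phi cnormM cnorm_conj exprMn.
  apply: nFG; rewrite ?n2_vhat//; first by apply: sub_sym; lra.
have IB : \int[mu]_(sig in IT) B sig <= n2 W2 F * n2 W2 G.
  rewrite -[leLHS](_ : \int[mu]_(sig in IT) \int[mu]_(x in W)
      (cnorm (vhat b F s' x) ^+ 2 * cnorm (vhat c G s (x + sig)) ^+ 2) = _); last first.
    apply: eq_Rintegral => sig _; apply: eq_Rintegral => x _.
    by rewrite /Psi cnormM cnorm_conj exprMn.
  by apply: nFG; rewrite ?n2_vhat.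
have bVP : cbm (fun sig => cint W (fun y => cmul (Psi sig y) (V sig y))).
  have b1 : cbm (fun p : R * R => V p.1 p.2).
    rewrite (_ : (fun _ => _) = fun p : R * R => cint IT (fun x => cmul (cmul (vhat b F s x) (cconj (vhat c G s' (x + p.1))))
      (cmul (cexpi (r * a (1 * x + p.2 + p.1))) (cmul (m (x, p.2 + p.1)) (cconj (m (p.2, x + p.1))))))); last first.
      by apply/funext => p; apply: eq_cint => x _; rewrite hkE.
    apply: (@cbm_cint _ _ _ (fun q : (R * R) * R => cmul (cmul (vhat b F s q.2) (cconj (vhat c G s' (q.2 + q.1.1))))
      (cmul (cexpi (r * a (1 * q.2 + q.1.2 + q.1.1))) (cmul (m (q.2, q.1.2 + q.1.1)) (cconj (m (q.1.2, q.2 + q.1.1))))))) => //.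
    by bmt.
  have b2 : cbm (fun p : R * R => Psi p.1 p.2) by rewrite /Psi; bmt.
  exact: (cbm_cint1 (cbmM b2 b1) fW).
rewrite E; apply: le_trans (cint_norm fT bVP) _.
apply: (@le_trans _ _ (\int[mu]_(sig in IT) (k * ((A sig + B sig) / 2)))).
  apply: rI_le; [exact: fT| | |by move=> sig _; exact: pt]; first by bmt.
  by bmt.
rewrite rIZ//; last by bmt.
rewrite rIZr//; last by bmt.
rewrite rID; [|exact: fT|exact: bA|exact: bB].
rewrite -kE; apply: (ler_wpM2l k00).
exact: half_sum_le IA IB.
Qed.

End Strichartz.

Lemma cmul_regroup (R : realType) (e f k z w v : R * R) :
  cmul (cmul (cmul e (cmul k z)) (cmul f (cmul k w))) v =
  cmul z (cmul w (cmul (cmul k k) (cmul (cmul e f) v))).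
Proof. by cring. Qed.

(** * Decay in time in the absence of space resonances *)

Section Separation.
Context (R : realType) (L kap1 : R) (b c : R -> R) (m : R * R -> R * R).
Local Notation mu := (@lebesgue_measure R).
Local Notation C := (R * R)%type.
Local Notation J := (`[- (L + 1), L + 1]%classic).
Hypothesis L0 : 0 <= L.
Hypothesis sb : smooth1 b.
Hypothesis sc : smooth1 c.
Hypothesis sm : symb L m.
Hypothesis k10 : 0 < kap1.
Hypothesis sub : forall p, supp m p -> `|p.1| <= L /\ `|p.2| <= L.
Hypothesis sep : forall p, supp m p ->
  kap1 <= `|derive1n 1 b p.1 - derive1n 1 c p.2|.

Lemma smf_affine (P : Type) (K : P -> set R) (al : R -> R) (x0 : P -> R) (e B : R) n j :
  smooth1 al -> (forall p y, K p y -> `|x0 p + e * y| <= B) ->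
  smf K n (fun p y => derive1n j al (x0 p + e * y)).
Proof.
move=> sal KB.
have dd k p y : der (fun y => derive1n k al (x0 p + e * y)) y
    (derive1n k.+1 al (x0 p + e * y) * e).
  have d1 : der (fun y => x0 p + e * y) y e.
    by apply: der_eq (derD (der_cst _ y) (der_lin0 e y)) _; rewrite add0r.
  exact: der_comp (smooth1_der k _ sal) d1.
have bd k : exists C : R, forall p y, K p y -> `|derive1n k al (x0 p + e * y)| <= C.
  have [D _ bD] := continuous_bounded_itv B (@smooth1_cont _ _ k sal).
  by exists D => p y /KB; exact: bD.
elim: n j => [|n ih] j.
  by split; [move=> p; exact: der_continuous (dd j p)|exact: bd|].
split; [by move=> p; exact: der_continuous (dd j p)|exact: bd|].
eexists; first by move=> p y; exact: dd.
by apply: smfM; [exact: ih|exact: smf_cst].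
Qed.

(** The parameter is [(z, r)]: the output frequency, and the slope [r = (y - x) / s] that the
    positions [y], [x] of the data add to the phase. For [|r| <= kap1 / 2] half of the separation
    survives. *)
Let K (p : R * R) : set R := [set xi | supp m (xi, p.1 - xi) /\ `|p.2| <= kap1 / 2].

Let K_closed p : closed (K p).
Proof.
apply: closed_and.
apply: (@preimage_closed _ _ (fun xi : R => (xi, p.1 - xi)) (supp m)) => [x _|].
  apply: (@cont_pair _ (fun y => y) (fun y => p.1 - y)) => y; first exact: cvg_id.
  by apply: cvgB; [exact: cvg_cst|exact: cvg_id].
exact: closed_closure.
Qed.

Let KL p xi : K p xi -> `|xi| <= L. Proof. by move=> [/sub[]]. Qed.

Lemma supp0 p : ~ supp m p -> m p = 0.
Proof.
move=> np; have [//|h] := eqVneq (m p) 0.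
exfalso; apply: np; apply: subset_closure; exact: h.
Qed.

(** The derivative of the phase in [xi] is [b'(xi) - c'(z - xi) - r], at least [kap1 / 2] in
    absolute value on the support, so it can be divided by any number of times. *)
Lemma separated_kernel n : exists2 D : R, 0 <= D & forall s z r, s != 0 -> `|r| <= kap1 / 2 ->
  cnorm (cint J (fun xi => cmul (cexpi (s * (b xi + c (z - xi) - r * xi))) (m (xi, z - xi))))
    <= D / `|s| ^+ n.
Proof.
pose h (p : R * R) xi := derive1n 1 b (0 + 1 * xi) - derive1n 1 c (p.1 + -1 * xi) - p.2.
pose psi (p : R * R) xi := b xi + c (p.1 - xi) - p.2 * xi.
pose ind (p : R * R) : R := ((`|p.2| : R) <= kap1 / 2)%R%:R.
pose A1 (p : R * R) (xi : R) := ind p * (m (0 + 1 * xi, p.1 + -1 * xi)).1.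
pose A2 (p : R * R) (xi : R) := ind p * (m (0 + 1 * xi, p.1 + -1 * xi)).2.
have hE p xi : h p xi = derive1n 1 b xi - derive1n 1 c (p.1 - xi) - p.2.
  by rewrite /h add0r mul1r mulN1r.
have mE p xi : m (0 + 1 * xi, p.1 + -1 * xi) = m (xi, p.1 - xi).
  by rewrite add0r mul1r mulN1r.
have KB p xi : K p xi -> `|0 + 1 * xi| <= L /\ `|p.1 + -1 * xi| <= L.
  by move=> [/sub[]]; rewrite add0r mul1r mulN1r.
have sind k : smf K k (fun p _ => ind p).
  by apply: (@smf_param _ _ _ _ _ 1) => p x _; rewrite /ind; case: (`|p.2| <= kap1 / 2); rewrite ?normr0 ?normr1.
have [s1 s2 _] := sm.
have sA1 : smf K n A1 by apply: smfM => //; apply: (smf_sm2 (s1 n) KB).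
have sA2 : smf K n A2 by apply: smfM => //; apply: (smf_sm2 (s2 n) KB).
have zz p xi : ~ K p xi -> ind p = 0 \/ m (xi, p.1 - xi) = 0.
  move=> nK; rewrite /ind; case: (boolP (_ <= _)) => hr; last by left.
  by right; apply: supp0 => hs; apply: nK.
have z1 : supK K A1 by move=> p xi /zz[e|e]; rewrite /A1 mE e ?mul0r ?mulr0.
have z2 : supK K A2 by move=> p xi /zz[e|e]; rewrite /A2 mE e ?mul0r ?mulr0.
have sh : smf K n h.
  apply: smfB; first apply: smfB.
  - by apply: (@smf_affine _ _ _ (fun _ => 0) 1 L) => // p y /KB[].
  - by apply: (@smf_affine _ _ _ (fun p => p.1) (-1) L) => // p y /KB[].
  - by apply: (@smf_param _ _ _ _ _ (kap1 / 2)) => p x [].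
have hk p xi : K p xi -> kap1 / 2 <= `|h p xi|.
  move=> [/sep /= h1 h2]; rewrite hE.
  have := lerB_dist (derive1n 1 b xi - derive1n 1 c (p.1 - xi)) p.2; lra.
have dpsi p xi : der (psi p) xi (h p xi).
  rewrite hE /psi.
  have d1 : der (fun y => p.1 - y) xi (-1).
    by apply: der_eq (derB (der_cst p.1 xi) (der_id xi)) _; rewrite sub0r.
  have d2 := der_comp (smooth1_der 0 _ sc) d1.
  apply: der_eq (derB (derD (smooth1_der 0 xi sb) d2) (der_lin0 p.2 xi)) _.
  by rewrite mulrN1.
have [D D0 bD] := nonstationary_cplx L0 K_closed KL (divr_gt0 k10 (ltr0n _ 2)) z1 z2 sA1 sA2 sh hk dpsi.
exists D; first exact: D0.
move=> s z r s0 hr; have := bD (z, r) s s0.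
rewrite (_ : cint J (fun xi => cmul _ (A1 _ _, A2 _ _)) =
  cint J (fun xi => cmul (cexpi (s * (b xi + c (z - xi) - r * xi))) (m (xi, z - xi))))//.
apply: eq_cint => xi _; rewrite /A1 /A2 mE /ind /= hr !mul1r.
by rewrite -surjective_pairing.
Qed.

Lemma norm1_le (f : R -> C) (X : R) : 0 <= X -> cbm f ->
  (\int[mu]_(x in `[- X, X]) cnorm (f x)) ^+ 2 <= 2 * X * n2 `[- X, X] f.
Proof.
move=> X0 bf; have fX := finm_itv (- X) X.
have := rI_cauchy_schwarz fX (bm_cst _ 1) (cbm_norm bf).
under eq_Rintegral do rewrite mul1r.
move=> h; apply: le_trans h _; rewrite ler_wpM2r ?n2_ge0//.
under eq_Rintegral do rewrite expr1n.
by rewrite (rI_cst fX) fine_mu_itv; lra.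
Qed.

(** With both transforms expanded over positions, the [xi] integral is the kernel just bounded, with
    [r = (y - x) / s]. The condition on [X1 + X2] says that the data have not had to travel far
    enough to compensate the difference of group velocities. Passing from L^1 to L^2 norms of the
    data costs [4 X1 X2] in the square. *)
Lemma separated_bound n : exists2 D : R, 0 <= D & forall s z X1 X2 f g,
  0 <= X1 -> 0 <= X2 -> 0 < s -> X1 + X2 <= kap1 / 2 * s -> cbm f -> cbm g ->
  cnorm (Tm_hat b c m (Ftrunc f X1) (Ftrunc g X2) s z) ^+ 2 <=
    D / s ^+ (2 * n) * (X1 * X2) * (n2 `[- X1, X1] f * n2 `[- X2, X2] g).
Proof.
have [D D0 bD] := separated_kernel n.
set kp := (2 * pi)^-1 : R.
exists (4 * (kp ^+ 2 * D) ^+ 2); first by rewrite mulr_ge0// sqr_ge0.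
move=> s z X1 X2 f g X10 X20 s0 Xs bf bg.
have f1 := finm_itv (- X1) X1; have f2 := finm_itv (- X2) X2.
have fJ := finm_itv (- (L + 1)) (L + 1).
have mb := cont_meas (@smooth1_cont _ _ 0 sb); have mc := cont_meas (@smooth1_cont _ _ 0 sc).
rewrite /= in mb mc.
have bm_ := symb_cbm sm.
pose V y x xi := cmul (cexpi (s * (b xi + c (z - xi)) - (y - x) * xi)) (m (xi, z - xi)).
pose g' x := cmul (g x) (cexpi (- (x * z))).
have bg' : cbm g' by rewrite /g'; bmt.
pose U (q : (R * R) * R) := cmul (cmul (kp ^+ 2, 0) (cmul (f q.1.2) (g' q.2))) (V q.1.2 q.2 q.1.1).
have bU : cbm U by rewrite /U /V; bmt.
pose Q y x := cint J (fun xi => V y x xi).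
have bQ : cbm (fun p : R * R => Q p.1 p.2).
  apply: (@cbm_cint _ _ _ (fun q : (R * R) * R => V q.1.1 q.1.2 q.2)) => //.
  by rewrite /V; bmt.
have E : Tm_hat b c m (Ftrunc f X1) (Ftrunc g X2) s z =
    cint `[- X1, X1] (fun y => cint `[- X2, X2] (fun x =>
      cmul (cmul (kp ^+ 2, 0) (cmul (f y) (g' x))) (Q y x))).
  rewrite (@TmE _ L b c m sm (L + 1)); last by rewrite lerDl.
  transitivity (cint J (fun xi => cint `[- X1, X1] (fun y => cint `[- X2, X2] (fun x => U (xi, y, x))))).
    apply: eq_cint => xi _; rewrite /vhat !FtruncE -/kp.
    have b1 : cbm (fun y : R => cmul (cexpi (- (y * xi))) (f y)) by bmt.
    have b2 : cbm (fun x : R => cmul (cexpi (- (x * (z - xi)))) (g x)) by bmt.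
    pose I1 := cint `[- X1, X1] (fun y => cmul (cexpi (- (y * xi))) (f y)).
    pose I2 := cint `[- X2, X2] (fun x => cmul (cexpi (- (x * (z - xi)))) (g x)).
    rewrite -/I1 -/I2.
    transitivity (cmul I1 (cmul I2 (cmul (kp ^+ 2, 0)
       (cmul (cexpi (s * (b xi + c (z - xi)))) (m (xi, z - xi)))))).
      rewrite mulrDr cexpiD (_ : (kp ^+ 2, 0) = cmul (kp, 0) (kp, 0)); last first.
        by rewrite /cmul /= !mulr0 mul0r subr0 addr0.
      exact: cmul_regroup.
    rewrite -cintZr//; apply: eq_cint => y _.
    rewrite -cintZr// -cintZ//; last by bmt.
    apply: eq_cint => x _; rewrite /U /V /g' /=.
    rewrite (_ : s * (b xi + c (z - xi)) - (y - x) * xi =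
      s * (b xi + c (z - xi)) + (- (y * xi) + x * xi)); last by ring.
    rewrite (_ : - (x * (z - xi)) = - (x * z) + x * xi); last by ring.
    by rewrite !cexpiD; cring.
  rewrite (cint_triple fJ f1 f2 bU) /=; apply: eq_cint => y _; apply: eq_cint => x _.
  by rewrite /U /= cintZ// /V; bmt.
have Qb y x : `[- X1, X1]%classic y -> `[- X2, X2]%classic x -> cnorm (Q y x) <= D / s ^+ n.
  move=> /in_sym hy /in_sym hx.
  have hr : `|(y - x) / s| <= kap1 / 2.
    rewrite normrM normfV (gtr0_norm s0) ler_pdivrMr//.
    by rewrite (le_trans (ler_normB _ _))// (le_trans _ Xs)// lerD.
  have := bD s z _ (lt0r_neq0 s0) hr; rewrite (gtr0_norm s0) /Q /V.
  rewrite (_ : (fun xi => cmul (cexpi (s * (b xi + c (z - xi) - _))) _) =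
     fun xi => cmul (cexpi (s * (b xi + c (z - xi)) - (y - x) * xi)) (m (xi, z - xi)))//.
  apply/funext => xi; congr (cmul (cexpi _) _).
  by field; rewrite gt_eqF.
have kp0 : 0 <= kp by rewrite invr_ge0 mulr_ge0// pi_ge0.
have Ds : 0 <= D / s ^+ n by rewrite divr_ge0// exprn_ge0// ltW.
set If := \int[mu]_(y in `[- X1, X1]) cnorm (f y).
set Ig := \int[mu]_(y in `[- X2, X2]) cnorm (g y).
have If0 : 0 <= If by apply: Rintegral_ge0.
have Ig0 : 0 <= Ig by apply: Rintegral_ge0.
have bUQ : cbm (fun p : R * R => cmul (cmul (kp ^+ 2, 0) (cmul (f p.1) (g' p.2))) (Q p.1 p.2)) by bmt.
have main : cnorm (Tm_hat b c m (Ftrunc f X1) (Ftrunc g X2) s z) <=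
    (kp ^+ 2 * (D / s ^+ n)) * (If * Ig).
  rewrite E; apply: le_trans (cint_norm f1 (cbm_cint1 bUQ f2)) _.
  apply: (@le_trans _ _ (\int[mu]_(y in `[- X1, X1]) (kp ^+ 2 * (D / s ^+ n) * Ig * cnorm (f y)))).
    apply: rI_le; [exact: f1| |by bmt|].
      exact: (cbm_norm (cbm_cint1 bUQ f2)).
    move=> y hy; apply: le_trans (cint_norm f2 (cbm2 y bUQ)) _.
    apply: (@le_trans _ _ (\int[mu]_(x in `[- X2, X2]) (kp ^+ 2 * (D / s ^+ n) * cnorm (f y) * cnorm (g x)))).
      apply: rI_le; [exact: f2|exact: (cbm_norm (cbm2 y bUQ))|by bmt|].
      move=> x hx; rewrite -[leLHS]/(cnorm (cmul (cmul (kp ^+ 2, 0) (cmul (f y) (g' x))) (Q y x))).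
      rewrite !cnormM cnorm_real cnorm_expi mulr1.
      rewrite ger0_norm ?exprn_ge0//.
      rewrite [leRHS](_ : _ = kp ^+ 2 * (cnorm (f y) * cnorm (g x)) * (D / s ^+ n)); last by ring.
      by rewrite ler_wpM2l ?Qb// mulr_ge0 ?exprn_ge0// mulr_ge0.
    by rewrite (rIZ f2) -/Ig; [apply: le_of_eq; ring|bmt].
  by rewrite (rIZ f1) -/If; [apply: le_of_eq; ring|bmt].
have n1 := norm1_le X10 bf; have n2' := norm1_le X20 bg.
rewrite -/If in n1; rewrite -/Ig in n2'.
apply: (@le_trans _ _ ((kp ^+ 2 * (D / s ^+ n) * (If * Ig)) ^+ 2)).
  apply: lerXn2r; rewrite ?nnegrE; [exact: cnorm_ge0| |exact: main].
  apply: mulr_ge0; last exact: mulr_ge0.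
  by apply: mulr_ge0 Ds; exact: exprn_ge0.
rewrite exprMn [(If * Ig) ^+ 2]exprMn.
apply: le_trans (ler_wpM2l (sqr_ge0 _) (ler_pM (sqr_ge0 _) (sqr_ge0 _) n1 n2')) _.
apply: le_of_eq; rewrite mulnC exprM; field; rewrite expf_neq0// gt_eqF//.
Qed.

End Separation.

(** * The Duhamel integral *)

Section TimeWeights.
Context (R : realType).
Local Notation mu := (@lebesgue_measure R).

Lemma FTC_itv (F f : R -> R) (a b : R) : a <= b ->
  (forall x, a <= x <= b -> der F x (f x)) -> continuous f ->
  \int[mu]_(x in `[a, b]) f x = F b - F a.
Proof.
rewrite le_eqVlt => /predU1P[-> _ _|ab dF cf].
  by rewrite set_itv1 Rintegral_set1 subrr.
have cF x : a <= x <= b -> {for x, continuous F} by move=> /dF /der_cont.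
rewrite /Rintegral (@continuous_FTC2 _ _ F)//.
- exact: continuous_subspaceT.
- split => //.
  + by move=> x; rewrite in_itv /= => /andP[? ?]; have [|] := dF x; first by apply/andP; split; exact: ltW.
  + by apply: cvg_at_right_filter; apply: cF; rewrite lexx ltW.
  + by apply: cvg_at_left_filter; apply: cF; rewrite lexx ltW.
- move=> x; rewrite in_itv /= => /andP[? ?]; rewrite derive1E.
  by have [|_ ->] := dF x; first by apply/andP; split; exact: ltW.
Qed.

Lemma rI_split (h : R -> R) (a b c : R) : a <= b -> b <= c -> bm h ->
  \int[mu]_(x in `[a, c]) h x =
  \int[mu]_(x in `[a, b]) h x + \int[mu]_(x in `[b, c]) h x.
Proof.
move=> ab bc bh.
have := @Rintegral_itvB R h (BLeft a) (BRight c) b (bm_integrable bh (finm_itv _ _)).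
rewrite !bnd_simp => /(_ ab bc); rewrite Rintegral_itv_obnd_cbnd; first by move=> <-; ring.
apply: (bm_integrable bh); split; first exact: measurable_itv.
by rewrite lebesgue_measure_itv /=; case: ifPn => // _; rewrite ltry.
Qed.

Definition isq (u : R) : R := (Num.sqrt (1 + `|u|))^-1.

Lemma isq_gt0 u : 0 < isq u.
Proof. by rewrite invr_gt0 sqrtr_gt0 ltr_pwDl. Qed.

Lemma isq_le1 u : isq u <= 1.
Proof.
rewrite invf_le1 ?sqrtr_gt0 ?ltr_pwDl// -[leLHS]sqrtr1 ler_wsqrtr// lerDl.
exact: normr_ge0.
Qed.

Lemma isq_cont : continuous isq.
Proof.
move=> u; apply: cvgV; first by rewrite gt_eqF// sqrtr_gt0 ltr_pwDl.
apply: (@continuous_comp _ _ _ (fun u : R => 1 + `|u|) (@Num.sqrt R)).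
  by apply: cvgD; [exact: cvg_cst|exact: norm_continuous].
exact: sqrt_continuous.
Qed.

Lemma bm_isq : bm isq.
Proof.
split; first exact: cont_meas isq_cont.
by exists 1 => u; rewrite ger0_norm ?isq_le1// ltW// isq_gt0.
Qed.

Lemma der_sqrt1 (u : R) : 0 <= u -> der (fun u => 2 * Num.sqrt (1 + u)) u (isq u).
Proof.
move=> u0; have p : 0 < 1 + u by rewrite ltr_pwDl.
apply: der_eq (derZ 2 (der_comp (is_derive1_sqrt p) (derD (der_cst 1 u) (der_id u)))) _.
rewrite /isq (ger0_norm u0) add0r mulr1 invfM mulrA mulfV ?mul1r//.
Qed.

Lemma rI_isq_shift (t tau : R) : 0 <= tau -> tau <= t ->
  \int[mu]_(s in `[0, tau]) isq (t - s) = 2 * Num.sqrt (1 + t) - 2 * Num.sqrt (1 + (t - tau)).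
Proof.
move=> tau0 taut.
rewrite (@FTC_itv (fun s => - (2 * Num.sqrt (1 + (t - s)))) _ 0 tau tau0).
- by rewrite subr0 opprK addrC.
- move=> s /andP[s0 st].
  have ts : 0 <= t - s by lra.
  have d1 : der (fun s => t - s) s (-1).
    by apply: der_eq (derB (der_cst t s) (der_id s)) _; rewrite sub0r.
  by apply: der_eq (derN (@der_comp _ (fun u => 2 * Num.sqrt (1 + u)) (fun s => t - s) s _ _ (der_sqrt1 ts) d1)) _; rewrite mulrN1 opprK.
- move=> s; apply: (@continuous_comp _ _ _ (fun s => t - s) isq); last exact: isq_cont.
  by apply: cvgB; [exact: cvg_cst|exact: cvg_id].
Qed.

Lemma rI_isq (tau : R) : 0 <= tau ->
  \int[mu]_(s in `[0, tau]) isq s = 2 * Num.sqrt (1 + tau) - 2.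
Proof.
move=> tau0; rewrite (@FTC_itv (fun s => 2 * Num.sqrt (1 + s)) _ 0 tau tau0).
- by rewrite addr0 sqrtr1 mulr1.
- by move=> s /andP[s0 _]; exact: der_sqrt1.
- exact: isq_cont.
Qed.

Lemma sqrt1D (x : R) : 0 <= x -> Num.sqrt (1 + x) <= 1 + Num.sqrt x.
Proof.
move=> x0; rewrite -(@ler_pXn2r _ 2) ?nnegrE ?sqrtr_ge0 ?addr_ge0 ?sqrtr_ge0//.
rewrite sqr_sqrtr ?addr_ge0//.
have := sqr_sqrtr x0; have := sqrtr_ge0 x; nra.
Qed.

Lemma rI_isq_le (tau : R) : 0 <= tau -> \int[mu]_(s in `[0, tau]) isq s <= 2 * Num.sqrt tau.
Proof. by move=> tau0; rewrite rI_isq//; have := sqrt1D tau0; lra. Qed.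

(** The integral is [2 (A - B)] with [A^2 - B^2 = tau] and [A + B >= sqrt t]. The bound stays valid
    up to [tau = t], although the weight is not small near [s = t]. *)
Lemma rI_isq_shift_le (t tau : R) : 0 <= tau -> tau <= t -> 0 < t ->
  \int[mu]_(s in `[0, tau]) isq (t - s) <= 2 * tau / Num.sqrt t.
Proof.
move=> tau0 taut t0; rewrite rI_isq_shift//.
have st : 0 < Num.sqrt t by rewrite sqrtr_gt0.
rewrite ler_pdivlMr//.
set A := Num.sqrt (1 + t); set B := Num.sqrt (1 + (t - tau)).
have A2 : A ^+ 2 = 1 + t by rewrite sqr_sqrtr; lra.
have B2 : B ^+ 2 = 1 + (t - tau) by rewrite sqr_sqrtr; lra.
have B0 : 0 <= B by exact: sqrtr_ge0.
have tA : Num.sqrt t <= A by rewrite ler_wsqrtr; lra.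
have AB : B <= A by rewrite ler_wsqrtr; lra.
have : (A - B) * Num.sqrt t <= (A - B) * (A + B).
  by rewrite ler_wpM2l; lra.
nra.
Qed.

Lemma rI_isq_sym_le (s tau : R) : 0 <= s <= tau ->
  \int[mu]_(r in `[0, tau]) isq (s - r) <= 4 * Num.sqrt tau.
Proof.
move=> /andP[s0 st]; have tau0 : 0 <= tau by lra.
have b1 : bm (fun r : R => isq (s - r)).
  by have bi := bm_isq; bmt.
rewrite (rI_split s0 st b1) rI_isq_shift// subrr addr0 sqrtr1 mulr1.
rewrite (@FTC_itv (fun r => 2 * Num.sqrt (1 + (r - s))) _ s tau st).
- rewrite subrr addr0 sqrtr1.
  have ts : 0 <= tau - s by lra.
  have := sqrt1D s0; have := sqrt1D ts.
  have : Num.sqrt s <= Num.sqrt tau by rewrite ler_wsqrtr.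
  have : Num.sqrt (tau - s) <= Num.sqrt tau by rewrite ler_wsqrtr; lra.
  lra.
- move=> r /andP[r0 _].
  have ts : 0 <= r - s by lra.
  have d1 : der (fun r => r - s) r 1.
    by apply: der_eq (derB (der_id r) (der_cst s r)) _; rewrite subr0.
  by apply: der_eq (@der_comp _ (fun u => 2 * Num.sqrt (1 + u)) (fun r => r - s) r _ _ (der_sqrt1 ts) d1) _; rewrite mulr1 /isq distrC.
- move=> r; apply: (@continuous_comp _ _ _ (fun r => s - r) isq); last exact: isq_cont.
  by apply: cvgB; [exact: cvg_cst|exact: cvg_id].
Qed.

End TimeWeights.

Section Duhamel.
Context (R : realType) (L kap : R) (a b c : R -> R) (m : R * R -> R * R).
Local Notation mu := (@lebesgue_measure R).
Local Notation C := (R * R)%type.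
Hypothesis L0 : 0 <= L.
Hypothesis sa : smooth1 a.
Hypothesis sb : smooth1 b.
Hypothesis sc : smooth1 c.
Hypothesis k0 : 0 < kap.
Hypothesis ka : forall x, kap <= `|derive1n 2 a x|.
Hypothesis kb : forall x, kap <= `|derive1n 2 b x|.
Hypothesis kc : forall x, kap <= `|derive1n 2 c x|.
Hypothesis sm : symb L m.
Local Notation T := (2 * L).
Local Notation IT := (`[- (2 * L), 2 * L]%classic).
Local Notation W := (`[- (2 * L + 1), 2 * L + 1]%classic).
Local Notation W2 := (`[- (2 * (2 * L + 1)), 2 * (2 * L + 1)]%classic).
Implicit Types F G : R -> C.

Let bm_ : cbm m. Proof. exact: symb_cbm sm. Qed.
Let fT : finm IT. Proof. exact: finm_itv. Qed.
Let ma : measurable_fun setT a. Proof. exact: cont_meas (@smooth1_cont _ _ 0 sa). Qed.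
Let mb : measurable_fun setT b. Proof. exact: cont_meas (@smooth1_cont _ _ 0 sb). Qed.
Let mc : measurable_fun setT c. Proof. exact: cont_meas (@smooth1_cont _ _ 0 sc). Qed.
Let WW2 : W `<=` W2. Proof. by apply: sub_sym; have := L0; lra. Qed.
Let fW2 : finm W2. Proof. exact: finm_itv. Qed.
Let fW : finm W. Proof. exact: finm_itv. Qed.

(* The part of Duhamel's formula coming from the times in [D]. *)
Definition duh (D : set R) F G (t z : R) : C :=
  cmul (0, -1) (cint D (fun s => cmul (cexpi ((t - s) * a z)) (Tm_hat b c m F G s z))).

(** The inverse Fourier integral may be restricted to [IT], since an output frequency is the sum of
    two input frequencies of size at most [L]. *)
Definition sol (D : set R) F G (t x : R) : C :=
  cint IT (fun z => cmul (cexpi (x * z)) (duh D F G t z)).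

Let bK F G t : cbm F -> cbm G ->
  cbm (fun p : R * R => cmul (cexpi ((t - p.1) * a p.2)) (Tm_hat b c m F G p.1 p.2)).
Proof. by move=> bF bG; have bT := cbm_Tm L0 mb mc sm bF bG; bmt. Qed.

Lemma cbm_duh D F G t : finm D -> cbm F -> cbm G -> cbm (duh D F G t).
Proof.
move=> fD bF bG; have h := cbm_cint2 (bK t bF bG) fD.
by rewrite /duh; apply: cbmM => //; exact: cbm_cst.
Qed.

Lemma cbm_sol D F G t : finm D -> cbm F -> cbm G -> cbm (sol D F G t).
Proof.
move=> fD bF bG; have bd := cbm_duh t fD bF bG.
have bk : cbm (fun p : R * R => cmul (cexpi (p.1 * p.2)) (duh D F G t p.2)).
  by move: (duh D F G t) bd => u bd {bF bG}; bmt.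
exact: (cbm_cint1 bk fT).
Qed.

(** At each time [s] the dispersive bound gives the weight [isq (t - s)], uniformly in [x]; it is
    then integrated over [[0, tau]]. *)
Lemma sup_bound : exists2 D : R, 0 <= D & forall t tau F G x, 0 <= tau -> tau <= t -> 0 < t ->
  cbm F -> cbm G ->
  cnorm (sol `[0, tau] F G t x) <=
    D * (tau / Num.sqrt t) * Num.sqrt (n2 W2 F * n2 W2 G).
Proof.
have [D D0 bD] := dispersive_bound L0 mb mc sm sa k0 ka.
exists (2 * Num.sqrt D); first by rewrite mulr_ge0// sqrtr_ge0.
move=> t tau F G x tau0 taut t0 bF bG.
have fD := finm_itv 0 tau.
pose B s := cint IT (fun z => cmul (cexpi (x * z))
      (cmul (cexpi ((t - s) * a z)) (Tm_hat b c m F G s z))).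
have bT := cbm_Tm L0 mb mc sm bF bG.
pose H (p : R * R) := cmul (cexpi (x * p.2))
      (cmul (cexpi ((t - p.1) * a p.2)) (Tm_hat b c m F G p.1 p.2)).
have bH : cbm H by rewrite /H; bmt.
have bB : cbm B by exact: (cbm_cint1 bH fT).
have E : sol `[0, tau] F G t x = cmul (0, -1) (cint `[0, tau] B).
  have bTz z : cbm (fun s => Tm_hat b c m F G s z) by exact: (cbm1 z bT).
  rewrite /sol /duh.
  have h := cbm_cint2 (bK t bF bG) fD.
  transitivity (cint IT (fun z => cmul (0, -1) (cint `[0, tau] (fun s => H (s, z))))).
    apply: eq_cint => z _; rewrite cmulCA; congr (cmul _ _).
    by rewrite /H /= (cintZ fD)//; have b1 := bTz z; bmt.
  rewrite (cintZ fT); last exact: (cbm_cint2 bH fD).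
  by apply: (congr1 (cmul (0, -1))); exact: (esym (cint_fubini bH fD fT)).
rewrite E cnorm_mi; apply: le_trans (cint_norm fD bB) _.
set N := n2 W2 F * n2 W2 G.
have N0 : 0 <= N by apply: mulr_ge0; exact: n2_ge0.
have Bb s : cnorm (B s) <= Num.sqrt D * Num.sqrt N * isq (t - s).
  have r1 : 0 < 1 + `|t - s| by rewrite ltr_pwDl.
  rewrite -(@ler_pXn2r _ 2) ?nnegrE; [|by []|exact: cnorm_ge0|]; last first.
    by rewrite !mulr_ge0 ?sqrtr_ge0// ltW// isq_gt0.
  apply: le_trans (bD _ _ _ _ _ bF bG) _.
  have -> : (Num.sqrt D * Num.sqrt N * isq (t - s)) ^+ 2 = D / (1 + `|t - s|) * N.
    by rewrite !exprMn !sqr_sqrtr// /isq exprVn sqr_sqrtr ?(ltW r1)// mulrAC.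
  rewrite ler_wpM2l ?divr_ge0 ?(ltW r1)//.
  by apply: ler_pM; rewrite ?n2_ge0//; apply: rI_subset => //; try by [bmt|move=> y; exact: sqr_ge0].
have bi := bm_isq R.
apply: (@le_trans _ _ (\int[mu]_(s in `[0, tau]) (Num.sqrt D * Num.sqrt N * isq (t - s)))).
  by apply: rI_le => //; bmt.
rewrite (rIZ fD); last by bmt.
have q0 : 0 <= Num.sqrt D * Num.sqrt N by rewrite mulr_ge0 ?sqrtr_ge0.
apply: le_trans (ler_wpM2l q0 (rI_isq_shift_le tau0 taut t0)) _.
apply: le_of_eq; ring.
Qed.

(** Schur test in the time variable, applied to the constant function [1]: the kernel in [(s, s')]
    is the one of [strichartz_kernel] with [r = s' - s]. Its row integrals give [sqrt tau], and the
    squared norm of [1] gives [tau]. *)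
Lemma energy_bound : exists2 D : R, 0 <= D & forall t tau F G, 0 <= tau ->
  cbm F -> cbm G ->
  n2 IT (duh `[0, tau] F G t) <= D * (tau * Num.sqrt tau) * (n2 W2 F * n2 W2 G).
Proof.
have [D D0 bD] := strichartz_kernel L0 mb mc sm sa k0 ka.
exists (4 * D); first by rewrite mulr_ge0.
move=> t tau F G tau0 bF bG.
have fD := finm_itv 0 tau.
have bk := bK t bF bG.
set N := n2 W2 F * n2 W2 G.
have N0 : 0 <= N by apply: mulr_ge0; exact: n2_ge0.
have bi := bm_isq R.
have bT := cbm_Tm L0 mb mc sm bF bG.
have one : n2 `[0, tau] (fun _ => (1, 0) : C) = tau.
  transitivity (\int[mu]_(x in `[0, tau]) (1 : R)).
    by apply: eq_Rintegral => x _; rewrite cnorm_real normr1 expr1n.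
  by rewrite (rI_cst fD) fine_mu_itv// mul1r subr0.
have := @schur_test R `[0, tau] IT (fun p : R * R => cmul (cexpi ((t - p.1) * a p.2)) (Tm_hat b c m F G p.1 p.2))
  (fun _ => (1, 0)) (fun p => D * isq (p.1 - p.2) * N) (4 * D * Num.sqrt tau * N) fD fT bk.
rewrite one => h.
apply: le_trans (le_trans (le_of_eq _) (h _ _ _ _ _ _)) _.
- apply: eq_Rintegral => z _; rewrite /duh cnorm_mi; congr (cnorm _ ^+ 2).
  by apply: eq_cint => s _; rewrite cmul1.
- exact: cbm_cst.
- by bmt.
- by move=> x y /=; rewrite /isq distrC.
- by move=> p; rewrite mulr_ge0// mulr_ge0// ltW// isq_gt0.
- move=> s s' _ _ /=.
  have := bD (s' - s) s s' F G bF bG; rewrite -/N /isq (distrC s s').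
  rewrite (_ : (fun z => cmul (cexpi ((s' - s) * a z)) _) =
     fun y => cmul (cmul (cexpi ((t - s) * a y)) (Tm_hat b c m F G s y))
      (cconj (cmul (cexpi ((t - s') * a y)) (Tm_hat b c m F G s' y))))//.
  apply/funext => y; rewrite cconjM cconj_expi cmulACA -cexpiD; congr (cmul (cexpi _) _).
  by ring.
- move=> s; rewrite /= in_itv /= => hs.
  have -> : \int[mu]_(s' in `[0, tau]) (D * isq (s - s') * N) =
      \int[mu]_(s' in `[0, tau]) (D * N * isq (s - s')).
    by apply: eq_Rintegral => s' _; rewrite mulrAC.
  rewrite (rIZ fD); last by bmt.
  have q0 : 0 <= D * N by rewrite mulr_ge0.
  apply: le_trans (ler_wpM2l q0 (rI_isq_sym_le hs)) _.
  by apply: le_of_eq; ring.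
by apply: le_of_eq; ring.
Qed.

End Duhamel.

Section Localized.
Context (R : realType) (L kap : R) (a b c : R -> R) (m : R * R -> R * R).
Local Notation mu := (@lebesgue_measure R).
Local Notation C := (R * R)%type.
Hypothesis L0 : 0 <= L.
Hypothesis sa : smooth1 a.
Hypothesis sb : smooth1 b.
Hypothesis sc : smooth1 c.
Hypothesis k0 : 0 < kap.
Hypothesis kc : forall x, kap <= `|derive1n 2 c x|.
Hypothesis sm : symb L m.
Local Notation T := (2 * L).
Local Notation IT := (`[- (2 * L), 2 * L]%classic).
Local Notation W := (`[- (2 * L + 1), 2 * L + 1]%classic).
Implicit Types F G : R -> C.

Let bm_ : cbm m. Proof. exact: symb_cbm sm. Qed.
Let fT : finm IT. Proof. exact: finm_itv. Qed.
Let ma : measurable_fun setT a. Proof. exact: cont_meas (@smooth1_cont _ _ 0 sa). Qed.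
Let mb : measurable_fun setT b. Proof. exact: cont_meas (@smooth1_cont _ _ 0 sb). Qed.
Let mc : measurable_fun setT c. Proof. exact: cont_meas (@smooth1_cont _ _ 0 sc). Qed.

(* The weight [sqrt (1 + |s|)], capped so as to be bounded off [[0, tau]]. *)
Definition capsq (tau s : R) : R := Num.sqrt (1 + Num.min `|s| tau).

Lemma capsq_gt0 tau s : 0 <= tau -> 0 < capsq tau s.
Proof. by move=> tau0; rewrite sqrtr_gt0 ltr_pwDl// le_min normr_ge0. Qed.

Lemma capsqE tau s : 0 <= s <= tau -> capsq tau s = (isq s)^-1.
Proof. by move=> /andP[s0 st]; rewrite /capsq /isq invrK min_l// ger0_norm. Qed.

Lemma capsq_cont tau : continuous (capsq tau).
Proof.
move=> s; apply: (@continuous_comp _ _ _ (fun s : R => 1 + Num.min `|s| tau) (@Num.sqrt R)).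
  apply: cvgD; first exact: cvg_cst.
  apply: (@continuous_min _ _ (fun s : R => `|s|) (fun _ => tau)); first exact: norm_continuous.
  exact: cvg_cst.
exact: sqrt_continuous.
Qed.

Lemma bm_sqrt (h : R -> R) : continuous h -> (exists M, forall s, 0 <= h s <= M) ->
  bm (fun s => Num.sqrt (h s)).
Proof.
move=> ch [M hM]; split.
  by apply: cont_meas => s; apply: (@continuous_comp _ _ _ h (@Num.sqrt R)); [exact: ch|exact: sqrt_continuous].
exists (Num.sqrt M) => s; rewrite ger0_norm ?sqrtr_ge0// ler_wsqrtr//.
by case/andP: (hM s).
Qed.

(** Cauchy-Schwarz in time with the weight [om = isq^-1]: one factor is the integral [I0] of [isq].
    In the other, the decay [1 / (1 + s) = isq^2] of [localized_bound] turns the weight into [isq]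
    again. The product [I0^2] is at most [4 tau], with no logarithm. *)
Lemma localized_energy : exists2 D : R, 0 <= D & forall (t tau X : R) F g, 0 <= tau -> 0 <= X ->
  cbm F -> cbm g ->
  n2 IT (duh a b c m `[0, tau] F (Ftrunc g X) t)
    <= D * tau * X * (n2 W F * n2 `[- X, X] g).
Proof.
have [D D0 bD] := localized_bound L0 mb mc sm sc k0 kc.
exists (4 * D); first by rewrite mulr_ge0.
move=> t tau X F g tau0 X0 bF bg.
have bG := cbm_Ftrunc X bg.
have fD := finm_itv 0 tau.
set N := n2 W F * _.
have N0 : 0 <= N by apply: mulr_ge0; exact: n2_ge0.
have bT := cbm_Tm L0 mb mc sm bF bG.
set G := Ftrunc g X in bG bT *.
pose om := capsq tau.
have om0 s : 0 < om s by exact: capsq_gt0.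
have omM s : om s <= Num.sqrt (1 + tau).
  by rewrite ler_wsqrtr// lerD2l ge_min lexx orbT.
have com : continuous om by exact: capsq_cont.
have bom : bm om.
  split; first exact: cont_meas.
  by exists (Num.sqrt (1 + tau)) => s; rewrite ger0_norm ?omM// ltW.
pose v1 s := Num.sqrt (om s); pose v2 s := Num.sqrt (om s)^-1.
have bv1 : bm v1 by apply: bm_sqrt => //; exists (Num.sqrt (1 + tau)) => s; rewrite omM ltW.
have bv2 : bm v2.
  apply: bm_sqrt.
    by move=> s; apply: cvgV; [rewrite gt_eqF|exact: com].
  exists 1 => s; rewrite invr_ge0 (ltW (om0 s)) /= invf_le1// -[leLHS]sqrtr1 ler_wsqrtr//.
  by rewrite lerDl le_min normr_ge0.
have v1E s : v1 s ^+ 2 = om s by rewrite sqr_sqrtr// ltW.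
have v2E s : v2 s ^+ 2 = (om s)^-1 by rewrite sqr_sqrtr// invr_ge0 ltW.
have v12 s : v2 s * v1 s = 1.
  by rewrite /v1 /v2 -sqrtrM ?invr_ge0 ?(ltW (om0 s))// mulVf ?sqrtr1// gt_eqF.
pose I0 := \int[mu]_(s in `[0, tau]) isq s.
have I0E : \int[mu]_(s in `[0, tau]) (v2 s ^+ 2) = I0.
  apply: eq_Rintegral => s /set_mem; rewrite /= in_itv /= => hs.
  by rewrite v2E /om capsqE// invrK.
have I00 : 0 <= I0 by apply: Rintegral_ge0 => s _; rewrite ltW// isq_gt0.
have I0le : I0 <= 2 * Num.sqrt tau by exact: rI_isq_le.
have bTs z : cbm (fun s => Tm_hat b c m F G s z) by exact: (cbm1 z bT).
pose q z := \int[mu]_(s in `[0, tau]) (om s * cnorm (Tm_hat b c m F G s z) ^+ 2).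
have pt z : cnorm (duh a b c m `[0, tau] F G t z) ^+ 2 <= I0 * q z.
  rewrite /duh cnorm_mi.
  have b1 : cbm (fun s : R => cmul (cexpi ((t - s) * a z)) (Tm_hat b c m F G s z)).
    by have h := bTs z; bmt.
  have h1 := cint_norm fD b1.
  have bn : bm (fun s => v1 s * cnorm (Tm_hat b c m F G s z)).
    by have h := bTs z; bmt.
  have := rI_cauchy_schwarz fD bv2 bn; rewrite I0E.
  rewrite (_ : \int[mu]_(s in _) (v2 s * _) =
     \int[mu]_(s in `[0, tau]) cnorm (cmul (cexpi ((t - s) * a z)) (Tm_hat b c m F G s z))); last first.
    by apply: eq_Rintegral => s _; rewrite mulrA v12 mul1r cnorm_expiM.
  rewrite (_ : \int[mu]_(s in _) ((v1 s * _) ^+ 2) = q z); last first.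
    by apply: eq_Rintegral => s _; rewrite exprMn v1E.
  apply: le_trans; apply: lerXn2r; rewrite ?nnegrE; [exact: cnorm_ge0| |exact: h1].
  by apply: Rintegral_ge0 => s _; exact: cnorm_ge0.
have bq2 : bm (fun p : R * R => om p.1 * cnorm (Tm_hat b c m F G p.1 p.2) ^+ 2).
  by bmt.
have bq : bm q by exact: (bm_rI (bm_swap bq2) fD).
have bdu := cbm_duh L0 sa sb sc sm t fD bF bG.
apply: (@le_trans _ _ (\int[mu]_(z in IT) (I0 * q z))).
  by apply: rI_le; [exact: fT|exact: cbm_norm2|exact: (bmM (bm_cst _ _) bq)|by move=> z _; exact: pt].
rewrite (rIZ fT _ bq) /q -(rI_fubini bq2 fD fT) /=.
have key : \int[mu]_(s in `[0, tau]) \int[mu]_(z in IT) (om s * cnorm (Tm_hat b c m F G s z) ^+ 2)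
    <= D * X * N * I0.
  rewrite /I0 -rIZ//; last exact: bm_isq.
  apply: rI_le; [exact: fD|exact: (bm_rI bq2 fT)| |].
    by apply: bmM; [exact: bm_cst|exact: bm_isq].
  move=> s; rewrite /= in_itv /= => hs.
  have bs : cbm (Tm_hat b c m F G s) by exact: (cbm2 s bT).
  rewrite (rIZ fT _ (cbm_norm2 bs)) -/(n2 IT (Tm_hat b c m F G s)).
  apply: le_trans (ler_wpM2l (ltW (om0 s)) (bD s X F g X0 bF bg)) _.
  rewrite -/N /om capsqE//; have /andP[s0 _] := hs; apply: le_of_eq.
  have i0 : isq s != 0 by rewrite gt_eqF// isq_gt0.
  have -> : (1 + `|s|)^-1 = isq s ^+ 2.
    by rewrite /isq exprVn sqr_sqrtr// addr_ge0.
  by field.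
apply: le_trans (ler_wpM2l I00 key) _.
have DXN : 0 <= D * X * N by apply: mulr_ge0 N0; exact: mulr_ge0.
clearbody N I0.
have st : Num.sqrt tau ^+ 2 = tau by rewrite sqr_sqrtr.
have II : I0 ^+ 2 <= 4 * tau.
  rewrite -st (_ : 4 * Num.sqrt tau ^+ 2 = (2 * Num.sqrt tau) ^+ 2); last by ring.
  by apply: lerXn2r; rewrite ?nnegrE// mulr_ge0// sqrtr_ge0.
apply: (@le_trans _ _ (D * X * N * (4 * tau))); last by apply: le_of_eq; ring.
by apply: le_trans (ler_wpM2l DXN II); apply: le_of_eq; ring.
Qed.

End Localized.

(** * Lebesgue norms *)

Section LebesgueNorms.
Context (R : realType).
Local Notation mu := (@lebesgue_measure R).
Local Notation C := (R * R)%type.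
Implicit Types (u v : R -> C) (q : \bar R) (r : R).

(* [A] bounds the [L^q] norm of [u]; bounded intervals keep every integral finite. *)
Definition Lqb q u (A : R) : Prop :=
  match q with
  | r%:E => forall X, 0 <= X -> \int[mu]_(x in `[- X, X]) (cnorm (u x) `^ r) <= A `^ r
  | _ => forall x, cnorm (u x) <= A
  end.

Lemma bm_powR (h : R -> R) r : bm h -> (forall x, 0 <= h x) -> 0 <= r ->
  bm (fun x => h x `^ r).
Proof.
move=> bh h0 r0; split.
  by apply: (measurableT_comp (measurable_powR r)); case: bh.
have [M M0 hM] := bm_bound bh; exists (M `^ r) => x.
rewrite ger0_norm ?powR_ge0// ge0_ler_powR ?nnegrE ?(ltW M0)//.
by rewrite (le_trans _ (hM x))// ler_norm.
Qed.

Lemma Lqb_le q u A B : A <= B -> 0 <= A -> (2%:E <= q)%E -> Lqb q u A -> Lqb q u B.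
Proof.
move=> AB A0; case: q => [r||]//=.
- rewrite lee_fin => r2 h X X0; apply: le_trans (h X X0) _.
  by rewrite ge0_ler_powR ?nnegrE//; lra.
- by move=> _ h x; exact: le_trans (h x) AB.
Qed.

(** Pointwise, [|u|^r <= S^(r - 2) |u|^2]. For [q = +oo] the value [inv_exp q = 0] leaves just the
    sup bound. *)
Lemma Lqb_interp q u (S E : R) : cbm u -> 0 <= S -> 0 <= E -> (2%:E <= q)%E ->
  (forall x, cnorm (u x) <= S) -> (forall X, 0 <= X -> n2 `[- X, X] u <= E ^+ 2) ->
  Lqb q u (S `^ (1 - 2 * inv_exp q) * E `^ (2 * inv_exp q)).
Proof.
move=> bu S0 E0; case: q => [r||]//=; last first.
  by move=> _ hS _ x; rewrite mulr0 subr0 powRr1// powRr0 mulr1.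
rewrite lee_fin => r2 hS hE X X0.
have r0 : r != 0 by rewrite gt_eqF; lra.
have fX := finm_itv (- X) X.
have bn := cbm_norm bu.
rewrite powRM ?powR_ge0// -!powRrM.
have -> : (1 - 2 * r^-1) * r = r - 2 by field.
have -> : 2 * r^-1 * r = 2 by field.
rewrite powR_mulrn//.
apply: le_trans (ler_wpM2l (powR_ge0 _ _) (hE X X0)).
rewrite /n2 -(rIZ fX); last by bmt.
apply: rI_le => //.
- by apply: bm_powR => //; lra.
- by bmt.
move=> x _; have -> : cnorm (u x) `^ r = cnorm (u x) `^ (r - 2) * cnorm (u x) ^+ 2.
  by rewrite -powR_mulrn// -powRD ?subrK// (negbTE r0).
by rewrite ler_wpM2r ?sqr_ge0// ge0_ler_powR ?nnegrE ?hS//; lra.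
Qed.

Lemma powRD_le (x y r : R) : 0 <= x -> 0 <= y -> 0 <= r ->
  (x + y) `^ r <= 2 `^ r * (x `^ r + y `^ r).
Proof.
move=> x0 y0 r0; have m0 : 0 <= Num.max x y by rewrite le_max x0.
apply: (@le_trans _ _ ((2 * Num.max x y) `^ r)).
  rewrite ge0_ler_powR ?nnegrE ?addr_ge0 ?mulr_ge0//.
  by rewrite mulr_natl mulr2n lerD// le_max lexx ?orbT.
rewrite powRM// ler_wpM2l ?powR_ge0//.
by case: (leP x y) => _; rewrite ?lerDl ?lerDr powR_ge0.
Qed.

(** The factor [4] instead of [2] comes from the crude inequality [(x + y)^r <= 2^r (x^r + y^r)]
    followed by [2 <= 2^r]. *)
Lemma Lqb_add q u v A : cbm u -> cbm v -> 0 <= A -> (2%:E <= q)%E ->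
  Lqb q u A -> Lqb q v A -> Lqb q (fun x => u x + v x) (4 * A).
Proof.
move=> bu bv A0; case: q => [r||]//=; last first.
  by move=> _ hu hv x; have := cnormD (u x) (v x); have := hu x; have := hv x; lra.
rewrite lee_fin => r2 hu hv X X0; have fX := finm_itv (- X) X.
have r0 : 0 <= r by lra.
have r1 : 1 <= r by lra.
have bU : bm (fun x => cnorm (u x) `^ r) by apply: bm_powR => //; exact: cbm_norm.
have bV : bm (fun x => cnorm (v x) `^ r) by apply: bm_powR => //; exact: cbm_norm.
have h1 := hu X X0; have h2 := hv X X0; clear hu hv.
have bUV := bmD bU bV.
apply: (@le_trans _ _ (\int[mu]_(x in `[- X, X]) (2 `^ r * (cnorm (u x) `^ r + cnorm (v x) `^ r)))).
  apply: (rI_le fX); [|exact: (bmM (bm_cst _ _) bUV)|].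
    by apply: bm_powR => //; apply: cbm_norm; exact: cbmD.
  move=> x _; apply: le_trans (powRD_le (cnorm_ge0 (u x)) (cnorm_ge0 (v x)) r0).
  by rewrite ge0_ler_powR ?nnegrE ?addr_ge0 ?cnorm_ge0//; exact: cnormD.
rewrite (rIZ fX _ bUV) (rID fX bU bV).
have -> : (4 * A) `^ r = 2 `^ r * (2 `^ r * A `^ r).
  by rewrite (_ : 4 * A = 2 * (2 * A)) ?powRM ?mulr_ge0//; ring.
rewrite ler_wpM2l ?powR_ge0//.
apply: le_trans (lerD h1 h2) _; rewrite -mulr2n -(mulr_natl (A `^ r)).
apply: (ler_wpM2r (powR_ge0 A r)).
by rewrite -[leLHS](@powRr1 R 2)// ler_powR// ler1n.
Qed.

End LebesgueNorms.

(** * Spatially localized data *)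

Section Pieces.
Context (R : realType).
Local Notation mu := (@lebesgue_measure R).
Local Notation C := (R * R)%type.

Lemma cint_exp_cbm (f : R -> C) (X : R) : cbm f ->
  cbm (fun xi => cint `[- X, X] (fun x => cmul (cexpi (- (x * xi))) (f x))).
Proof.
move=> bf; have bk : cbm (fun p : R * R => cmul (cexpi (- (p.1 * p.2))) (f p.1)) by bmt.
exact: (cbm_cint2 bk (finm_itv _ _)).
Qed.

Lemma n2Z (D : set R) (z : C) (h : R -> C) : finm D -> cbm h ->
  n2 D (fun x => cmul z (h x)) = cnorm z ^+ 2 * n2 D h.
Proof.
move=> fD bh; rewrite -(rIZ fD _ (cbm_norm2 bh)); apply: eq_Rintegral => x _.
by rewrite cnormM exprMn.
Qed.

Lemma n2_Ftrunc (T : R) : 0 < T -> exists2 D : R, 0 <= D & forall (X : R) f, 0 <= X -> cbm f ->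
  n2 `[- T, T] (Ftrunc f X) <= D * n2 `[- X, X] f.
Proof.
move=> /half_plancherel[D D0 bD]; exists (cnorm ((2 * pi)^-1, 0) ^+ 2 * D).
  by rewrite mulr_ge0// sqr_ge0.
move=> X f X0 bf.
have -> : Ftrunc f X = fun xi => cmul ((2 * pi)^-1, 0)
    (cint `[- X, X] (fun x => cmul (cexpi (- (x * xi))) (f x))).
  by apply/funext => xi; rewrite FtruncE.
rewrite (n2Z _ (finm_itv _ _) (cint_exp_cbm X bf)) -mulrA ler_wpM2l ?sqr_ge0//.
have e1 : `|-1 : R| = 1 by rewrite normrN1.
apply: le_trans (bD X (-1) f X0 e1 bf); apply: le_of_eq.
apply: eq_Rintegral => xi _; congr (cnorm _ ^+ 2); apply: eq_cint => x _.
by rewrite mulN1r cmulC.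
Qed.

Lemma Ftrunc_sub (f : R -> C) (X X' : R) : X' <= X ->
  (forall x, X' < `|x| -> f x = 0) -> Ftrunc f X = Ftrunc f X'.
Proof.
move=> XX h; apply/funext => xi; rewrite !FtruncE; congr (cmul _ _); symmetry.
by apply: cint_supp => [|x _ /notin_sym /h ->]; [exact: sub_sym|rewrite cmulz0].
Qed.

Lemma FtruncD (f g : R -> C) (X : R) : cbm f -> cbm g ->
  Ftrunc (fun x => f x + g x) X = fun xi => Ftrunc f X xi + Ftrunc g X xi.
Proof.
move=> bf bg; apply/funext => xi; rewrite !FtruncE.
have b (h : R -> C) : cbm h -> cbm (fun x : R => cmul (cexpi (- (x * xi))) (h x)) by move=> bh; bmt.
have -> : cint `[- X, X] (fun x => cmul (cexpi (- (x * xi))) (f x + g x)) =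
   cint `[- X, X] (fun x => cmul (cexpi (- (x * xi))) (f x)) +
   cint `[- X, X] (fun x => cmul (cexpi (- (x * xi))) (g x)).
  rewrite -(cintD (finm_itv _ _) (b _ bf) (b _ bg)); apply: eq_cint => x _; cring.
by cring.
Qed.

End Pieces.

Section Solution.
Context (R : realType) (L : R) (a b c : R -> R) (m : R * R -> R * R).
Local Notation mu := (@lebesgue_measure R).
Local Notation C := (R * R)%type.
Hypothesis L0 : 0 < L.
Hypothesis sa : smooth1 a.
Hypothesis sb : smooth1 b.
Hypothesis sc : smooth1 c.
Hypothesis sm : symb L m.
Local Notation IT := (`[- (2 * L), 2 * L]%classic).
Implicit Types F G : R -> C.

Let bm_ : cbm m. Proof. exact: symb_cbm sm. Qed.
Let fT : finm IT. Proof. exact: finm_itv. Qed.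
Let ma : measurable_fun setT a. Proof. exact: cont_meas (@smooth1_cont _ _ 0 sa). Qed.
Let mb : measurable_fun setT b. Proof. exact: cont_meas (@smooth1_cont _ _ 0 sb). Qed.
Let mc : measurable_fun setT c. Proof. exact: cont_meas (@smooth1_cont _ _ 0 sc). Qed.
Let L0' : 0 <= L. Proof. exact: ltW. Qed.
Let T0 : 0 < 2 * L. Proof. by rewrite mulr_gt0. Qed.

Let bK F G t z : cbm F -> cbm G ->
  cbm (fun s : R => cmul (cexpi ((t - s) * a z)) (Tm_hat b c m F G s z)).
Proof.
move=> bF bG; have bT := cbm1 z (cbm_Tm L0' mb mc sm bF bG).
have {}bT : cbm (fun s => Tm_hat b c m F G s z) by exact: bT.
by bmt.
Qed.

Lemma TmDl F F' G s z : cbm F -> cbm F' -> cbm G ->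
  Tm_hat b c m (fun x => F x + F' x) G s z = Tm_hat b c m F G s z + Tm_hat b c m F' G s z.
Proof.
move=> bF bF' bG; rewrite !(TmE b c sm _ _ _ _ (lexx L)).
have bv (H : R -> C) : cbm H ->
    cbm (fun xi : R => cmul (cmul (vhat b H s xi) (vhat c G s (z - xi))) (m (xi, z - xi))).
  by move=> bH; rewrite /vhat; bmt.
rewrite -(cintD (finm_itv _ _) (bv _ bF) (bv _ bF')); apply: eq_cint => xi _.
by rewrite /vhat; cring.
Qed.

Lemma solDl D F F' G t x : finm D -> cbm F -> cbm F' -> cbm G ->
  sol L a b c m D (fun x => F x + F' x) G t x = sol L a b c m D F G t x + sol L a b c m D F' G t x.
Proof.
move=> fD bF bF' bG; rewrite /sol.
have bd (H : R -> C) : cbm H -> cbm (fun z : R => cmul (cexpi (x * z)) (duh a b c m D H G t z)).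
  by move=> bH; have h := cbm_duh L0' sa sb sc sm t fD bH bG; bmt.
rewrite -(cintD fT (bd _ bF) (bd _ bF')); apply: eq_cint => z _.
rewrite /duh; set I1 := cint D (fun s => cmul _ (Tm_hat b c m F G s z)).
set I2 := cint D (fun s => cmul _ (Tm_hat b c m F' G s z)).
have -> : cint D (fun s => cmul (cexpi ((t - s) * a z)) (Tm_hat b c m (fun x => F x + F' x) G s z)) = I1 + I2.
  rewrite -(cintD fD (bK t z bF bG) (bK t z bF' bG)); apply: eq_cint => s _.
  by rewrite (TmDl _ _ bF bF' bG); cring.
clearbody I1 I2; by cring.
Qed.

Lemma duh_swap D F G t z : cbm F -> cbm G ->
  duh a b c m D F G t z = duh a c b (fun p => m (p.2, p.1)) D G F t z.
Proof.
move=> bF bG; congr (cmul _ _); apply: eq_cint => s _.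
by rewrite (Tm_swap L0' mb mc sm s z bF bG).
Qed.

Lemma sol_swap D F G t x : cbm F -> cbm G ->
  sol L a b c m D F G t x = sol L a c b (fun p => m (p.2, p.1)) D G F t x.
Proof. by move=> bF bG; apply: eq_cint => z _; rewrite (duh_swap D t z bF bG). Qed.

Lemma sol_split F G (t tau x : R) : 0 <= tau -> tau <= t -> cbm F -> cbm G ->
  sol L a b c m `[0, t] F G t x = sol L a b c m `[0, tau] F G t x + sol L a b c m `[tau, t] F G t x.
Proof.
move=> tau0 taut bF bG; rewrite /sol.
have bd u v : cbm (fun z : R => cmul (cexpi (x * z)) (duh a b c m `[u, v] F G t z)).
  by have h := cbm_duh L0' sa sb sc sm t (finm_itv u v) bF bG; bmt.
rewrite -(cintD fT (bd _ _) (bd _ _)); apply: eq_cint => z _.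
have [b1 b2] := bK t z bF bG.
have -> : duh a b c m `[0, t] F G t z = duh a b c m `[0, tau] F G t z + duh a b c m `[tau, t] F G t z.
  rewrite /duh {1}/cint (rI_split tau0 taut b1) (rI_split tau0 taut b2).
  rewrite /cint; set u1 := Rintegral _ _ _; set u2 := Rintegral _ _ _.
  set u3 := Rintegral _ _ _; set u4 := Rintegral _ _ _; clearbody u1 u2 u3 u4.
  by cring.
set u := duh _ _ _ _ _ _ _ _ _; set v := duh _ _ _ _ _ _ _ _ _; clearbody u v; cring.
Qed.

Lemma usolE F G t x : usol a b c m F G t x = sol L a b c m `[0, t] F G t x.
Proof.
rewrite /usol /sol; symmetry.
have E : [set s | 0 <= s <= t] = `[0, t]%classic.
  by apply/seteqP; split => s; rewrite /= in_itv.
rewrite /uhat E; apply: cint_supp => // z _ /notin_sym hz.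
rewrite -/(duh a b c m `[0, t] F G t z).
have -> : duh a b c m `[0, t] F G t z = 0; last by rewrite cmulz0.
rewrite /duh; have -> : cint `[0, t] (fun s => cmul (cexpi ((t - s) * a z)) (Tm_hat b c m F G s z)) =
    cint `[0, t] (fun _ => 0).
  by apply: eq_cint => s _; rewrite (Tm_supp b c sm) ?cmulz0.
by rewrite /cint !(rI_cst (finm_itv _ _)) !mul0r cmulz0.
Qed.

End Solution.

(** * Early and late times of the Duhamel integral *)

Section Estimates.
Context (R : realType) (L kap kap1 : R) (a b c : R -> R) (m : R * R -> R * R).
Local Notation mu := (@lebesgue_measure R).
Local Notation C := (R * R)%type.
Hypothesis L0 : 0 < L.
Hypothesis sa : smooth1 a.
Hypothesis sb : smooth1 b.
Hypothesis sc : smooth1 c.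
Hypothesis k0 : 0 < kap.
Hypothesis ka : forall x, kap <= `|derive1n 2 a x|.
Hypothesis kb : forall x, kap <= `|derive1n 2 b x|.
Hypothesis kc : forall x, kap <= `|derive1n 2 c x|.
Hypothesis sm : symb L m.
Hypothesis k10 : 0 < kap1.
Hypothesis sub : forall p, supp m p -> `|p.1| <= L /\ `|p.2| <= L.
Hypothesis sep : forall p, supp m p ->
  kap1 <= `|derive1n 1 b p.1 - derive1n 1 c p.2|.
Local Notation IT := (`[- (2 * L), 2 * L]%classic).
Implicit Types f g : R -> C.

Let L0' : 0 <= L. Proof. exact: ltW. Qed.
Let T0 : 0 < 2 * L. Proof. by rewrite mulr_gt0. Qed.

Definition mass (X1 X2 : R) f g := Num.sqrt (n2 `[- X1, X1] f * n2 `[- X2, X2] g).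

Lemma mass_ge0 X1 X2 f g : 0 <= mass X1 X2 f g.
Proof. exact: sqrtr_ge0. Qed.

Lemma mass_sq X1 X2 f g : mass X1 X2 f g ^+ 2 = n2 `[- X1, X1] f * n2 `[- X2, X2] g.
Proof. by rewrite sqr_sqrtr// mulr_ge0// n2_ge0. Qed.

Lemma head_sup : exists2 D : R, 0 <= D & forall (t tau X1 X2 : R) f g x,
  0 <= X1 -> 0 <= X2 -> 0 <= tau -> tau <= t -> 0 < t -> cbm f -> cbm g ->
  cnorm (sol L a b c m `[0, tau] (Ftrunc f X1) (Ftrunc g X2) t x)
    <= D * (tau / Num.sqrt t) * mass X1 X2 f g.
Proof.
have [D D0 bD] := sup_bound L0' sa sb sc k0 ka sm.
have W0 : 0 < 2 * (2 * L + 1) by have := L0; lra.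
have [E E0 bE] := n2_Ftrunc W0.
exists (D * E); first exact: mulr_ge0.
move=> t tau X1 X2 f g x X10 X20 tau0 taut t0 bf bg.
have q0 : 0 <= D * (tau / Num.sqrt t) by rewrite mulr_ge0// divr_ge0// sqrtr_ge0.
have M0 := mass_ge0 X1 X2 f g.
apply: le_trans (bD t tau _ _ x tau0 taut t0 (cbm_Ftrunc X1 bf) (cbm_Ftrunc X2 bg)) _.
rewrite (mulrAC D E) -[leRHS]mulrA; apply: (ler_wpM2l q0).
rewrite -[leRHS]ger0_norm; last by rewrite mulr_ge0.
rewrite -sqrtr_sqr ler_wsqrtr// exprMn mass_sq.
apply: le_trans (ler_pM (n2_ge0 _ _) (n2_ge0 _ _) (bE X1 f X10 bf) (bE X2 g X20 bg)) _.
by apply: le_of_eq; ring.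
Qed.

(** The single number [B] stands for whichever of [sqrt tau], [X1], [X2] is best: the curvature of
    [a] gives the first, that of [b] (after exchanging the inputs) the second, that of [c] the
    third. *)
Lemma head_energy : exists2 D : R, 0 <= D & forall (t tau X1 X2 B : R) f g,
  0 <= X1 -> 0 <= X2 -> 0 <= tau -> 0 <= B -> cbm f -> cbm g ->
  [\/ Num.sqrt tau <= B, X1 <= B | X2 <= B] ->
  n2 IT (duh a b c m `[0, tau] (Ftrunc f X1) (Ftrunc g X2) t)
    <= D * (tau * B) * mass X1 X2 f g ^+ 2.
Proof.
have [D1 D10 bD1] := energy_bound L0' sa sb sc k0 ka sm.
have [D2 D20 bD2] := localized_energy L0' sa sb sc k0 kc sm.
have [D3 D30 bD3] := localized_energy L0' sa sc sb k0 kb (symb_swap sm).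
have W0 : 0 < 2 * (2 * L + 1) by have := L0; lra.
have W10 : 0 < 2 * L + 1 by have := L0; lra.
have [E E0 bE] := n2_Ftrunc W0.
have [F F0 bF] := n2_Ftrunc W10.
exists (D1 * E ^+ 2 + D2 * F + D3 * F).
  by rewrite !addr_ge0// mulr_ge0// sqr_ge0.
move=> t tau X1 X2 B f g X10 X20 tau0 B0 bf bg hB.
have tB : 0 <= tau * B by rewrite mulr_ge0.
rewrite mass_sq; set N1 := n2 _ f; set N2 := n2 _ g.
have N10 : 0 <= N1 by exact: n2_ge0.
have N20 : 0 <= N2 by exact: n2_ge0.
have Q0 : 0 <= tau * B * (N1 * N2) by rewrite mulr_ge0// mulr_ge0.
have fin (K K' : R) : 0 <= K -> K <= K' -> K * (tau * B) * (N1 * N2) <= K' * (tau * B) * (N1 * N2).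
  by move=> K0 KK; rewrite -!mulrA ler_wpM2r//; rewrite mulrA.
have p1 : 0 <= D1 * E ^+ 2 by rewrite mulr_ge0// sqr_ge0.
have p2 : 0 <= D2 * F by rewrite mulr_ge0.
have p3 : 0 <= D3 * F by rewrite mulr_ge0.
have b1 := cbm_Ftrunc X1 bf; have b2 := cbm_Ftrunc X2 bg.
case: hB => hB.
- apply: (@le_trans _ _ (D1 * E ^+ 2 * (tau * B) * (N1 * N2))); last by apply: fin => //; lra.
  apply: le_trans (bD1 t tau _ _ tau0 b1 b2) _.
  apply: (@le_trans _ _ (D1 * (tau * B) * (E * N1 * (E * N2)))); last by apply: le_of_eq; ring.
  apply: ler_pM.
  + by rewrite mulr_ge0// mulr_ge0// sqrtr_ge0.
  + by rewrite mulr_ge0// n2_ge0.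
  + by rewrite ler_wpM2l// ler_wpM2l.
  + by apply: ler_pM; rewrite ?n2_ge0//; [exact: bE|exact: bE].
- apply: (@le_trans _ _ (D3 * F * (tau * B) * (N1 * N2))); last by apply: fin => //; lra.
  have -> : duh a b c m `[0, tau] (Ftrunc f X1) (Ftrunc g X2) t =
      duh a c b (fun p => m (p.2, p.1)) `[0, tau] (Ftrunc g X2) (Ftrunc f X1) t.
    by apply/funext => z; exact: (duh_swap a L0 sb sc sm _ _ _ b1 b2).
  apply: le_trans (bD3 t tau X1 _ f tau0 X10 b2 bf) _.
  rewrite -/N1.
  apply: (@le_trans _ _ (D3 * (tau * B) * (F * N2 * N1))); last by apply: le_of_eq; ring.
  apply: ler_pM.
  + by rewrite mulr_ge0// mulr_ge0.
  + by rewrite mulr_ge0// n2_ge0.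
  + by rewrite -mulrA ler_wpM2l// ler_wpM2l.
  + by rewrite ler_wpM2r//; exact: bF.
- apply: (@le_trans _ _ (D2 * F * (tau * B) * (N1 * N2))); last by apply: fin => //; lra.
  apply: le_trans (bD2 t tau X2 _ g tau0 X20 b1 bg) _.
  rewrite -/N2.
  apply: (@le_trans _ _ (D2 * (tau * B) * (F * N1 * N2))); last by apply: le_of_eq; ring.
  apply: ler_pM.
  + by rewrite mulr_ge0// mulr_ge0.
  + by rewrite mulr_ge0// n2_ge0.
  + by rewrite -mulrA ler_wpM2l// ler_wpM2l.
  + by rewrite ler_wpM2r//; exact: bF.
Qed.

(** From time [tau] on, both radii are small compared with [s], so each time has rapid decay; the
    length of the time interval costs at most a factor [t]. *)
Lemma tail_bound n : exists2 D : R, 0 <= D & forall (t tau X1 X2 : R) f g z,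
  0 <= X1 -> 0 <= X2 -> 0 < tau -> tau <= t -> X1 + X2 <= kap1 / 2 * tau -> cbm f -> cbm g ->
  cnorm (duh a b c m `[tau, t] (Ftrunc f X1) (Ftrunc g X2) t z)
    <= D * (t * Num.sqrt (X1 * X2) / tau ^+ n) * mass X1 X2 f g.
Proof.
have [D D0 bD] := separated_bound L0' sb sc sm k10 sub sep n.
exists (Num.sqrt D); first exact: sqrtr_ge0.
move=> t tau X1 X2 f g z X10 X20 tau0 taut hX bf bg.
have b1 := cbm_Ftrunc X1 bf; have b2 := cbm_Ftrunc X2 bg.
have mb : measurable_fun setT b by exact: cont_meas (@smooth1_cont _ _ 0 sb).
have mc : measurable_fun setT c by exact: cont_meas (@smooth1_cont _ _ 0 sc).
have bT := cbm1 z (cbm_Tm L0' mb mc sm b1 b2).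
have {}bT : cbm (fun s => Tm_hat b c m (Ftrunc f X1) (Ftrunc g X2) s z) by exact: bT.
have bk : cbm (fun s : R => cmul (cexpi ((t - s) * a z)) (Tm_hat b c m (Ftrunc f X1) (Ftrunc g X2) s z)).
  by bmt.
rewrite /duh cnorm_mi.
set N := mass X1 X2 f g; have N0 : 0 <= N by exact: mass_ge0.
have taun : 0 < tau ^+ n by rewrite exprn_gt0.
pose M := Num.sqrt D * Num.sqrt (X1 * X2) / tau ^+ n * N.
have M0 : 0 <= M by rewrite mulr_ge0// divr_ge0 ?(ltW taun)// mulr_ge0// sqrtr_ge0.
have pt s : `[tau, t]%classic s ->
   cnorm (cmul (cexpi ((t - s) * a z)) (Tm_hat b c m (Ftrunc f X1) (Ftrunc g X2) s z)) <= M.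
  rewrite /= in_itv /= => /andP[ts _].
  have s0 : 0 < s by exact: lt_le_trans tau0 ts.
  rewrite cnorm_expiM -(@ler_pXn2r _ 2) ?nnegrE; [|by []|exact: cnorm_ge0|exact: M0].
  have hs : X1 + X2 <= kap1 / 2 * s.
    by apply: le_trans hX _; rewrite ler_wpM2l// divr_ge0// ltW.
  apply: le_trans (bD s z X1 X2 f g X10 X20 s0 hs bf bg) _.
  have X120 : 0 <= X1 * X2 by exact: mulr_ge0.
  rewrite /M !exprMn -mass_sq -/N (sqr_sqrtr D0) (sqr_sqrtr X120).
  rewrite ler_wpM2r ?sqr_ge0// exprVn -exprM mulnC -mulrA (mulrC _ (X1 * X2)) mulrA.
  rewrite ler_wpM2l ?mulr_ge0// lef_pV2 ?posrE ?exprn_gt0//.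
  by apply: lerXn2r; rewrite ?nnegrE//; exact: ltW.
apply: le_trans (cint_le (finm_itv _ _) bk pt) _.
rewrite fine_mu_itv//.
apply: (@le_trans _ _ (M * t)); first by rewrite ler_wpM2l// gerBl ltW.
by rewrite /M; apply: le_of_eq; ring.
Qed.

End Estimates.

(** * The interpolated bound for a pair of scales *)

Section Powers.
Context (R : realType).
Implicit Types (t x y p : R) (q : \bar R).

Lemma powRDt t x y : 0 < t -> t `^ (x + y) = t `^ x * t `^ y.
Proof. by move=> t0; rewrite powRD// (gt_eqF t0) implybT. Qed.

Lemma powR_mono t x y : 1 <= t -> x <= y -> t `^ x <= t `^ y.
Proof. by move=> t1; exact: ler_powR. Qed.

Lemma powR_split x p : 0 <= x -> x `^ (1 - 2 * p) * x `^ (2 * p) = x.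
Proof.
move=> x0; rewrite -powRD; first by rewrite subrK powRr1.
by rewrite subrK oner_eq0.
Qed.

Lemma powR_interp t (x u v p : R) : 0 < t -> 0 <= x ->
  (x * t `^ u) `^ (1 - 2 * p) * (x * t `^ v) `^ (2 * p) = x * t `^ (u * (1 - 2 * p) + v * (2 * p)).
Proof.
move=> t0 x0; rewrite !powRM ?powR_ge0// mulrACA powR_split// -!powRrM.
by rewrite powRDt.
Qed.

Lemma inv_exp_itv q : (2%:E <= q)%E -> 0 <= inv_exp q <= 2^-1.
Proof.
case: q => [r||]//=; last by move=> _; rewrite lexx /= invr_ge0.
rewrite lee_fin => r2; have r0 : 0 < r by lra.
by rewrite invr_ge0 (ltW r0) lef_pV2// posrE.
Qed.

Lemma sqr_powR t x : (t `^ (x / 2)) ^+ 2 = t `^ x.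
Proof. by rewrite -powR_mulrn ?powR_ge0// -powRrM divfK. Qed.

(** One power of [tau] absorbs the factor [sqrt (X1 X2)]. The other [k] powers gain at least [t^2],
    enough for the length [t] of the time interval and for a target power as low as [t^(-1/2)]. *)
Lemma tail_exponent (e M eta k : R) : 0 <= eta -> 2 <= k * (2 * eta) -> 0 <= M * k -> - 2^-1 <= e ->
  1 + (M + eta) <= e + (M + 2 * eta) * (k + 1).
Proof. by move=> *; rewrite mulrDl !mulrDr !mulr1; nra. Qed.

End Powers.

Section PairBound.
Context (R : realType) (L kap kap1 : R) (a b c : R -> R) (m : R * R -> R * R).
Local Notation mu := (@lebesgue_measure R).
Local Notation C := (R * R)%type.
Hypothesis L0 : 0 < L.
Hypothesis sa : smooth1 a.
Hypothesis sb : smooth1 b.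
Hypothesis sc : smooth1 c.
Hypothesis k0 : 0 < kap.
Hypothesis ka : forall x, kap <= `|derive1n 2 a x|.
Hypothesis kb : forall x, kap <= `|derive1n 2 b x|.
Hypothesis kc : forall x, kap <= `|derive1n 2 c x|.
Hypothesis sm : symb L m.
Hypothesis k10 : 0 < kap1.
Hypothesis sub : forall p, supp m p -> `|p.1| <= L /\ `|p.2| <= L.
Hypothesis sep : forall p, supp m p ->
  kap1 <= `|derive1n 1 b p.1 - derive1n 1 c p.2|.
Local Notation IT := (`[- (2 * L), 2 * L]%classic).
Implicit Types f g : R -> C.
Variables (q : \bar R) (eta : R).
Hypothesis q2 : (2%:E <= q)%E.
Hypothesis eta0 : 0 < eta.
Let p := inv_exp q.

Let L0' : 0 <= L. Proof. exact: ltW. Qed.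
Let T0 : 0 < 2 * L. Proof. by rewrite mulr_gt0. Qed.


Let fT : finm IT. Proof. exact: finm_itv. Qed.

(* For data at scales [t^mu1] and [t^mu2], the relevant times are at most about
   [t^pair_theta], and the squared L^2 bound is [t^(pair_theta + pair_gain)]. *)
Definition pair_theta (mu1 mu2 : R) := Num.min 1 (Num.max mu1 mu2 + 2 * eta).

Definition pair_gain (mu1 mu2 : R) :=
  Num.min (pair_theta mu1 mu2 / 2) (Num.min mu1 mu2 + eta).

(** This is [(1 - 2p)(th - 1/2) + 2p (th + ga)/2], the interpolation of the sup exponent with the
    L^2 exponent. *)
Definition pair_exp (mu1 mu2 : R) :=
  pair_theta mu1 mu2 * (1 - p) - 2^-1 + p + p * pair_gain mu1 mu2.

Lemma pair_theta_ge0 mu1 mu2 : 0 <= mu1 -> 0 <= pair_theta mu1 mu2 <= 1.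
Proof.
move=> m0; rewrite le_min ler01 ge_min lexx /=.
by rewrite !andbT addr_ge0 ?le_max ?m0// mulr_ge0// ltW.
Qed.

Lemma pair_gain_ge0 mu1 mu2 : 0 <= mu1 -> 0 <= mu2 -> 0 <= pair_gain mu1 mu2.
Proof.
move=> m1 m2; have /andP[th0 _] := pair_theta_ge0 mu2 m1.
by rewrite le_min divr_ge0//= addr_ge0 ?le_min ?m1// ltW.
Qed.

Lemma pair_exp_ge mu1 mu2 : 0 <= mu1 -> 0 <= mu2 -> - 2^-1 <= pair_exp mu1 mu2.
Proof.
move=> m1 m2; have /andP[th0 _] := pair_theta_ge0 mu2 m1.
have g0 := pair_gain_ge0 m1 m2; have /andP[p0 p1] := inv_exp_itv q2.
rewrite -/p in p0 p1.
have h1 : 0 <= pair_theta mu1 mu2 * (1 - p) by rewrite mulr_ge0//; lra.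
have h2 : 0 <= p * pair_gain mu1 mu2 by rewrite mulr_ge0.
rewrite /pair_exp; lra.
Qed.

(** The radii are bounded only for exponents below [1]: the piece at distance [t] and beyond has no
    outer radius. It needs none, as all times up to [t] are then kept and the bound by [sqrt tau] is
    the one that counts. *)
Lemma pair_head : exists2 K : R, 0 <= K & forall (t tau C0 mu1 mu2 X1 X2 : R) f g,
  1 <= t -> 1 <= C0 -> 0 <= tau -> tau <= t -> tau <= C0 * t `^ pair_theta mu1 mu2 ->
  0 <= mu1 -> 0 <= mu2 -> 0 <= X1 -> 0 <= X2 ->
  (mu1 < 1 -> X1 <= t `^ (mu1 + eta)) -> (mu2 < 1 -> X2 <= t `^ (mu2 + eta)) ->
  cbm f -> cbm g ->
  Lqb q (sol L a b c m `[0, tau] (Ftrunc f X1) (Ftrunc g X2) t)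
    (K * C0 * t `^ pair_exp mu1 mu2 * mass X1 X2 f g).
Proof.
have [D1 D10 bD1] := head_sup L0 sa sb sc k0 ka sm.
have [D2 D20 bD2] := head_energy L0 sa sb sc k0 ka kb kc sm.
have [D3 D30 bD3] := half_plancherel_dual T0.
pose K := D1 + Num.sqrt (D3 * D2).
have K0 : 0 <= K by rewrite addr_ge0// sqrtr_ge0.
exists K => // t tau C0 mu1 mu2 X1 X2 f g t1 C01 tau0 taut tauC m1 m2 X10 X20 hX1 hX2 bf bg.
have t0 : 0 < t by exact: lt_le_trans t1.
have C00 : 0 <= C0 by exact: le_trans C01.
set th := pair_theta mu1 mu2 in tauC *.
set ga := pair_gain mu1 mu2.
have /andP[th0 th1] := pair_theta_ge0 mu2 m1; rewrite -/th in th0 th1.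
have ga0 : 0 <= ga by exact: pair_gain_ge0.
set N := mass X1 X2 f g; have N0 : 0 <= N by exact: mass_ge0.
pose x := K * C0 * N; have x0 : 0 <= x by rewrite mulr_ge0// mulr_ge0.
have b1 := cbm_Ftrunc X1 bf; have b2 := cbm_Ftrunc X2 bg.
have fD := finm_itv 0 tau.
have bsol := cbm_sol L0' sa sb sc sm t fD b1 b2.
have bduh := cbm_duh L0' sa sb sc sm t fD b1 b2.
have C0le : C0 <= C0 ^+ 2 by rewrite expr2 ler_peMl.
(* If the gain is not [th / 2], it is [min mu1 mu2 + eta < th / 2 <= 1 / 2]. The smaller exponent is
   then below [1], and the corresponding radius is bounded. *)
have hB : [\/ Num.sqrt tau <= C0 * t `^ ga, X1 <= C0 * t `^ ga | X2 <= C0 * t `^ ga].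
  case: (leP (th / 2) (Num.min mu1 mu2 + eta)) => h.
    apply: Or31; have -> : ga = th / 2 by rewrite /ga /pair_gain -/th min_l.
    rewrite -(@ler_pXn2r _ 2) ?nnegrE ?sqrtr_ge0//; last by rewrite mulr_ge0// powR_ge0.
    by rewrite sqr_sqrtr// exprMn sqr_powR (le_trans tauC)// ler_wpM2r// powR_ge0.
  have -> : ga = Num.min mu1 mu2 + eta by rewrite /ga /pair_gain -/th min_r// ltW.
  have : Num.min mu1 mu2 < 1 by have := eta0; lra.
  case: (leP mu1 mu2) => _ hm; [apply: Or32|apply: Or33].
    by apply: le_trans (hX1 hm) _; rewrite mulrC ler_peMr// powR_ge0.
  by apply: le_trans (hX2 hm) _; rewrite mulrC ler_peMr// powR_ge0.
have -> : K * C0 * t `^ pair_exp mu1 mu2 * N =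
    (x * t `^ (th - 2^-1)) `^ (1 - 2 * p) * (x * t `^ ((th + ga) / 2)) `^ (2 * p).
  rewrite powR_interp// /x mulrAC; congr (_ * t `^ _).
  by rewrite /pair_exp -/th -/ga; field.
apply: Lqb_interp => //.
- by rewrite mulr_ge0// powR_ge0.
- by rewrite mulr_ge0// powR_ge0.
- move=> y; apply: le_trans (bD1 t tau X1 X2 f g y X10 X20 tau0 taut t0 bf bg) _.
  have -> : x * t `^ (th - 2^-1) = K * (C0 * t `^ (th - 2^-1)) * N by rewrite /x; ring.
  rewrite -/N ler_wpM2r//; apply: ler_pM => //.
  + by rewrite divr_ge0// sqrtr_ge0.
  + by rewrite lerDl sqrtr_ge0.
  + rewrite ler_pdivrMr ?sqrtr_gt0// -powR12_sqrt ?(ltW t0)// -mulrA -powRDt//.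
    by rewrite subrK.
- move=> X XX0; apply: le_trans (bD3 X _ XX0 bduh) _.
  have tB : 0 <= C0 * t `^ ga by rewrite mulr_ge0// powR_ge0.
  apply: le_trans (ler_wpM2l D30 (bD2 t tau X1 X2 _ f g X10 X20 tau0 tB bf bg hB)) _.
  rewrite -/N /x !exprMn sqr_powR.
  apply: (@le_trans _ _ (D3 * D2 * (C0 ^+ 2 * t `^ (th + ga)) * N ^+ 2)).
    have key : tau * (C0 * t `^ ga) <= C0 ^+ 2 * t `^ (th + ga).
      rewrite powRDt// [leRHS](_ : _ = C0 * t `^ th * (C0 * t `^ ga)); last by ring.
      exact: ler_wpM2r.
    have DN : 0 <= D3 * D2 * N ^+ 2 by rewrite mulr_ge0 ?sqr_ge0// mulr_ge0.
    by apply: le_trans (le_trans (le_of_eq _) (ler_wpM2l DN key)) (le_of_eq _); ring.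
  have -> : K ^+ 2 * C0 ^+ 2 * N ^+ 2 * t `^ (th + ga) = K ^+ 2 * (C0 ^+ 2 * t `^ (th + ga)) * N ^+ 2 by ring.
  rewrite ler_wpM2r ?sqr_ge0// ler_wpM2r ?mulr_ge0 ?sqr_ge0 ?powR_ge0//.
  rewrite -[leLHS]sqr_sqrtr ?mulr_ge0//; apply: lerXn2r; rewrite ?nnegrE ?sqrtr_ge0//.
  by rewrite lerDr.
Qed.

(** The extra [eta] in the exponent of [tau] over that of the radii turns arbitrarily many
    integrations by parts into an arbitrarily large power of [t]. *)
Lemma pair_tail (C0 : R) : 1 <= C0 -> 4 / kap1 <= C0 ->
  exists2 K : R, 0 <= K & forall (t tau mu1 mu2 X1 X2 : R) f g,
  1 <= t -> tau = C0 * t `^ (Num.max mu1 mu2 + 2 * eta) -> tau < t ->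
  0 <= mu1 -> 0 <= mu2 -> 0 <= X1 -> 0 <= X2 ->
  (mu1 < 1 -> X1 <= t `^ (mu1 + eta)) -> (mu2 < 1 -> X2 <= t `^ (mu2 + eta)) ->
  cbm f -> cbm g ->
  Lqb q (sol L a b c m `[tau, t] (Ftrunc f X1) (Ftrunc g X2) t)
    (K * t `^ pair_exp mu1 mu2 * mass X1 X2 f g).
Proof.
move=> C01 C0k; have C00 : 0 <= C0 by exact: le_trans C01.
(* Each integration by parts gains at least [t^(2 eta)]; this many gain at least [t^2]. *)
have [n hn] : exists n : nat, 2 <= n%:R * (2 * eta).
  exists (Num.trunc (2 / (2 * eta))).+1; rewrite -ler_pdivrMr ?mulr_gt0//.
  by apply: ltW; apply: truncnS_gt.
have [D1 D10 bD1] := tail_bound a L0 sb sc sm k10 sub sep n.+1.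
have [D3 D30 bD3] := half_plancherel_dual T0.
pose K := D1 * (4 * L + Num.sqrt (D3 * (4 * L))).
have L40 : 0 <= 4 * L by rewrite mulr_ge0.
have K0 : 0 <= K by rewrite mulr_ge0// addr_ge0// sqrtr_ge0.
exists K => // t tau mu1 mu2 X1 X2 f g t1 tauE taut m1 m2 X10 X20 hX1 hX2 bf bg.
have t0 : 0 < t by exact: lt_le_trans t1.
set M := Num.max mu1 mu2 in tauE.
have M0 : 0 <= M by rewrite le_max m1.
have tau0 : 0 < tau by rewrite tauE mulr_gt0 ?powR_gt0// (lt_le_trans _ C01).
(* Since [C0 >= 1], a time [tau] below [t] forces both exponents below [1], so both radii are
   bounded. *)
have M1 : M + 2 * eta < 1.
  rewrite ltNge; apply/negP => h; move: taut; rewrite ltNge => /negP; apply.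
  rewrite tauE -[leLHS]mul1r; apply: ler_pM => //; first exact: ltW.
  by rewrite -[leLHS](powRr1 (ltW t0)) powR_mono.
set N := mass X1 X2 f g; have N0 : 0 <= N by exact: mass_ge0.
have e0 := eta0.
have XM (mu X : R) : mu <= M -> (mu < 1 -> X <= t `^ (mu + eta)) -> X <= t `^ (M + eta).
  move=> hmu hX; have mu1' : mu < 1 by lra.
  by apply: le_trans (hX mu1') _; rewrite powR_mono// lerD2r.
have {}hX1 : X1 <= t `^ (M + eta) by apply: (XM mu1) => //; rewrite le_max lexx.
have {}hX2 : X2 <= t `^ (M + eta) by apply: (XM mu2) => //; rewrite le_max lexx orbT.
(* Here [C0 >= 4 / kap1] makes the sum of two radii at most [kap1 / 2] times [tau]. *)
have hX : X1 + X2 <= kap1 / 2 * tau.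
  have h1 : t `^ (M + eta) <= t `^ (M + 2 * eta) by rewrite powR_mono//; lra.
  have h2 : 2 <= kap1 / 2 * C0.
    by move: C0k; rewrite ler_pdivrMr// => h; rewrite mulrAC ler_pdivlMr// mulrC; lra.
  apply: (@le_trans _ _ (2 * t `^ (M + 2 * eta))); first by rewrite mulr_natl mulr2n; apply: lerD; [exact: le_trans hX1 h1|exact: le_trans hX2 h1].
  by rewrite tauE mulrA ler_wpM2r// powR_ge0.
have duhb z : cnorm (duh a b c m `[tau, t] (Ftrunc f X1) (Ftrunc g X2) t z)
    <= D1 * t `^ pair_exp mu1 mu2 * N.
  apply: le_trans (bD1 t tau X1 X2 f g z X10 X20 tau0 (ltW taut) hX bf bg) _.
  rewrite -/N ler_wpM2r// ler_wpM2l//.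
  rewrite ler_pdivrMr ?exprn_gt0//.
  apply: (@le_trans _ _ (t `^ (1 + (M + eta)))).
    rewrite powRDt// powRr1 ?(ltW t0)// ler_wpM2l ?(ltW t0)//.
    rewrite -[leRHS]ger0_norm ?powR_ge0// -sqrtr_sqr ler_wsqrtr// expr2.
    exact: ler_pM.
  apply: (@le_trans _ _ (t `^ pair_exp mu1 mu2 * t `^ ((M + 2 * eta) * n.+1%:R))).
    rewrite -powRDt// powR_mono//; have he := pair_exp_ge m1 m2.
    have : 0 <= M * n%:R by rewrite mulr_ge0.
    by rewrite -(natr1 n) => Mk; exact: (tail_exponent (ltW eta0) hn Mk he).
  rewrite ler_wpM2l ?powR_ge0// powRrM powR_mulrn ?powR_ge0//.
  apply: lerXn2r; rewrite ?nnegrE ?powR_ge0 ?(ltW tau0)//.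
  by rewrite tauE ler_peMl// powR_ge0.
have b1 := cbm_Ftrunc X1 bf; have b2 := cbm_Ftrunc X2 bg.
have fD := finm_itv tau t.
have bsol := cbm_sol L0' sa sb sc sm t fD b1 b2.
have bduh := cbm_duh L0' sa sb sc sm t fD b1 b2.
set P := t `^ _ in duhb *; have P0 : 0 <= P by exact: powR_ge0.
clearbody P N.
(* A uniform bound on the Fourier side over the bounded window [IT] controls the sup norm and the
   L^2 norm by the same quantity, so the interpolation has equal end points. *)
rewrite -[X in Lqb _ _ X](powR_split p); last by rewrite mulr_ge0// mulr_ge0.
have LE : fine (mu IT) = 4 * L.
  by rewrite fine_mu_itv; [ring|have := L0; lra].
have DPN : 0 <= D1 * P * N by rewrite mulr_ge0// mulr_ge0.
apply: Lqb_interp => //.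
- by rewrite mulr_ge0// mulr_ge0.
- by rewrite mulr_ge0// mulr_ge0.
- move=> x.
  have bx : cbm (fun z : R => cmul (cexpi (x * z)) (duh a b c m `[tau, t] (Ftrunc f X1) (Ftrunc g X2) t z)).
    by bmt.
  apply: le_trans (cint_le fT bx (M := D1 * P * N) _) _.
    by move=> z _; rewrite cnorm_expiM.
  rewrite LE /K; have s0 := sqrtr_ge0 (D3 * (4 * L)).
  rewrite -subr_ge0 (_ : _ - _ = D1 * P * N * Num.sqrt (D3 * (4 * L))); last by ring.
  by rewrite mulr_ge0.
- move=> X XX0; apply: le_trans (bD3 X _ XX0 bduh) _.
  apply: (@le_trans _ _ (D3 * ((D1 * P * N) ^+ 2 * (4 * L)))).
    rewrite ler_wpM2l// -LE -(rI_cst fT); apply: rI_le => //; first by bmt.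
      exact: bm_cst.
    by move=> z _; apply: lerXn2r; rewrite ?nnegrE//; exact: cnorm_ge0.
  have -> : (K * P * N) ^+ 2 = (D1 * P * N) ^+ 2 * (4 * L + Num.sqrt (D3 * (4 * L))) ^+ 2.
    by rewrite /K; ring.
  rewrite mulrCA ler_wpM2l ?sqr_ge0//.
  rewrite -[leLHS]sqr_sqrtr ?mulr_ge0//; apply: lerXn2r; rewrite ?nnegrE ?addr_ge0 ?sqrtr_ge0//.
  by rewrite lerDr.
Qed.

Lemma pair_bound : exists2 K : R, 0 <= K & forall (t mu1 mu2 X1 X2 : R) f g,
  1 <= t -> 0 <= mu1 -> 0 <= mu2 -> 0 <= X1 -> 0 <= X2 ->
  (mu1 < 1 -> X1 <= t `^ (mu1 + eta)) -> (mu2 < 1 -> X2 <= t `^ (mu2 + eta)) ->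
  cbm f -> cbm g ->
  Lqb q (sol L a b c m `[0, t] (Ftrunc f X1) (Ftrunc g X2) t)
    (K * t `^ pair_exp mu1 mu2 * mass X1 X2 f g).
Proof.
pose C0 := Num.max 1 (4 / kap1).
have C01 : 1 <= C0 by rewrite le_max lexx.
have C0k : 4 / kap1 <= C0 by rewrite le_max lexx orbT.
have [K1 K10 hd] := pair_head.
have [K2 K20 tl] := pair_tail C01 C0k.
clearbody C0.
have K1C : 0 <= K1 * C0 by rewrite mulr_ge0// (le_trans _ C01).
exists (4 * (K1 * C0 + K2)); first by rewrite mulr_ge0// addr_ge0.
move=> t mu1 mu2 X1 X2 f g t1 m1 m2 X10 X20 hX1 hX2 bf bg.
have t0 : 0 < t by exact: lt_le_trans t1.
have N0 := mass_ge0 X1 X2 f g.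
have P0 := powR_ge0 t (pair_exp mu1 mu2).
have up (k k' : R) : k <= k' -> k * t `^ pair_exp mu1 mu2 * mass X1 X2 f g
    <= k' * t `^ pair_exp mu1 mu2 * mass X1 X2 f g.
  by move=> kk; rewrite ler_wpM2r// ler_wpM2r.
have pos (k : R) : 0 <= k -> 0 <= k * t `^ pair_exp mu1 mu2 * mass X1 X2 f g.
  by move=> k0'; rewrite mulr_ge0// mulr_ge0.
have [tC|Ct] := leP t (C0 * t `^ (Num.max mu1 mu2 + 2 * eta)).
  apply: (@Lqb_le _ q _ (K1 * C0 * t `^ pair_exp mu1 mu2 * mass X1 X2 f g)) => //.
  - by apply: up; rewrite mulrDr -[leLHS]mul1r -[leLHS]addr0 lerD ?mulr_ge0// ler_wpM2r// ler1n.
  - exact: pos.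
  apply: (hd t t C0) => //; first exact: ltW.
  (* When [pair_theta] is capped at [1], the requirement is just [t <= C0 t]. *)
  rewrite /pair_theta; case: (leP 1 (Num.max mu1 mu2 + 2 * eta)) => h; last exact: tC.
  by rewrite (powRr1 (ltW t0)) ler_peMl// ltW.
set tau := C0 * _ in Ct.
have tau0 : 0 <= tau by rewrite mulr_ge0 ?powR_ge0// (le_trans _ C01).
have b1 := cbm_Ftrunc X1 bf; have b2 := cbm_Ftrunc X2 bg.
have E : sol L a b c m `[0, t] (Ftrunc f X1) (Ftrunc g X2) t = _ :=
  funext (fun x => sol_split L0 sa sb sc sm x tau0 (ltW Ct) b1 b2).
rewrite E.
rewrite -!(mulrA 4); apply: Lqb_add => //.
- exact: (cbm_sol L0' sa sb sc sm t (finm_itv 0 tau) b1 b2).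
- exact: (cbm_sol L0' sa sb sc sm t (finm_itv tau t) b1 b2).
- by apply: pos; rewrite addr_ge0.
- apply: (@Lqb_le _ q _ (K1 * C0 * t `^ pair_exp mu1 mu2 * mass X1 X2 f g)) => //.
  + by apply: up; rewrite lerDl.
  + exact: pos.
  apply: (hd t tau C0) => //; first exact: ltW.
  rewrite /pair_theta /tau; case: (leP 1 (Num.max mu1 mu2 + 2 * eta)) => h; last by [].
  apply: (le_trans (ltW Ct)); by rewrite (powRr1 (ltW t0)) ler_peMl// ltW.
- apply: (@Lqb_le _ q _ (K2 * t `^ pair_exp mu1 mu2 * mass X1 X2 f g)) => //.
  + by apply: up; rewrite lerDr.
  + exact: pos.
  exact: tl.
Qed.

End PairBound.

(** * Optimisation of the exponents *)

Section Exponents.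
Context (R : realType).
(** A certificate for a linear programme: each constraint is multiplied by a nonnegative factor, and
    the right side minus the left is [h1 + h2 + h3 + h4 + 3 h5]. At [eta = 0] equality holds for
    [th = M = 1] and [ga = k = 1/2]. *)
Lemma exponent_small_weight (p sg eta th ga M k : R) : 0 <= p -> p <= 2^-1 -> 0 <= eta -> th <= 1 ->
  th <= M + 2 * eta -> ga <= th / 2 -> ga <= k + eta -> 0 <= k -> 0 <= sg -> sg <= p ->
  th * (1 - p) - 2^-1 + p + p * ga - (M + k) * sg <= p / 2 + 2^-1 - 3 / 2 * sg + 3 * eta.
Proof.
move=> p0 p1 eta0 th1 thM gath gak k0 s0 sp.
have h1 : 0 <= (M + 2 * eta - th) * sg by rewrite mulr_ge0// subr_ge0.
have h2 : 0 <= (k + eta - ga) * sg by rewrite mulr_ge0// subr_ge0.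
have h3 : 0 <= (th / 2 - ga) * (p - sg) by rewrite mulr_ge0// subr_ge0.
have h4 : 0 <= (1 - th) * (1 - p / 2 - 3 / 2 * sg).
  by rewrite mulr_ge0 ?subr_ge0//; move: p1 sp; clear; lra.
have h5 : 0 <= eta * (1 - sg) by rewrite mulr_ge0//; move: p1 sp; clear; lra.
move: h1 h2 h3 h4 h5; clear; lra.
Qed.

(** Here the right side minus the left is exactly [h1 + h2 + h3 + h4 + h5]; at [eta = 0] equality
    holds for [th = M = 1] and [ga = k = 0]. *)
Lemma exponent_large_weight (p sg eta th ga M k : R) : 0 <= p -> p <= 2^-1 -> 0 <= eta -> th <= 1 ->
  th <= M + 2 * eta -> ga <= th / 2 -> ga <= k + eta -> 0 <= k -> p <= sg -> sg <= 1 - p ->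
  th * (1 - p) - 2^-1 + p + p * ga - (M + k) * sg <= 2^-1 - sg + 3 * eta.
Proof.
move=> p0 p1 eta0 th1 thM gath gak k0 ps sp.
have s0 : 0 <= sg by exact: le_trans ps.
have h1 : 0 <= (M + 2 * eta - th) * sg by rewrite mulr_ge0// subr_ge0.
have h2 : 0 <= p * (k + eta - ga) by rewrite mulr_ge0// subr_ge0.
have h3 : 0 <= k * (sg - p) by rewrite mulr_ge0// subr_ge0.
have h4 : 0 <= (1 - th) * (1 - p - sg).
  by rewrite mulr_ge0 ?subr_ge0//; move: sp; clear; lra.
have h5 : 0 <= eta * (3 - p - 2 * sg) by rewrite mulr_ge0//; move: p1 p0 sp; clear; lra.
move: h1 h2 h3 h4 h5; clear; lra.
Qed.

End Exponents.

(** * Decomposition of the data and summation over scales *)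

Section Telescope.
Context (R : realType).
Local Notation C := (R * R)%type.

(** The cutoffs are summed by telescoping, each addition costing a factor [4]; only the number of
    pieces enters the constant. *)
Lemma Lqb_telescope (q : \bar R) (Phi : (R -> C) -> R -> C) (A : R) (ch : nat -> R -> R) f n :
  (2%:E <= q)%E -> 0 <= A -> cbm f -> (forall i, bm (ch i)) -> (forall x, ch 0%N x = 0) ->
  (forall h k, cbm h -> cbm k -> Phi (fun x => h x + k x) = fun x => Phi h x + Phi k x) ->
  (forall h, cbm h -> cbm (Phi h)) ->
  (forall i, (i <= n)%N -> Lqb q (Phi (fun x => cmul (ch i.+1 x - ch i x, 0) (f x))) A) ->
  Lqb q (Phi (fun x => cmul (ch n.+1 x, 0) (f x))) (4 ^+ n * A).
Proof.
move=> q2 A0 bf bch ch0 addPhi bPhi.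
have bpc i : cbm (fun x => cmul (ch i.+1 x - ch i x, 0) (f x)).
  by have b1 := bch i; have b2 := bch i.+1; bmt.
have bp i : cbm (fun x => cmul (ch i x, 0) (f x)) by have b1 := bch i; bmt.
elim: n => [|n ih] hA.
  rewrite mul1r (_ : (fun x => _) = fun x => cmul (ch 1%N x - ch 0%N x, 0) (f x)); first exact: hA.
  by apply/funext => x; rewrite ch0 subr0.
rewrite (_ : (fun x => _) = fun x => cmul (ch n.+1 x, 0) (f x) +
    cmul (ch n.+2 x - ch n.+1 x, 0) (f x)); last first.
  by apply/funext => x; cring.
have A1 : 0 <= 4 ^+ n * A by rewrite mulr_ge0// exprn_ge0.
rewrite (addPhi _ _ (bp _) (bpc _)) exprS -mulrA; apply: Lqb_add => //.
- exact: bPhi.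
- exact: bPhi.
- by apply: ih => i hi; apply: hA; exact: leqW.
- by apply: Lqb_le (hA n.+1 (leqnn _)) => //; rewrite ler_peMl// exprn_ege1// ler1n.
Qed.

End Telescope.

Section Cutoffs.
Context (R : realType).
Local Notation C := (R * R)%type.
Variables (N : nat) (rho : nat -> R).

(** Cutoff [0] is zero and cutoff [N + 1] is one, so the differences of index [0] to [N] add up to
    one: difference [0] is the central ball, those in between are annuli, and difference [N] is
    unbounded. *)
Definition cutoff (i : nat) (x : R) : R :=
  if i is j.+1 then if (j < N)%N then \1_(`[- rho j.+1, rho j.+1]%classic) x else 1 else 0.

Lemma bm_cutoff i : bm (cutoff i).
Proof.
case: i => [|i]; first exact: bm_cst.
rewrite /cutoff; case: (i < N)%N; last exact: bm_cst.
split; first exact: measurable_indic (measurable_itv _).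
by exists 1 => x; rewrite indicE; case: (_ \in _); rewrite ?normr1 ?normr0.
Qed.

Lemma indic_sym (r x : R) : \1_(`[- r, r]%classic) x = (`|x| <= r)%R%:R :> R.
Proof. by rewrite indicE; congr (_%:R); rewrite mem_setE in_itv /= ler_norml. Qed.

Hypothesis rho_mono : forall i, rho i <= rho i.+1.

Lemma cutoff_diff i x : (i <= N)%N ->
  `|cutoff i.+1 x - cutoff i x| <= 1 /\
  (cutoff i.+1 x - cutoff i x != 0 ->
    ((i < N)%N -> `|x| <= rho i.+1) /\ ((0 < i)%N -> rho i <= `|x|)).
Proof.
case: i => [_|i iN]; rewrite /cutoff ?indic_sym.
  rewrite subr0; case: ifP => // NN; last by rewrite normr1.
  by case: (leP `|x| (rho 1%N)) => hx; rewrite ?normr1 ?normr0 ?eqxx.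
rewrite iN; case: ifP => NN.
  have := rho_mono i.+1; case: (leP `|x| (rho i.+2)) => h2; case: (leP `|x| (rho i.+1)) => h1 h.
  - by rewrite subrr normr0 eqxx.
  - by rewrite subr0 normr1; split => // _; split => // _; exact: ltW.
  - by move: (lt_le_trans h2 h1); rewrite ltNge h.
  - by rewrite subrr normr0 eqxx.
case: (leP `|x| (rho i.+1)) => h1; first by rewrite subrr normr0 eqxx.
by rewrite subr0 normr1; split => // _; split => // _; exact: ltW.
Qed.

End Cutoffs.

Section WeightedBound.
Context (R : realType).
Local Notation C := (R * R)%type.

(* [W] bounds the weighted norm of [f], tested against the functions it dominates. *)
Definition wbound (sg : R) (f : R -> C) (W : R) := forall (X : R) (h : R -> C), cbm h ->
  (forall x, cnorm (h x) <= (1 + x ^+ 2) `^ (sg / 2) * cnorm (f x)) ->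
  n2 `[- X, X] h <= W ^+ 2.

(** On the support of [ch] the weight is at least [r^sg]. *)
Lemma wbound_piece (sg W r Y : R) (f : R -> C) (ch : R -> R) : 0 <= sg -> 0 <= W -> 0 < r -> wbound sg f W ->
  cbm f -> bm ch -> (forall x, `|ch x| <= 1) -> (forall x, ch x != 0 -> r <= Num.sqrt (1 + x ^+ 2)) ->
  n2 `[- Y, Y] (fun x => cmul (ch x, 0) (f x)) <= (r `^ (- sg) * W) ^+ 2.
Proof.
move=> s0 W0 r0 hW bf bch ch1 hch.
have bh : cbm (fun x => cmul (ch x, 0) (f x)) by bmt.
have rs : 0 < r `^ sg by rewrite powR_gt0.
rewrite powRN mulrC expr_div_n ler_pdivlMr ?exprn_gt0// mulrC.
have -> : r `^ sg ^+ 2 = cnorm (r `^ sg, 0) ^+ 2 by rewrite cnorm_real ger0_norm// ltW.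
rewrite -(n2Z _ (finm_itv _ _) bh); apply: hW; first by bmt.
move=> x; rewrite !cnormM !cnorm_real mulrA ler_wpM2r ?cnorm_ge0//.
rewrite (ger0_norm (ltW rs)).
have [->|chx] := eqVneq (ch x) 0; first by rewrite normr0 mulr0 powR_ge0.
apply: (@le_trans _ _ (r `^ sg)); first by rewrite ler_piMr// ltW.
have x0 : 0 <= 1 + x ^+ 2 by rewrite addr_ge0// sqr_ge0.
rewrite mulrC powRrM powR12_sqrt//.
by apply: ge0_ler_powR; rewrite ?nnegrE ?sqrtr_ge0 ?(ltW r0)//; exact: hch.
Qed.

End WeightedBound.

Section Core.
Context (R : realType) (L kap kap1 : R) (a b c : R -> R) (m : R * R -> R * R).
Local Notation mu := (@lebesgue_measure R).
Local Notation C := (R * R)%type.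
Hypothesis L0 : 0 < L.
Hypothesis sa : smooth1 a.
Hypothesis sb : smooth1 b.
Hypothesis sc : smooth1 c.
Hypothesis k0 : 0 < kap.
Hypothesis ka : forall x, kap <= `|derive1n 2 a x|.
Hypothesis kb : forall x, kap <= `|derive1n 2 b x|.
Hypothesis kc : forall x, kap <= `|derive1n 2 c x|.
Hypothesis sm : symb L m.
Hypothesis k10 : 0 < kap1.
Hypothesis sub : forall p, supp m p -> `|p.1| <= L /\ `|p.2| <= L.
Hypothesis sep : forall p, supp m p ->
  kap1 <= `|derive1n 1 b p.1 - derive1n 1 c p.2|.
Local Notation IT := (`[- (2 * L), 2 * L]%classic).
Implicit Types f g : R -> C.
Variables (q : \bar R) (eta : R).
Hypothesis q2 : (2%:E <= q)%E.
Hypothesis eta0 : 0 < eta.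
Let p := inv_exp q.

Let L0' : 0 <= L. Proof. exact: ltW. Qed.
Let T0 : 0 < 2 * L. Proof. by rewrite mulr_gt0. Qed.



Lemma core_estimate (sg Tgt : R) : 0 <= sg ->
  (forall mu1 mu2, 0 <= mu1 -> 0 <= mu2 -> pair_exp q eta mu1 mu2 - (mu1 + mu2) * sg <= Tgt) ->
  exists2 K : R, 0 <= K & forall (t X Wf Wg : R) f g, 1 <= t -> 0 <= X -> 0 <= Wf -> 0 <= Wg ->
    cbm f -> cbm g -> wbound sg f Wf -> wbound sg g Wg ->
    Lqb q (sol L a b c m `[0, t] (Ftrunc f X) (Ftrunc g X) t) (K * t `^ Tgt * (Wf * Wg)).
Proof.
move=> s0 hT.
have [K K0 bK] := pair_bound L0 sa sb sc k0 ka kb kc sm k10 sub sep q2 eta0.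
(* [N] depends on [eta] alone, so the number of pieces and the factors [4 ^+ N] do not depend on
   [t]. The condition [N eta >= 1] makes the last radius at least [t]. *)
have [N hN] : exists N : nat, 1 <= N%:R * eta.
  by exists (Num.trunc (1 / eta)).+1; rewrite -ler_pdivrMr//; apply: ltW; exact: truncnS_gt.
exists (4 ^+ N * (4 ^+ N * K)); first by rewrite !mulr_ge0// exprn_ge0.
move=> t X Wf Wg f g t1 X0 Wf0 Wg0 bf bg hf hg.
have t0 : 0 < t by exact: lt_le_trans t1.
pose rho (i : nat) := t `^ (i%:R * eta).
have rho_mono i : rho i <= rho i.+1.
  by rewrite powR_mono// ler_wpM2r ?(ltW eta0)// ler_nat.
have rho1 i : 1 <= rho i.
  by rewrite -[leLHS](powRr0 t) powR_mono// mulr_ge0// ltW.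
pose ch := cutoff N rho.
have bch i : bm (ch i) by exact: bm_cutoff.
pose pc i (h : R -> C) (x : R) := cmul (ch i.+1 x - ch i x, 0) (h x).
have bpc i h : cbm h -> cbm (pc i h).
  by move=> bh; have b1 := bch i; have b2 := bch i.+1; rewrite /pc; bmt.
(* The outer radius of piece [i] inside the truncation [[-X, X]]; the last piece is limited by [X]
   only. *)
pose Y (i : nat) := if (i < N)%N then Num.min X (rho i.+1) else X.
have Y0 i : 0 <= Y i.
  by rewrite /Y; case: ifP => // _; rewrite le_min X0 (le_trans _ (rho1 _)).
have FY i h : (i <= N)%N -> Ftrunc (pc i h) X = Ftrunc (pc i h) (Y i).
  move=> iN; rewrite /Y; case: ifP => // iN'; case: (leP X (rho i.+1)) => // hX.
  apply: Ftrunc_sub; first exact: ltW.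
  move=> x hx; have [_] := cutoff_diff rho_mono x iN; rewrite -/ch => hd.
  have [d0|/hd[/(_ iN')]] := eqVneq (ch i.+1 x - ch i x) 0; first by rewrite /pc d0 cmul0.
  by rewrite leNgt hx.
have PY i h W : (i <= N)%N -> 0 <= W -> cbm h -> wbound sg h W ->
    n2 `[- Y i, Y i] (pc i h) <= (rho i `^ (- sg) * W) ^+ 2.
  move=> iN W0 bh hW; apply: wbound_piece => //.
  - exact: lt_le_trans (rho1 i).
  - by have b1 := bch i; have b2 := bch i.+1; bmt.
  - by move=> x; have [] := cutoff_diff rho_mono x iN.
  - move=> x hx; have [_ /(_ hx)[_ hi]] := cutoff_diff rho_mono x iN.
    (* The central piece has no inner radius, but [rho 0 = 1] and the weight is at least [1]
       everywhere. *)
    case: (posnP i) => [->|/hi hr].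
      by rewrite /rho mul0r powRr0 -[leLHS]sqrtr1 ler_wsqrtr// lerDl sqr_ge0.
    apply: (le_trans hr); rewrite -sqrtr_sqr ler_wsqrtr//.
    by rewrite lerDr.
have FP i h : cbm h -> cbm (Ftrunc (pc i h) X) by move=> bh; exact: (cbm_Ftrunc X (bpc i h bh)).
have A0 : 0 <= K * t `^ Tgt * (Wf * Wg) by rewrite mulr_ge0// mulr_ge0// powR_ge0.
have pair i j : (i <= N)%N -> (j <= N)%N ->
    Lqb q (sol L a b c m `[0, t] (Ftrunc (pc i f) X) (Ftrunc (pc j g) X) t) (K * t `^ Tgt * (Wf * Wg)).
  move=> iN jN; rewrite FY// FY//.
  have mu0 (k : nat) : 0 <= k%:R * eta by rewrite mulr_ge0// ltW.
  (* An exponent [k eta < 1] excludes [k = N], so the piece has the outer radius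
     [rho k.+1 = t^(k eta + eta)]. *)
  have hY (k : nat) : (k <= N)%N -> k%:R * eta < 1 -> Y k <= t `^ (k%:R * eta + eta).
    move=> kN k1; have kN' : (k < N)%N.
      by rewrite ltn_neqAle kN andbT; apply: contraTneq k1 => ->; rewrite -leNgt.
    rewrite /Y kN' ge_min; apply/orP; right.
    by rewrite /rho -(natr1 k) mulrDl mul1r.
  apply: Lqb_le (bK t (i%:R * eta) (j%:R * eta) (Y i) (Y j) _ _ t1 (mu0 i) (mu0 j)
    (Y0 i) (Y0 j) (hY i iN) (hY j jN) (bpc i f bf) (bpc j g bg)) => //; last first.
    by rewrite mulr_ge0 ?mass_ge0// mulr_ge0// powR_ge0.
  set e := pair_exp _ _ _ _.
  have m1 : mass (Y i) (Y j) (pc i f) (pc j g) <= t `^ (- ((i%:R * eta + j%:R * eta) * sg)) * (Wf * Wg).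
    rewrite -[leRHS]ger0_norm; last by rewrite mulr_ge0 ?powR_ge0// mulr_ge0.
    rewrite -sqrtr_sqr ler_wsqrtr//.
    have -> : (t `^ (- ((i%:R * eta + j%:R * eta) * sg)) * (Wf * Wg)) ^+ 2 =
        (rho i `^ (- sg) * Wf) ^+ 2 * (rho j `^ (- sg) * Wg) ^+ 2.
      rewrite /rho -!powRrM mulrDl opprD -!mulrN powRDt//; ring.
    by apply: ler_pM; rewrite ?n2_ge0//; exact: PY.
  have P0 : 0 <= K * t `^ e by rewrite mulr_ge0// powR_ge0.
  apply: le_trans (ler_wpM2l P0 m1) _.
  rewrite [leLHS]mulrA ler_wpM2r ?mulr_ge0// -[leLHS]mulrA ler_wpM2l// -powRDt//.
  by rewrite powR_mono//; exact: hT.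
have chN h : (fun x => cmul (ch N.+1 x, 0) (h x)) = h.
  by apply/funext => x; rewrite /ch /cutoff ltnn cmul1.
have fD := finm_itv 0 t.
have inner i : (i <= N)%N -> Lqb q (sol L a b c m `[0, t] (Ftrunc (pc i f) X) (Ftrunc g X) t)
    (4 ^+ N * (K * t `^ Tgt * (Wf * Wg))).
  move=> iN; rewrite -{1}(chN g).
  apply: (@Lqb_telescope R q (fun h => sol L a b c m `[0, t] (Ftrunc (pc i f) X) (Ftrunc h X) t)) => //.
  - move=> h k bh bk; apply/funext => x; rewrite FtruncD//.
    have b1 := FP i f bf; have b2 := cbm_Ftrunc X bh; have b3 := cbm_Ftrunc X bk.
    have b4 : cbm (fun xi => Ftrunc h X xi + Ftrunc k X xi) by exact: cbmD.
    (* Additivity in the second datum is additivity in the first, after the exchange of the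
       inputs. *)
    rewrite (sol_swap a L0 sb sc sm _ _ _ b1 b4) (sol_swap a L0 sb sc sm _ _ _ b1 b2) (sol_swap a L0 sb sc sm _ _ _ b1 b3).
    exact: (solDl L0 sa sc sb (symb_swap sm) _ _ fD b2 b3 b1).
  - move=> h bh; exact: (cbm_sol L0' sa sb sc sm t fD (FP i f bf) (cbm_Ftrunc X bh)).
  - by move=> j jN; exact: pair.
rewrite -{1}(chN f) -!mulrA (mulrA K).
apply: (@Lqb_telescope R q (fun h => sol L a b c m `[0, t] (Ftrunc h X) (Ftrunc g X) t)) => //.
- by rewrite mulr_ge0// exprn_ge0.
- move=> h k bh bk; apply/funext => x; rewrite FtruncD//.
  exact: (solDl L0 sa sb sc sm _ _ fD (cbm_Ftrunc X bh) (cbm_Ftrunc X bk) (cbm_Ftrunc X bg)).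
- move=> h bh; exact: (cbm_sol L0' sa sb sc sm t fD (cbm_Ftrunc X bh) (cbm_Ftrunc X bg)).
Qed.

End Core.

(** * Passage to general data *)

Section Dominated.
Context (R : realType).
Local Notation mu := (@lebesgue_measure R).
Local Notation C := (R * R)%type.
Implicit Types (D : set R) (phi psi : R -> R) (h k : R -> C) (A B M : R).

(** The integral is taken in the extended reals, so the bound includes finiteness. A bound on the
    real-valued integral would not, as [fine] sends [+oo] to [0]. *)
Definition ibd D phi B := [/\ measurable_fun setT phi, forall x, 0 <= phi x
  & (\int[mu]_(x in D) (phi x)%:E <= B%:E)%E].

Lemma ibd_le D D' phi psi B : measurable D -> measurable D' -> D `<=` D' ->
  measurable_fun setT phi -> (forall x, 0 <= phi x) -> (forall x, D x -> phi x <= psi x) ->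
  ibd D' psi B -> ibd D phi B.
Proof.
move=> mD mD' DD' mphi phi0 le [mpsi psi0 hB]; split => //; apply: le_trans hB.
apply: (@le_trans _ _ (\int[mu]_(x in D) (psi x)%:E)%E).
  apply: ge0_le_integral => //.
  - by move=> x _; rewrite lee_fin.
  - by apply/measurable_EFinP; exact: measurable_funTS.
  - by apply/measurable_EFinP; exact: measurable_funTS.
apply: ge0_subset_integral => //.
- by apply/measurable_EFinP; exact: measurable_funTS.
- by move=> x _; rewrite lee_fin.
Qed.

Lemma ibdD D phi psi A B : measurable D -> ibd D phi A -> ibd D psi B ->
  ibd D (fun x => phi x + psi x) (A + B).
Proof.
move=> mD [m1 p1 h1] [m2 p2 h2]; split; first exact: measurable_funD.
  by move=> x; exact: addr_ge0.
under eq_integral do rewrite EFinD.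
rewrite ge0_integralD//; first by rewrite EFinD leeD.
- by move=> x _; rewrite lee_fin.
- by apply/measurable_EFinP; exact: measurable_funTS.
- by move=> x _; rewrite lee_fin.
- by apply/measurable_EFinP; exact: measurable_funTS.
Qed.

Lemma ibdZ D phi (k : R) B : measurable D -> 0 <= k -> ibd D phi B -> ibd D (fun x => k * phi x) (k * B).
Proof.
move=> mD k0 [m1 p1 h1]; split; first by apply: measurable_funM => //; exact: measurable_cst.
  by move=> x; exact: mulr_ge0.
under eq_integral do rewrite EFinM.
rewrite ge0_integralZl//.
- by rewrite EFinM lee_wpmul2l// lee_fin.
- by apply/measurable_EFinP; exact: measurable_funTS.
- by move=> x _; rewrite lee_fin.
Qed.

Lemma ibd_bm D phi B : finm D -> bm phi -> (forall x, 0 <= phi x) ->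
  \int[mu]_(x in D) phi x <= B <-> ibd D phi B.
Proof.
move=> fD bphi phi0.
have fin : (\int[mu]_(x in D) (phi x)%:E)%E \is a fin_num.
  by apply: integrable_fin_num; [case: fD|exact: bm_integrable].
split => [hB|[_ _]]; last by rewrite -(fineK fin) lee_fin.
by split; [case: bphi| |rewrite -(fineK fin) lee_fin].
Qed.

Lemma cmeas_norm h : cmeasurable h -> measurable_fun setT (fun x => cnorm (h x)).
Proof.
move=> [m1 m2]; apply: (measurableT_comp (@continuous_measurable_fun _ _ (@sqrt_continuous R))).
by apply: measurable_funD; exact: measurable_funX.
Qed.

Lemma cmeas_norm2 h : cmeasurable h -> measurable_fun setT (fun x => cnorm (h x) ^+ 2).
Proof. by move=> mh; apply: measurable_funX; exact: cmeas_norm. Qed.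

Lemma cmeasD h k : cmeasurable h -> cmeasurable k -> cmeasurable (fun x => h x + k x).
Proof. by move=> [m1 m2] [k1 k2]; split; exact: measurable_funD. Qed.

Lemma cmeasB h k : cmeasurable h -> cmeasurable k -> cmeasurable (fun x => h x - k x).
Proof. by move=> [m1 m2] [k1 k2]; split; exact: measurable_funB. Qed.

Lemma cmeasM h k : cmeasurable h -> cmeasurable k -> cmeasurable (fun x => cmul (h x) (k x)).
Proof.
move=> [m1 m2] [k1 k2]; split => /=.
  by apply: measurable_funB; exact: measurable_funM.
by apply: measurable_funD; exact: measurable_funM.
Qed.

Lemma cbm_meas h : cbm h -> cmeasurable h.
Proof. by move=> [[m1 _] [m2 _]]. Qed.

Definition cintg D h := mu.-integrable D (EFin \o (fun x => (h x).1)) /\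
  mu.-integrable D (EFin \o (fun x => (h x).2)).

Lemma cint_dom D h phi B : measurable D -> cmeasurable h -> ibd D phi B ->
  (forall x, D x -> cnorm (h x) <= phi x) -> cintg D h /\ cnorm (cint D h) <= 2 * B.
Proof.
move=> mD [m1 m2] [mphi phi0 hB] hphi.
have iphi : mu.-integrable D (EFin \o phi).
  apply/integrableP; split; first by apply/measurable_EFinP; exact: measurable_funTS.
  apply: (@le_lt_trans _ _ B%:E); last exact: ltry.
  apply: le_trans hB; rewrite le_eqVlt; apply/orP; left; apply/eqP.
  by apply: eq_integral => x _; rewrite /= ger0_norm.
have one (u : R -> R) : measurable_fun setT u -> (forall x, D x -> `|u x| <= phi x) ->
    mu.-integrable D (EFin \o u) /\ `|\int[mu]_(x in D) u x| <= B.
  move=> mu' hu.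
  have iu : mu.-integrable D (EFin \o u).
    apply: le_integrable iphi => //; first by apply/measurable_EFinP; exact: measurable_funTS.
    by move=> x Dx; rewrite /= lee_fin (ger0_norm (phi0 x)); exact: hu.
  split => //; apply: (le_trans (@le_normr_Rintegral _ _ _ mu D u mD iu)).
  have inu : mu.-integrable D (EFin \o (fun x => `|u x|)) by exact: (integrable_norm iu).
  apply: (@le_trans _ _ (\int[mu]_(x in D) phi x)); first exact: le_Rintegral.
  by rewrite -lee_fin /Rintegral fineK//; exact: integrable_fin_num.
have [i1 b1] := one _ m1 (fun x Dx => le_trans (re_le_cnorm _) (hphi x Dx)).
have [i2 b2] := one _ m2 (fun x Dx => le_trans (im_le_cnorm _) (hphi x Dx)).
split; first by split.
by apply: le_trans (cnorm_le _) _; rewrite /= mulr2n mulrDl !mul1r; exact: lerD.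
Qed.

Lemma cintB_g D h k : measurable D -> cintg D h -> cintg D k ->
  cint D (fun x => h x - k x) = cint D h - cint D k.
Proof.
by move=> mD [h1 h2] [k1 k2]; rewrite /cint; congr (_, _); rewrite -RintegralB.
Qed.

(* Products are dominated by AM-GM, which replaces the Cauchy-Schwarz inequality. *)
Lemma cint_prod D h k w A B M (e : R) : measurable D -> cmeasurable h -> cmeasurable k -> cmeasurable w ->
  ibd D (fun x => cnorm (h x) ^+ 2) A -> ibd D (fun x => cnorm (k x) ^+ 2) B ->
  0 <= M -> (forall x, D x -> cnorm (w x) <= M) -> 0 < e ->
  cintg D (fun x => cmul (cmul (h x) (k x)) (w x)) /\
  cnorm (cint D (fun x => cmul (cmul (h x) (k x)) (w x))) <= 2 * (M * (e * A + e^-1 * B)).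
Proof.
move=> mD mh mk mw hA hB M0 hw e0.
have e1 : 0 <= e^-1 by rewrite invr_ge0 ltW.
apply: (@cint_dom D _ (fun x => M * (e * cnorm (h x) ^+ 2 + e^-1 * cnorm (k x) ^+ 2))) => //.
- by apply: cmeasM => //; exact: cmeasM.
- apply: ibdZ => //; apply: ibdD => //; apply: ibdZ => //; exact: ltW.
move=> x Dx; rewrite !cnormM mulrC; apply: ler_pM; rewrite ?cnorm_ge0//.
  by rewrite mulr_ge0// cnorm_ge0.
  exact: hw.
set a := cnorm (h x); set b := cnorm (k x).
have a0 : 0 <= a by exact: cnorm_ge0.
have b0 : 0 <= b by exact: cnorm_ge0.
have : 0 <= e * (a - e^-1 * b) ^+ 2 by rewrite mulr_ge0 ?sqr_ge0// ltW.
have -> : e * (a - e^-1 * b) ^+ 2 = (e * a ^+ 2 + e^-1 * b ^+ 2) - 2 * (a * b).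
  by field; rewrite gt_eqF.
rewrite subr_ge0; apply: le_trans; rewrite ler_peMl ?mulr_ge0// ler1n//.
Qed.

End Dominated.

Section Limits.
Context (R : realType).
Local Notation C := (R * R)%type.

Lemma unif_limit_meas d (T : measurableType d) (g : T -> R) :
  (forall e : R, 0 < e -> exists2 k : T -> R, measurable_fun setT k & forall x, `|g x - k x| <= e) ->
  measurable_fun setT g.
Proof.
move=> H; have /choice[k kP] : forall n : nat, exists k : T -> R,
    measurable_fun setT k /\ forall x, `|g x - k x| <= n.+1%:R^-1.
  by move=> n; have [|k mk hk] := H n.+1%:R^-1; [rewrite invr_gt0|exists k].
apply: (@measurable_fun_cvg _ _ _ setT k) => [n|x _]; first by case: (kP n).
apply/cvgrPdist_le => e e0; near=> n; apply: le_trans (proj2 (kP n) x) _.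
rewrite invf_ple ?posrE ?ltr0n//.
apply: (@le_trans _ _ n%:R); last by rewrite ler_nat.
by near: n; exact: nbhs_infty_ger.
Unshelve. all: by end_near. Qed.

Lemma unif_limit_cmeas (g : R -> C) :
  (forall e : R, 0 < e -> exists2 k : R -> C, cmeasurable k & forall x, cnorm (g x - k x) <= e) ->
  cmeasurable g.
Proof.
move=> H; split; apply: unif_limit_meas => e /H[k [k1 k2] hk].
  by exists (fun x => (k x).1) => // x; apply: le_trans (re_le_cnorm (g x - k x)) (hk x).
by exists (fun x => (k x).2) => // x; apply: le_trans (im_le_cnorm (g x - k x)) (hk x).
Qed.

Lemma unif_limit_cbm d (T : measurableType d) (g : T -> C) :
  (forall e : R, 0 < e -> exists2 k : T -> C, cbm k & forall x, cnorm (g x - k x) <= e) -> cbm g.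
Proof.
move=> H; split; split.
- apply: unif_limit_meas => e /H[k [[k1 _] _] hk].
  by exists (fun x => (k x).1) => // x; apply: le_trans (re_le_cnorm (g x - k x)) (hk x).
- have [k [bk _] hk] := H 1 ltr01; have [M M0 hM] := bm_bound bk; exists (1 + M) => x.
  rewrite -(subrK (k x).1 (g x).1) (le_trans (ler_normD _ _))// lerD//.
  exact: le_trans (re_le_cnorm (g x - k x)) (hk x).
- apply: unif_limit_meas => e /H[k [_ [k1 _]] hk].
  by exists (fun x => (k x).2) => // x; apply: le_trans (im_le_cnorm (g x - k x)) (hk x).
- have [k [_ bk] hk] := H 1 ltr01; have [M M0 hM] := bm_bound bk; exists (1 + M) => x.
  rewrite -(subrK (k x).2 (g x).2) (le_trans (ler_normD _ _))// lerD//.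
  exact: le_trans (im_le_cnorm (g x - k x)) (hk x).
Qed.

End Limits.

Section Truncation.
Context (R : realType).
Local Notation mu := (@lebesgue_measure R).
Local Notation C := (R * R)%type.
Implicit Types (f fh : R -> C) (B k X : R).

Lemma Lnorm2_le (h : R -> R) (A : R) : 0 <= A -> (forall x, 0 <= h x) ->
  (Lnorm mu 2%:E (fun x => (h x)%:E) <= A%:E)%E ->
  (\int[mu]_(x in setT) (h x ^+ 2)%:E <= (A ^+ 2)%:E)%E.
Proof.
move=> A0 h0; rewrite unlock /Lnorm.
have -> : (\int[mu]_x `| (h x)%:E | `^ 2 = \int[mu]_(x in setT) (h x ^+ 2)%:E)%E.
  by apply: eq_integral => x _; rewrite abse_EFin poweR_EFin ger0_norm// powR_mulrn.
have : (0 <= \int[mu]_(x in setT) (h x ^+ 2)%:E)%E.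
  by apply: integral_ge0 => x _; rewrite lee_fin sqr_ge0.
case: (\int[mu]_(x in setT) _)%E => [r||]//=.
- rewrite !lee_fin => r0 h1; rewrite -[leLHS]sqr_sqrtr//.
  by apply: lerXn2r; rewrite ?nnegrE ?sqrtr_ge0// -powR12_sqrt.
- by rewrite invr_eq0 pnatr_eq0 /=.
Qed.

Definition trunc f (X k : R) (x : R) : C :=
  cmul (\1_(`[- X, X]%classic `&` [set x | cnorm (f x) <= k]) x, 0) (f x).

Lemma truncE f X k x : trunc f X k x = if (`|x| <= X) && (cnorm (f x) <= k) then f x else 0.
Proof.
rewrite /trunc indicE in_setI; have -> : (x \in `[- X, X]%classic) = (`|x| <= X).
  by rewrite mem_setE in_itv /= ler_norml.
have -> : (x \in [set x | cnorm (f x) <= k]) = (cnorm (f x) <= k).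
  by apply/idP/idP; rewrite inE.
by case: ifP => _; rewrite ?cmul1 ?cmul0.
Qed.

Lemma trunc_le f X k x : cnorm (trunc f X k x) <= cnorm (f x).
Proof. by rewrite truncE; case: ifP => // _; rewrite cnorm0 cnorm_ge0. Qed.

Lemma trunc_out f X k x : X < `|x| -> trunc f X k x = 0.
Proof. by move=> h; rewrite truncE leNgt h. Qed.

Lemma cbm_trunc f X k : cmeasurable f -> 0 <= k -> cbm (trunc f X k).
Proof.
move=> mf k0.
have mA : measurable [set x | cnorm (f x) <= k].
  have := cmeas_norm mf measurableT (measurable_itv `]-oo, k]); rewrite setTI.
  by congr measurable; apply/seteqP; split => x; rewrite /= in_itv.
have [m1 m2] : cmeasurable (trunc f X k).
  apply: cmeasM => //; split => /=; last exact: measurable_cst.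
  by apply: measurable_indic; apply: measurableI => //; exact: measurable_itv.
have hk x : cnorm (trunc f X k x) <= k.
  by rewrite truncE; case: ifP => [/andP[]//|_]; rewrite cnorm0.
split; split => //; exists k => x.
  exact: le_trans (re_le_cnorm _) (hk x).
exact: le_trans (im_le_cnorm _) (hk x).
Qed.

(** Where [|f| > k] one has [|f| <= |f|^2 / k]: removing the large values changes the transform by
    at most [B / k], uniformly in [xi]. *)
Lemma Ftrunc_trunc f B X k xi : cmeasurable f -> 0 <= X -> 0 < k ->
  ibd setT (fun x => cnorm (f x) ^+ 2) B ->
  cnorm (Ftrunc f X xi - Ftrunc (trunc f X k) X xi) <= B / k.
Proof.
move=> mf X0 k0 hB; rewrite !FtruncE.
have fX := finm_itv (- X) X; have mX : measurable `[- X, X]%classic by case: fX.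
have bt := cbm_trunc X mf (ltW k0).
pose e x := cexpi (- (x * xi)).
have be : cbm e by rewrite /e; bmt.
have hBX : ibd `[- X, X] (fun x => cnorm (f x) ^+ 2) B.
  apply: ibd_le hB => //; last by move=> x; exact: sqr_ge0.
  exact: cmeas_norm2.
(* On a bounded interval, square integrability gives integrability through [|f| <= 1 + |f|^2]. *)
have gi (h : R -> C) : cmeasurable h -> (forall x, cnorm (h x) <= cnorm (f x)) ->
    cintg `[- X, X] (fun x => cmul (e x) (h x)).
  move=> mh hle; apply: (proj1 (@cint_dom R _ _ (fun x => 1 + cnorm (f x) ^+ 2) _ mX _ _ _)).
  - by apply: cmeasM => //; exact: cbm_meas.
  - apply: ibdD => //; last exact: hBX.
    apply/(ibd_bm _ fX (bm_cst _ 1) (fun _ => ler01)); exact: lexx.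
  - move=> x _; rewrite cnorm_expiM; apply: le_trans (hle x) _.
    have := sqr_ge0 (cnorm (f x) - 2^-1); nra.
have -> : cmul ((2 * pi)^-1, 0) (cint `[- X, X] (fun x => cmul (e x) (f x))) -
   cmul ((2 * pi)^-1, 0) (cint `[- X, X] (fun x => cmul (e x) (trunc f X k x))) =
   cmul ((2 * pi)^-1, 0) (cint `[- X, X] (fun x => cmul (e x) (f x - trunc f X k x))).
  have g1 := gi f mf (fun x => lexx _).
  have g2 := gi _ (cbm_meas bt) (trunc_le f X k).
  have -> : cint `[- X, X] (fun x => cmul (e x) (f x - trunc f X k x)) =
     cint `[- X, X] (fun x => cmul (e x) (f x)) - cint `[- X, X] (fun x => cmul (e x) (trunc f X k x)).
    by rewrite -(cintB_g mX g1 g2); apply: eq_cint => x _; cring.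
  by cring.
have kV : 0 <= k^-1 by rewrite invr_ge0 ltW.
have dom x : `[- X, X]%classic x -> cnorm (cmul (e x) (f x - trunc f X k x)) <= k^-1 * cnorm (f x) ^+ 2.
  move=> /in_sym Xx; rewrite cnorm_expiM truncE Xx.
  case: (leP (cnorm (f x)) k) => fk /=.
    by rewrite subrr cnorm0 mulr_ge0// sqr_ge0.
  by rewrite subr0 mulrC ler_pdivlMr// expr2 ler_wpM2l ?cnorm_ge0// ltW.
have [_ h] := cint_dom mX (cmeasM (cbm_meas be) (cmeasB mf (cbm_meas bt))) (ibdZ mX kV hBX) dom.
rewrite cnormM cnorm_real ger0_norm; last by rewrite invr_ge0 mulr_ge0// ltW// pi_gt0.
have pi1 : (2 * pi)^-1 * 2 <= 1 :> R.
  have p2 := pi_ge2 R.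
  by rewrite ler_pdivrMl ?mulr_gt0 ?pi_gt0//; lra.
have hBk : 0 <= B / k.
  have [_ _ hb] := hB; rewrite divr_ge0// ?(ltW k0)// -lee_fin; apply: le_trans hb.
  by apply: integral_ge0 => x _; rewrite lee_fin sqr_ge0.
apply: (@le_trans _ _ ((2 * pi)^-1 * (2 * (k^-1 * B)))).
  rewrite ler_wpM2l ?invr_ge0 ?mulr_ge0 ?(ltW (pi_gt0 R))//; exact: h.
rewrite mulrA (mulrC k^-1); rewrite -[leRHS]mul1r; exact: ler_wpM2r.
Qed.

End Truncation.

Section LTwoApproximation.
Context (R : realType).
Local Notation mu := (@lebesgue_measure R).
Local Notation C := (R * R)%type.
Implicit Types (f fh : R -> C) (B k X : R) (D : set R).

Lemma ibd_ge0 D (phi : R -> R) B : ibd D phi B -> 0 <= B.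
Proof.
move=> [_ p0 hB]; rewrite -lee_fin; apply: le_trans hB.
by apply: integral_ge0 => x _; rewrite lee_fin.
Qed.

Lemma ibd_mono D (phi : R -> R) B B' : B <= B' -> ibd D phi B -> ibd D phi B'.
Proof. by move=> BB [m p h]; split => //; apply: le_trans h _; rewrite lee_fin. Qed.

Lemma cnorm_sq_add (z w : C) : cnorm (z + w) ^+ 2 <= 2 * cnorm z ^+ 2 + 2 * cnorm w ^+ 2.
Proof.
have h := cnormD z w; have h0 := cnorm_ge0 (z + w).
apply: (@le_trans _ _ ((cnorm z + cnorm w) ^+ 2)).
  by apply: lerXn2r; rewrite ?nnegrE// addr_ge0// cnorm_ge0.
by rewrite -subr_ge0 (_ : _ - _ = (cnorm z - cnorm w) ^+ 2) ?sqr_ge0//; ring.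
Qed.

Lemma ibd_sq_add D (h k : R -> C) A B : measurable D -> cmeasurable h -> cmeasurable k ->
  ibd D (fun x => cnorm (h x) ^+ 2) A -> ibd D (fun x => cnorm (k x) ^+ 2) B ->
  ibd D (fun x => cnorm (h x + k x) ^+ 2) (2 * A + 2 * B).
Proof.
move=> mD mh mk hA hB.
apply: (ibd_le mD mD _ _ _ _ (ibdD mD (ibdZ mD _ hA) (ibdZ mD _ hB))) => //.
- by apply: cmeas_norm2; exact: cmeasD.
- by move=> x; exact: sqr_ge0.
- by move=> x _; exact: cnorm_sq_add.
Qed.

Lemma fourier_approx f fh B D (e : R) : cmeasurable f -> ibd setT (fun x => cnorm (f x) ^+ 2) B ->
  is_L2_fourier f fh -> finm D -> 0 < e ->
  exists (f' : R -> C) (n : nat), [/\ cbm f', forall x, cnorm (f' x) <= cnorm (f x),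
    forall x, n%:R < `|x| -> f' x = 0 &
    ibd D (fun xi => cnorm (fh xi - Ftrunc f' n%:R xi) ^+ 2) e].
Proof.
move=> mf hB [mfh cvg] fD e0; have mD : measurable D by case: fD.
have B0 := ibd_ge0 hB.
(* Two errors of [e / 4], each doubled by [ibd_sq_add], add up to [e]. *)
pose d := Num.sqrt (e / 4).
have d0 : 0 < d by rewrite sqrtr_gt0 divr_gt0.
have [n hn] : exists n : nat, (Lnorm mu 2%:E (fun xi =>
      (cnorm ((Ftrunc f n%:R xi).1 - (fh xi).1, (Ftrunc f n%:R xi).2 - (fh xi).2))%:E) < d%:E)%E.
  have h : nbhs (0%E : \bar R) [set y : \bar R | (y < d%:E)%E].
    by apply: open_nbhs_nbhs; split; [exact: open_ereal_lt_ereal|rewrite /= lte_fin].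
  have [N _ hN] := cvg _ h.
  by exists N; exact: (hN N (leqnn N)).
(* The level [(B + 1) / eta] makes the transforms differ by at most [eta]; the two bounds on [eta]
   then give [eta^2 mu(D) <= e / 4]. *)
exists (trunc f n%:R ((B + 1) / Num.min 1 (e / (4 * (fine (mu D) + 1))))), n.
set eta := Num.min _ _.
have m0 : 0 <= fine (mu D) by apply: fine_ge0.
have m1 : 0 < 4 * (fine (mu D) + 1) by rewrite mulr_gt0// ltr_wpDl.
have eta0 : 0 < eta by rewrite lt_min ltr01 divr_gt0.
set k := (B + 1) / eta.
have k0 : 0 < k by rewrite divr_gt0// ltr_wpDl.
have bt := cbm_trunc n%:R mf (ltW k0).
split.
- exact: bt.
- exact: trunc_le.
- by move=> x; exact: trunc_out.
have close xi : cnorm (Ftrunc f n%:R xi - Ftrunc (trunc f n%:R k) n%:R xi) <= eta.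
  apply: le_trans (Ftrunc_trunc xi mf (ler0n _ n) k0 hB) _.
  by rewrite /k invf_div mulrA ler_pdivrMr ?ltr_wpDl// mulrC ler_wpM2l ?(ltW eta0)// lerDl.
(* For unbounded [f] the truncated transform is measurable as a uniform limit of transforms of
   bounded functions. *)
have mF : cmeasurable (Ftrunc f n%:R).
  apply: unif_limit_cmeas => r r0; have k1 : 0 < (B + 1) / r by rewrite divr_gt0// ltr_wpDl.
  exists (Ftrunc (trunc f n%:R ((B + 1) / r)) n%:R).
    by apply: cbm_meas; apply: cbm_Ftrunc; exact: cbm_trunc mf (ltW k1).
  move=> xi; apply: le_trans (Ftrunc_trunc xi mf (ler0n _ n) k1 hB) _.
  by rewrite invf_div mulrA ler_pdivrMr ?ltr_wpDl// mulrC ler_wpM2l ?(ltW r0)// lerDl.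
have mG := cbm_meas (cbm_Ftrunc n%:R bt).
have h1 : ibd D (fun xi => cnorm (Ftrunc f n%:R xi - fh xi) ^+ 2) (d ^+ 2).
  have m2 := cmeas_norm2 (cmeasB mF mfh).
  apply: (@ibd_le R D setT _ _ _ mD measurableT _ m2 _ (fun x _ => lexx _)) => //.
    by move=> x; exact: sqr_ge0.
  split => //; first by move=> x; exact: sqr_ge0.
  exact: (Lnorm2_le (ltW d0) (fun x => cnorm_ge0 _) (ltW hn)).
have h2 : ibd D (fun xi => cnorm (Ftrunc f n%:R xi - Ftrunc (trunc f n%:R k) n%:R xi) ^+ 2)
    (eta ^+ 2 * fine (mu D)).
  have hc : ibd D (fun _ => eta ^+ 2) (eta ^+ 2 * fine (mu D)).
    apply/(ibd_bm _ fD (bm_cst _ _) (fun _ => sqr_ge0 _)); by rewrite (rI_cst fD).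
  apply: (ibd_le mD mD _ _ _ _ hc) => //.
  - by apply: cmeas_norm2; exact: cmeasB.
  - by move=> x; exact: sqr_ge0.
  - by move=> x _; apply: lerXn2r; rewrite ?nnegrE ?cnorm_ge0// ltW.
have h3 := ibd_sq_add mD (cmeasB mfh mF) (cmeasB mF mG) _ h2.
have E : (fun xi => cnorm (fh xi - Ftrunc (trunc f n%:R k) n%:R xi) ^+ 2) =
   (fun x => cnorm (fh x - Ftrunc f n%:R x + (Ftrunc f n%:R x - Ftrunc (trunc f n%:R k) n%:R x)) ^+ 2).
  by apply/funext => x; rewrite addrA subrK.
rewrite E; apply: ibd_mono (h3 (d ^+ 2) _); last first.
  by under eq_fun do rewrite cnormBC.
have -> : d ^+ 2 = e / 4 by rewrite sqr_sqrtr// divr_ge0// ltW.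
have h4 : eta ^+ 2 * fine (mu D) <= e / 4.
  have e1 : eta <= 1 by rewrite ge_min lexx.
  have e2 : eta <= e / (4 * (fine (mu D) + 1)) by rewrite ge_min lexx orbT.
  apply: (@le_trans _ _ (eta * (fine (mu D) + 1))).
    apply: ler_pM; rewrite ?sqr_ge0 ?lerDl//.
    by rewrite expr2 ler_piMl// ltW.
  move: e2; rewrite ler_pdivlMr// mulrCA mulrC => e2.
  by rewrite ler_pdivlMr.
lra.
Qed.

End LTwoApproximation.

Section Reflection.
Context (R : realType).
Local Notation mu := (@lebesgue_measure R).

Lemma lebesgue_measure_reflect (z : R) (A : set R) : measurable A ->
  pushforward mu ((fun x => - x + z) : R -> measurableTypeR R) A = mu A.
Proof.
move=> mA.
have mA' : measurable ((fun x => x + z) @^-1` A : set R).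
  rewrite -[X in measurable X]setTI; apply: (@measurable_funD _ _ R setT (fun x => x) (fun _ => z)) => //.
rewrite -(lebesgue_measure_shift z mA) /pushforward -(lebesgue_measureN mA').
by congr (mu _).
Qed.

Lemma ibd_reflect (z S S' : R) (phi : R -> R) (B : R) : S + `|z| <= S' ->
  ibd `[- S', S'] phi B -> ibd `[- S, S] (fun x => phi (z - x)) B.
Proof.
move=> SS [mphi phi0 hB].
have mr : measurable_fun [set: measurableTypeR R] ((fun x : R => - x + z) : measurableTypeR R -> measurableTypeR R).
  by apply: measurable_funD.
have mD : measurable `[- S', S']%classic by exact: measurable_itv.
have mD' : measurable ((fun x => - x + z) @^-1` `[- S', S']%classic : set R).
  by rewrite -[X in measurable X]setTI; exact: mr.
have E : (fun x => phi (z - x)) = (fun x => phi (- x + z)) by apply/funext => x; rewrite addrC.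
rewrite E.
have mc : measurable_fun setT (fun x : R => phi (- x + z)) by exact: (measurableT_comp mphi mr).
split => //; apply: le_trans hB.
pose P : set R := (fun x => - x + z) @^-1` `[- S', S']%classic.
pose I : set R := `[- S', S']%classic.
apply: (@le_trans _ _ (\int[mu]_(x in P) (phi (- x + z)%R)%:E)%E).
  apply: ge0_subset_integral => //.
  - by apply/measurable_EFinP; exact: measurable_funTS.
  - by move=> x _; rewrite lee_fin.
  move=> x /in_sym hx; apply/in_sym; rewrite addrC.
  by rewrite (le_trans (ler_normB _ _))// addrC (le_trans _ SS)// lerD2r.
have mf : measurable_fun (`[- S', S']%classic : set (measurableTypeR R)) (EFin \o phi).
  by apply/measurable_EFinP; exact: measurable_funTS.
have := @ge0_integral_pushforward _ _ _ _ R _ mr mu `[- S', S']%classic (EFin \o phi) mD mf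
   (fun y _ => phi0 y).
move=> h; apply: (@le_trans _ _ (\int[measure_function_pushforward__canonical__measure_function_Measure mu mr]_(x in I) (phi x)%:E)%E).
  by rewrite h.
rewrite le_eqVlt; apply/orP; left; apply/eqP; apply: eq_measure_integral => A mA _.
exact: lebesgue_measure_reflect.
Qed.

End Reflection.

Section TmLimit.
Context (R : realType) (L : R) (a b c : R -> R) (m : R * R -> R * R).
Local Notation mu := (@lebesgue_measure R).
Local Notation C := (R * R)%type.
Hypothesis L0 : 0 < L.
Hypothesis sa : smooth1 a.
Hypothesis sb : smooth1 b.
Hypothesis sc : smooth1 c.
Hypothesis sm : symb L m.
Local Notation IT := (`[- (2 * L), 2 * L]%classic).
Local Notation I3 := (`[- (3 * L), 3 * L]%classic).
Local Notation J := (`[- L, L]%classic).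
Implicit Types F G fh gh : R -> C.

Let L0' : 0 <= L. Proof. exact: ltW. Qed.
Let fT : finm IT. Proof. exact: finm_itv. Qed.
Let mJ : measurable J. Proof. exact: measurable_itv. Qed.
Let m3 : measurable I3. Proof. exact: measurable_itv. Qed.
Let ma : measurable_fun setT a. Proof. exact: cont_meas (@smooth1_cont _ _ 0 sa). Qed.
Let mb : measurable_fun setT b. Proof. exact: cont_meas (@smooth1_cont _ _ 0 sb). Qed.
Let mc : measurable_fun setT c. Proof. exact: cont_meas (@smooth1_cont _ _ 0 sc). Qed.

Lemma cintgB D (h k : R -> C) : measurable D -> cintg D h -> cintg D k -> cintg D (fun x => h x - k x).
Proof. by move=> mD [h1 h2] [k1 k2]; split;
  [exact: (@integrableB _ _ _ mu D mD _ _ h1 k1)|exact: (@integrableB _ _ _ mu D mD _ _ h2 k2)].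
Qed.

(** The difference of the two products is expanded into two terms with one small factor and one term
    with two. In the former the weight [e] goes to the given transform and [e^-1] to the small
    factor. The window [I3] is needed because [z - xi] ranges up to [3 L]. *)
Lemma Tm_approx (M e A B d : R) fh gh F G s z : 0 <= M -> (forall p, cnorm (m p) <= M) -> 0 < e ->
  cmeasurable fh -> cmeasurable gh -> cbm F -> cbm G -> `|z| <= 2 * L ->
  ibd I3 (fun x => cnorm (fh x) ^+ 2) A -> ibd I3 (fun x => cnorm (gh x) ^+ 2) B ->
  ibd I3 (fun x => cnorm (fh x - F x) ^+ 2) d -> ibd I3 (fun x => cnorm (gh x - G x) ^+ 2) d ->
  cnorm (Tm_hat b c m fh gh s z - Tm_hat b c m F G s z) <=
    2 * M * (e * (A + B) + d * (2 * e^-1 + 2)).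
Proof.
move=> M0 hM e0 mfh mgh bF bG hz hA hB hd1 hd2.
pose w xi := cmul (cmul (cexpi (s * b xi)) (cexpi (s * c (z - xi)))) (m (xi, z - xi)).
have bw : cbm w by rewrite /w; have bm_ := symb_cbm sm; bmt.
have wM xi : J xi -> cnorm (w xi) <= M by move=> _; rewrite !cnormM !cnorm_expi !mul1r.
have TE (u v : R -> C) : Tm_hat b c m u v s z = cint J (fun xi => cmul (cmul (u xi) (v (z - xi))) (w xi)).
  rewrite (TmE b c sm _ _ _ _ (lexx L)); apply: eq_cint => xi _.
  by rewrite /vhat /w; cring.
have sub3 : J `<=` I3 by apply: sub_sym; have := L0; lra.
have shr (u : R -> C) A' : ibd I3 (fun x => cnorm (u x) ^+ 2) A' -> ibd J (fun x => cnorm (u x) ^+ 2) A'.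
  by move=> [mu' u0 hu]; apply: (ibd_le mJ m3 sub3 mu' u0 (fun x _ => lexx _)).
have rfl (u : R -> C) A' : ibd I3 (fun x => cnorm (u x) ^+ 2) A' ->
    ibd J (fun x => cnorm (u (z - x)) ^+ 2) A'.
  apply: (@ibd_reflect R z L (3 * L) (fun x => cnorm (u x) ^+ 2)).
  by move: hz; have := L0; lra.
have mrf (u : R -> C) : cmeasurable u -> cmeasurable (fun x => u (z - x)).
  move=> [u1 u2]; split.
    by apply: (measurableT_comp u1); exact: measurable_funB.
  by apply: (measurableT_comp u2); exact: measurable_funB.
have mF := cbm_meas bF; have mG := cbm_meas bG; have mw := cbm_meas bw.
have md1 := cmeasB mfh mF; have md2 := cmeasB mgh mG.
have [g0 _] := cint_prod mJ mfh (mrf _ mgh) mw (shr _ _ hA) (rfl _ _ hB) M0 wM e0.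
have ei : 0 < e^-1 by rewrite invr_gt0.
have [g1 h1] := cint_prod mJ md1 (mrf _ mgh) mw (shr _ _ hd1) (rfl _ _ hB) M0 wM ei.
have [g2 h2] := cint_prod mJ mfh (mrf _ md2) mw (shr _ _ hA) (rfl _ _ hd2) M0 wM e0.
have [g3 h3] := cint_prod mJ md1 (mrf _ md2) mw (shr _ _ hd1) (rfl _ _ hd2) M0 wM ltr01.
rewrite !TE.
have -> : cint J (fun xi => cmul (cmul (F xi) (G (z - xi))) (w xi)) =
    (cint J (fun x => cmul (cmul (fh x) (gh (z - x))) (w x)) -
     cint J (fun x => cmul (cmul (fh x - F x) (gh (z - x))) (w x))) -
    (cint J (fun x => cmul (cmul (fh x) (gh (z - x) - G (z - x))) (w x)) -
     cint J (fun x => cmul (cmul (fh x - F x) (gh (z - x) - G (z - x))) (w x))).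
  rewrite -(cintB_g mJ g0 g1) -(cintB_g mJ g2 g3).
  rewrite -(cintB_g mJ (cintgB mJ g0 g1) (cintgB mJ g2 g3)).
  by apply: eq_cint => xi _; cring.
set I0 := cint J (fun x => cmul (cmul (fh x) (gh _)) _) in h1 h2 h3 *.
set I1 := cint J (fun x => cmul (cmul (fh x - F x) (gh _)) _) in h1 h2 h3 *.
set I2 := cint J (fun x => cmul (cmul (fh x) _) _) in h1 h2 h3 *.
set I4 := cint J (fun x => cmul (cmul (fh x - F x) _) _) in h1 h2 h3 *.
clearbody I0 I1 I2 I4.
have -> : I0 - (I0 - I1 - (I2 - I4)) = I1 + (I2 - I4) by cring.
apply: le_trans (cnormD _ _) _; apply: le_trans (lerD h1 (le_trans (cnormB _ _) (lerD h2 h3))) _.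
by rewrite invrK invr1 !mul1r; apply: le_of_eq; ring.
Qed.

Section Limit.
Variables (f g fh gh : R -> C) (Bf Bg : R).
Hypothesis mf : cmeasurable f.
Hypothesis mg : cmeasurable g.
Hypothesis hf : ibd setT (fun x => cnorm (f x) ^+ 2) Bf.
Hypothesis hg : ibd setT (fun x => cnorm (g x) ^+ 2) Bg.
Hypothesis ff : is_L2_fourier f fh.
Hypothesis gg : is_L2_fourier g gh.

Definition approximant (h h' : R -> C) (X : R) := [/\ cbm h', forall x, cnorm (h' x) <= cnorm (h x)
  & forall x, X < `|x| -> h' x = 0].

Let f3 : finm I3. Proof. exact: finm_itv. Qed.

(** Local square integrability of the Fourier transform is deduced from its distance to the bounded
    transform of one approximant. *)
Lemma fourier_L2_loc h hh B : cmeasurable h -> ibd setT (fun x => cnorm (h x) ^+ 2) B ->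
  is_L2_fourier h hh -> exists A, ibd I3 (fun x => cnorm (hh x) ^+ 2) A.
Proof.
move=> mh hB hhh; have [h' [n [bh' _ _ h1]]] := fourier_approx mh hB hhh f3 ltr01.
have bF := cbm_Ftrunc n%:R bh'.
have hF : ibd I3 (fun x => cnorm (Ftrunc h' n%:R x) ^+ 2) (n2 I3 (Ftrunc h' n%:R)).
  by apply/(ibd_bm _ f3 (cbm_norm2 bF) (fun _ => sqr_ge0 _)).
have [mhh _] := hhh.
eexists; have -> : (fun x => cnorm (hh x) ^+ 2) =
    (fun x => cnorm (hh x - Ftrunc h' n%:R x + Ftrunc h' n%:R x) ^+ 2).
  by apply/funext => x; rewrite subrK.
exact: (ibd_sq_add m3 (cmeasB mhh (cbm_meas bF)) (cbm_meas bF) h1 hF).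
Qed.

Lemma Tm_limit (e : R) : 0 < e -> exists f' g' X, [/\ 0 <= X, approximant f f' X, approximant g g' X
  & forall s z, cnorm (Tm_hat b c m fh gh s z - Tm_hat b c m (Ftrunc f' X) (Ftrunc g' X) s z) <= e].
Proof.
move=> e0.
have [A hA] := fourier_L2_loc mf hf ff; have [B hB] := fourier_L2_loc mg hg gg.
have A0 := ibd_ge0 hA; have B0 := ibd_ge0 hB.
have [M M0 hM] := cbm_bound (symb_cbm sm).
(* The weight [r] is chosen first, to make the contribution of the data smaller than [e / 2]; the
   approximation error [d] then compensates the resulting factor [r^-1]. *)
pose r := e / (4 * M * (A + B + 1)).
have AB : 0 < A + B + 1 by rewrite ltr_wpDl// addr_ge0.
have r0 : 0 < r by rewrite divr_gt0// !mulr_gt0.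
have q0 : 0 < 2 * r^-1 + 2 by rewrite addr_gt0// mulr_gt0// invr_gt0.
pose d := e / (4 * M * (2 * r^-1 + 2)).
have d0 : 0 < d by rewrite divr_gt0// !mulr_gt0.
have [f' [n1 [bf' lf' of' hf']]] := fourier_approx mf hf ff f3 d0.
have [g' [n2 [bg' lg' og' hg']]] := fourier_approx mg hg gg f3 d0.
pose X : R := (maxn n1 n2)%:R.
have X1 : n1%:R <= X by rewrite ler_nat leq_maxl.
have X2 : n2%:R <= X by rewrite ler_nat leq_maxr.
exists f', g', X; split.
- exact: ler0n.
- by split => // x hx; apply: of'; exact: le_lt_trans hx.
- by split => // x hx; apply: og'; exact: le_lt_trans hx.
rewrite (Ftrunc_sub X1 of') (Ftrunc_sub X2 og') => s z.
have [hz|hz] := leP `|z| (2 * L); last by rewrite !(Tm_supp b c sm)// subrr cnorm0 ltW.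
have [mfh _] := ff; have [mgh _] := gg.
apply: le_trans (Tm_approx s (ltW M0) hM r0 mfh mgh (cbm_Ftrunc _ bf') (cbm_Ftrunc _ bg') hz hA hB hf' hg') _.
have E1 : 2 * M * (r * (A + B + 1)) = e / 2 by rewrite /r; field; rewrite !gt_eqF.
have E2 : 2 * M * (d * (2 * r^-1 + 2)) = e / 2.
  by rewrite /d; move: (2 * r^-1 + 2) q0 => q q0; field; rewrite !gt_eqF.
have h : 0 <= 2 * M * r by apply: mulr_ge0; [apply: mulr_ge0 => //; exact: ltW|exact: ltW].
rewrite mulrDr E2 (_ : 2 * M * (r * (A + B)) = e / 2 - 2 * M * r); last by rewrite -E1; ring.
by rewrite addrAC -splitr gerBl.
Qed.

(** The approximation is uniform in time and frequency, so boundedness and joint measurability pass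
    to the limit. From here on the calculus of bounded functions applies to general data. *)
Lemma cbm_Tm_L2 : cbm (fun p : R * R => Tm_hat b c m fh gh p.1 p.2).
Proof.
apply: unif_limit_cbm => e /Tm_limit[f' [g' [X [X0 [bf' _ _] [bg' _ _] h]]]].
exists (fun p : R * R => Tm_hat b c m (Ftrunc f' X) (Ftrunc g' X) p.1 p.2).
  exact: (cbm_Tm L0' mb mc sm (cbm_Ftrunc _ bf') (cbm_Ftrunc _ bg')).
by move=> p; exact: h.
Qed.

Let cbm_kernel (F G : R -> C) t : cbm (fun p : R * R => Tm_hat b c m F G p.1 p.2) ->
  cbm (fun p : R * R => cmul (cexpi ((t - p.1) * a p.2)) (Tm_hat b c m F G p.1 p.2)).
Proof. by move=> bT; bmt. Qed.

Let cbm_flow (F G : R -> C) (t : R) : cbm (fun p : R * R => Tm_hat b c m F G p.1 p.2) ->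
  cbm (fun p : R * R => cmul (cexpi (p.1 * p.2)) (duh a b c m `[0, t] F G t p.2)).
Proof.
move=> bT; have bd : cbm (duh a b c m `[0, t] F G t).
  have h := cbm_cint2 (cbm_kernel t bT) (finm_itv 0 t).
  by rewrite /duh; apply: cbmM => //; exact: cbm_cst.
by move: (duh _ _ _ _ _ _ _ _) bd => u bd {bT}; bmt.
Qed.

Lemma cbm_usol t : cbm (usol a b c m fh gh t).
Proof.
rewrite (_ : usol a b c m fh gh t = sol L a b c m `[0, t] fh gh t).
  exact: (cbm_cint1 (cbm_flow t cbm_Tm_L2) fT).
by apply/funext => x; exact: usolE.
Qed.

Lemma usol_limit (t e : R) : 0 <= t -> 0 < e ->
  exists f' g' X, [/\ 0 <= X, approximant f f' X, approximant g g' X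
  & forall x, cnorm (usol a b c m fh gh t x -
      sol L a b c m `[0, t] (Ftrunc f' X) (Ftrunc g' X) t x) <= e].
Proof.
move=> t0 e0; pose r := e / (4 * L * t + 1).
have p0 : 0 < 4 * L * t + 1 by rewrite ltr_wpDl// mulr_ge0// mulr_ge0.
have r0 : 0 < r by rewrite divr_gt0.
have [f' [g' [X [X0 hf' hg' h]]]] := Tm_limit r0.
exists f', g', X; split => // x; rewrite (usolE a b c sm) /sol.
have [bf' _ _] := hf'; have [bg' _ _] := hg'.
set F := Ftrunc f' X in h *; set G := Ftrunc g' X in h *.
have bT' : cbm (fun p : R * R => Tm_hat b c m F G p.1 p.2).
  exact: (cbm_Tm L0' mb mc sm (cbm_Ftrunc _ bf') (cbm_Ftrunc _ bg')).
clearbody F G.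
have fD := finm_itv 0 t.
have dd z : cnorm (duh a b c m `[0, t] fh gh t z - duh a b c m `[0, t] F G t z) <= r * t.
  have k1 := cbm1 z (cbm_kernel t cbm_Tm_L2); have k2 := cbm1 z (cbm_kernel t bT').
  have -> : duh a b c m `[0, t] fh gh t z - duh a b c m `[0, t] F G t z =
      cmul (0, -1) (cint `[0, t] (fun s => cmul (cexpi ((t - s) * a z)) (Tm_hat b c m fh gh s z) -
        cmul (cexpi ((t - s) * a z)) (Tm_hat b c m F G s z))).
    by rewrite (cintB fD k1 k2) /duh /=; set u := cint _ _; set v := cint _ _; clearbody u v; cring.
  rewrite cnorm_mi; apply: le_trans (cint_le fD (cbmB k1 k2) (M := r) _) _.
    move=> s _ /=; rewrite (_ : _ - _ = cmul (cexpi ((t - s) * a z)) (Tm_hat b c m fh gh s z - Tm_hat b c m F G s z)).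
      by rewrite cnorm_expiM; exact: h.
    by set u := Tm_hat _ _ _ _ _ _ _; set v := Tm_hat _ _ _ _ _ _ _; clearbody u v; cring.
  by rewrite fine_mu_itv// subr0.
have w1 := cbm2 x (cbm_flow t cbm_Tm_L2); have w2 := cbm2 x (cbm_flow t bT').
rewrite -(cintB fT w1 w2) /=.
apply: le_trans (cint_le fT (cbmB w1 w2) (M := r * t) _) _.
  move=> z _ /=; rewrite (_ : _ - _ = cmul (cexpi (x * z)) (duh a b c m `[0, t] fh gh t z - duh a b c m `[0, t] F G t z)).
    by rewrite cnorm_expiM; exact: dd.
  by set u := duh _ _ _ _ _ _ _ _ _; set v := duh _ _ _ _ _ _ _ _ _; clearbody u v; cring.
rewrite fine_mu_itv; last by have := L0; lra.
rewrite (_ : r * t * _ = r * (4 * L * t)); last by ring.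
by rewrite /r mulrAC ler_pdivrMr// ler_wpM2l ?(ltW e0)// lerDl.
Qed.

End Limit.

End TmLimit.

(** * Assembly *)

Section Passage.
Context (R : realType).
Local Notation mu := (@lebesgue_measure R).
Local Notation C := (R * R)%type.
Implicit Types (u v : R -> C) (q : \bar R).

Lemma small_powR (r K e : R) : 1 <= r -> 0 <= K -> 0 < e ->
  exists2 d : R, 0 < d & K * d `^ r <= e.
Proof.
move=> r1 K0 e0; have K1 : 0 < K + 1 by rewrite ltr_wpDl.
exists (Num.min 1 (e / (K + 1))); first by rewrite lt_min ltr01 divr_gt0.
set d := Num.min _ _.
have d0 : 0 <= d by rewrite le_min ler01 divr_ge0// ltW.
have d1 : d <= 1 by rewrite ge_min lexx.
have d2 : d <= e / (K + 1) by rewrite ge_min lexx orbT.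
apply: (@le_trans _ _ ((K + 1) * d)); last by rewrite mulrC -ler_pdivlMr.
apply: ler_pM; rewrite ?powR_ge0 ?lerDl//.
have [->|dn] := eqVneq d 0; first by rewrite powR0// gt_eqF// (lt_le_trans _ r1).
by rewrite -[leRHS](powRr1 d0) ger_powR// lt_neqAle eq_sym dn d0.
Qed.

(** On a fixed interval [[-X, X]] a uniform error [d] contributes at most [2^r d^r (2 X)], which
    tends to [0] with [d]; the approximant may depend on [X]. *)
Lemma Lqb_limit q u (A : R) : cbm u -> 0 <= A -> (2%:E <= q)%E ->
  (forall e : R, 0 < e -> exists v, [/\ cbm v, Lqb q v A & forall x, cnorm (u x - v x) <= e]) ->
  Lqb q u (2 * A).
Proof.
move=> bu A0; case: q => [r||]//=; last first.
  move=> _ H x; apply: (@le_trans _ _ A); last by rewrite ler_peMl// ler1n.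
  apply/ler_addgt0Pr => e /H[v [_ hv huv]].
  rewrite -(subrK (v x) (u x)) (le_trans (cnormD _ _))// addrC.
  by apply: lerD; [exact: hv|exact: huv].
rewrite lee_fin => r2 H X X0; have fX := finm_itv (- X) X.
have r0 : 0 <= r by lra.
have r1 : 1 <= r by lra.
apply/ler_addgt0Pr => eta eta0.
have K0 : 0 <= 2 `^ r * (X + X) by rewrite mulr_ge0 ?powR_ge0// addr_ge0.
have [d d0 hd] := small_powR r1 K0 eta0.
have [v [bv hv huv]] := H d d0; have {hv}hX := hv X X0.
have bV : bm (fun x => cnorm (v x) `^ r) by apply: bm_powR => //; exact: cbm_norm.
have bU : bm (fun x => cnorm (u x) `^ r) by apply: bm_powR => //; exact: cbm_norm.
have bc := bm_cst R (d `^ r).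
apply: (@le_trans _ _ (\int[mu]_(x in `[- X, X]) (2 `^ r * (cnorm (v x) `^ r + d `^ r)))).
  apply: (rI_le fX bU); first exact: (bmM (bm_cst _ _) (bmD bV (bm_cst _ _))).
  move=> x _; apply: le_trans (powRD_le (cnorm_ge0 (v x)) (ltW d0) r0).
  rewrite ge0_ler_powR ?nnegrE ?addr_ge0 ?cnorm_ge0 ?(ltW d0)//.
  by rewrite -{1}(subrK (v x) (u x)) (le_trans (cnormD _ _))// addrC lerD2l.
rewrite (rIZ fX _ (bmD bV (bm_cst _ _))) (rID fX bV (bm_cst _ _)) (rI_cst fX).
rewrite fine_mu_itv; last by rewrite lerNl (le_trans _ X0)// oppr_le0.
rewrite opprK mulrDr powRM//; apply: lerD; first by rewrite ler_wpM2l ?powR_ge0.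
by rewrite (mulrC (d `^ r)) mulrA.
Qed.

(** Monotone convergence along the intervals [[-n, n]]; in the case of [+oo] a bound everywhere is
    an essential bound. *)
Lemma Lnorm_Lqb q u (A : R) : cbm u -> 0 <= A -> (2%:E <= q)%E -> Lqb q u A ->
  (Lnorm mu q (fun x => (cnorm (u x))%:E) <= A%:E)%E.
Proof.
move=> bu A0; rewrite unlock /Lnorm; case: q => [r||]//=; last first.
  move=> _ hA; case: ifPn => _; last by rewrite lee_fin.
  apply/ess_supP; apply: nearW => x /=.
  by rewrite ger0_norm ?cnorm_ge0// lee_fin.
rewrite lee_fin => r2 hA; have r0 : 0 < r by lra.
have bU : bm (fun x => cnorm (u x) `^ r).
  by apply: bm_powR => //; [exact: cbm_norm|exact: ltW].
have -> : (\int[mu]_x `| (cnorm (u x))%:E | `^ r = \int[mu]_(x in setT) (cnorm (u x) `^ r)%:E)%E.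
  by apply: eq_integral => x _; rewrite abse_EFin poweR_EFin ger0_norm// cnorm_ge0.
have key : (\int[mu]_(x in setT) (cnorm (u x) `^ r)%:E <= (A `^ r)%:E)%E.
  pose F (n : nat) : set R := `[- n%:R, n%:R]%classic.
  have UF : \bigcup_i F i = setT.
    apply/seteqP; split => // x _; have [n hn] : exists n : nat, `|x| <= n%:R.
      by exists (Num.trunc `|x|).+1; apply: ltW; exact: truncnS_gt.
    by exists n => //; exact/in_sym.
  have mU : measurable_fun setT (fun x => (cnorm (u x) `^ r)%:E) by apply/measurable_EFinP; case: bU.
  have cv : (\int[mu]_(x in F i) (cnorm (u x) `^ r)%:E)%E @[i --> \oo] -->
      (\int[mu]_(x in setT) (cnorm (u x) `^ r)%:E)%E.
    rewrite -UF; apply: ge0_nondecreasing_set_cvg_integral.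
    - by move=> i j ij; rewrite subsetEset; apply: sub_sym; rewrite ler_nat.
    - by move=> i; exact: measurable_itv.
    - by move=> i; apply: measurable_funTS.
    - by move=> i x _; rewrite lee_fin powR_ge0.
  rewrite -(cvg_lim _ cv)//; apply: lime_le; first by apply/cvg_ex; eexists; exact: cv.
  apply: nearW => n; have [_ _] // := proj1 (ibd_bm (A `^ r) (finm_itv (- n%:R) n%:R) bU (fun _ => powR_ge0 _ _)) (hA _ (ler0n _ n)).
have : (0 <= \int[mu]_(x in setT) (cnorm (u x) `^ r)%:E)%E.
  by apply: integral_ge0 => x _; rewrite lee_fin powR_ge0.
move: key; case: (\int[mu]_(x in setT) _)%E => [I||]//=.
rewrite !lee_fin => IA I0.
rewrite -[leRHS](powRr1 A0) -(@mulfV _ r) ?gt_eqF// powRrM.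
by rewrite ge0_ler_powR ?nnegrE ?powR_ge0// invr_ge0 ltW.
Qed.

(** The exponent may be lowered to [sg], as case (3) of the theorem requires. The last clause passes
    the bound to every approximant dominated by [f], without its dependence on the truncation. *)
Lemma wnorm_bounds (s sg : R) (f : R -> C) : 0 <= sg -> sg <= s -> cmeasurable f ->
  (wnorm s f < +oo)%E -> let W := fine (wnorm s f) in
  [/\ wnorm s f = W%:E, 0 <= W, ibd setT (fun x => cnorm (f x) ^+ 2) (W ^+ 2) &
    forall f', (forall x, cnorm (f' x) <= cnorm (f x)) -> wbound sg f' W].
Proof.
move=> s0 ss mf hW W.
have n0 : (0 <= wnorm s f)%E by exact: Lnorm_ge0.
have E : wnorm s f = W%:E by rewrite fineK// ge0_fin_numE.
have W0 : 0 <= W by exact: fine_ge0.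
pose h x := (1 + x ^+ 2) `^ (s / 2) * cnorm (f x).
have h0 x : 0 <= h x by rewrite mulr_ge0 ?powR_ge0 ?cnorm_ge0.
have b1 (x : R) : 1 <= 1 + x ^+ 2 by rewrite lerDl sqr_ge0.
have mh : measurable_fun setT h.
  apply: measurable_funM; last exact: cmeas_norm.
  apply: (measurableT_comp (measurable_powR (s / 2))).
  by apply: measurable_funD => //; exact: measurable_funX.
have ih : ibd setT (fun x => h x ^+ 2) (W ^+ 2).
  split; [exact: measurable_funX|by move=> x; exact: sqr_ge0|].
  by apply: Lnorm2_le => //; rewrite -E.
split => //.
- apply: (ibd_le measurableT measurableT (fun _ t => t) _ _ _ ih).
  + exact: cmeas_norm2.
  + by move=> x; exact: sqr_ge0.
  move=> x _; apply: lerXn2r; rewrite ?nnegrE ?cnorm_ge0//.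
  rewrite /h ler_peMl ?cnorm_ge0// -[leLHS](powRr0 (1 + x ^+ 2)) powR_mono// divr_ge0//.
  exact: le_trans ss.
- move=> f' ff' X k bk hk; have fX := finm_itv (- X) X.
  apply/(ibd_bm _ fX (cbm_norm2 bk) (fun _ => sqr_ge0 _)).
  apply: (ibd_le _ measurableT _ _ _ _ ih) => //.
  + exact: cmeas_norm2 (cbm_meas bk).
  + by move=> x; exact: sqr_ge0.
  move=> x _; apply: lerXn2r; rewrite ?nnegrE ?cnorm_ge0//.
  apply: le_trans (hk x) _; apply: ler_pM; rewrite ?powR_ge0 ?cnorm_ge0//.
  by rewrite powR_mono// ler_pM2r.
Qed.

End Passage.

Section Symbols.
Context (R : realType).
Local Notation C := (R * R)%type.

Lemma compact_supp_symb (m : R * R -> C) : smooth2 m -> compact (supp m) ->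
  exists L : R, [/\ 0 < L, symb L m & forall p, supp m p -> `|p.1| <= L /\ `|p.2| <= L].
Proof.
move=> sm cm.
have bd (pr : R * R -> R) : continuous pr -> exists2 D : R, 0 < D & forall p, supp m p -> `|pr p| <= D.
  move=> cpr; have /compact_bounded[D [_ bD]] : compact (pr @` supp m).
    by apply: continuous_compact => //; exact: continuous_subspaceT.
  exists (Num.max D 0 + 1); first by rewrite ltr_wpDl// le_max lexx orbT.
  move=> p sp; apply: (bD (Num.max D 0 + 1)); last by exists p.
  by rewrite (le_lt_trans (_ : D <= Num.max D 0)) ?ltrDl// le_max lexx.
have [D1 D10 h1] := bd _ (fun p => @cvg_fst _ _ _ _ _); have [D2 D20 h2] := bd _ (fun p => @cvg_snd _ _ _ _ _).
have sub p : supp m p -> `|p.1| <= D1 + D2 /\ `|p.2| <= D1 + D2.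
  by move=> sp; split; [rewrite (le_trans (h1 _ sp))// lerDl ltW|rewrite (le_trans (h2 _ sp))// lerDr ltW].
exists (D1 + D2); split => //; first exact: addr_gt0.
split.
- by move=> n; case: (sm2_smooth2 sm n).
- by move=> n; case: (sm2_smooth2 sm n).
- by move=> x y nxy; apply: supp0 => /sub.
Qed.

Lemma phase_e1 (a b c : R -> R) (p : R * R) : smooth1 a -> smooth1 b ->
  'D_(e1 R) (phase a b c) p = - derive1n 1 a (p.1 + p.2) + derive1n 1 b p.1.
Proof.
move=> sa sb.
have d1 : der (fun t : R => p.1 + p.2 + t) 0 1.
  by apply: der_eq (derD (der_cst (p.1 + p.2) 0) (der_id 0)) _; rewrite add0r.
have d2 : der (fun t : R => p.1 + t) 0 1.
  by apply: der_eq (derD (der_cst p.1 0) (der_id 0)) _; rewrite add0r.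
have da : der a (p.1 + p.2 + 0) (derive1n 1 a (p.1 + p.2)) by rewrite addr0; exact: (smooth1_der 0).
have db : der b (p.1 + 0) (derive1n 1 b p.1) by rewrite addr0; exact: (smooth1_der 0).
have [_ <-] : der (fun t => - a (p.1 + p.2 + t) + b (p.1 + t) + c p.2) 0
    (- derive1n 1 a (p.1 + p.2) + derive1n 1 b p.1).
  apply: der_eq (derD (derD (derN (der_comp da d1)) (der_comp db d2)) (der_cst (c p.2) 0)) _.
  by rewrite addr0 !mulr1.
rewrite /derive (_ : (fun h => h^-1 *: (phase a b c (h *: e1 R + p) - phase a b c p)) =
  fun h => h^-1 *: ((fun t : R => - a (p.1 + p.2 + t) + b (p.1 + t) + c p.2) (h *: 1 + 0) - (fun t : R => - a (p.1 + p.2 + t) + b (p.1 + t) + c p.2) 0))//.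
apply/funext => h; rewrite /phase /=; congr (_ *: (_ - _)); last by rewrite !addr0.
by rewrite !addr0 [h *: 0]mulr0 add0r ![h *: _]mulr1 (addrC h) (addrAC p.1 h).
Qed.

Lemma phase_e2 (a b c : R -> R) (p : R * R) : smooth1 a -> smooth1 c ->
  'D_(e2 R) (phase a b c) p = - derive1n 1 a (p.1 + p.2) + derive1n 1 c p.2.
Proof.
move=> sa sc.
have d1 : der (fun t : R => p.1 + p.2 + t) 0 1.
  by apply: der_eq (derD (der_cst (p.1 + p.2) 0) (der_id 0)) _; rewrite add0r.
have d2 : der (fun t : R => p.2 + t) 0 1.
  by apply: der_eq (derD (der_cst p.2 0) (der_id 0)) _; rewrite add0r.
have da : der a (p.1 + p.2 + 0) (derive1n 1 a (p.1 + p.2)) by rewrite addr0; exact: (smooth1_der 0).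
have dc : der c (p.2 + 0) (derive1n 1 c p.2) by rewrite addr0; exact: (smooth1_der 0).
have [_ <-] : der (fun t => - a (p.1 + p.2 + t) + b p.1 + c (p.2 + t)) 0
    (- derive1n 1 a (p.1 + p.2) + derive1n 1 c p.2).
  apply: der_eq (derD (derD (derN (der_comp da d1)) (der_cst (b p.1) 0)) (der_comp dc d2)) _.
  by rewrite addr0 !mulr1.
rewrite /derive (_ : (fun h => h^-1 *: (phase a b c (h *: e2 R + p) - phase a b c p)) =
  fun h => h^-1 *: ((fun t : R => - a (p.1 + p.2 + t) + b p.1 + c (p.2 + t)) (h *: 1 + 0) - (fun t : R => - a (p.1 + p.2 + t) + b p.1 + c (p.2 + t)) 0))//.
apply/funext => h; rewrite /phase /=; congr (_ *: (_ - _)); last by rewrite !addr0.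
by rewrite !addr0 [h *: 0]mulr0 add0r ![h *: _]mulr1 (addrC h) addrA.
Qed.

(** In the difference of the two derivatives of the phase the terms in [a'] cancel, which leaves
    [b'(xi) - c'(eta)]. It is continuous and nonzero on a compact set, so its inverse is bounded
    there. *)
Lemma separation (a b c : R -> R) (m : R * R -> C) :
  smooth1 a -> smooth1 b -> smooth1 c -> compact (supp m) -> no_space_res a b c m ->
  exists2 k : R, 0 < k & forall p, supp m p -> k <= `|derive1n 1 b p.1 - derive1n 1 c p.2|.
Proof.
move=> sa sb sc cm nr.
pose G (p : R * R) := derive1n 1 b p.1 - derive1n 1 c p.2.
have G0 p : supp m p -> G p != 0.
  by move=> /nr; rewrite phase_e1// phase_e2//; congr (_ != _); rewrite /G; ring.
have cG : continuous G.
  move=> p; apply: cvgB.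
    by apply: (@continuous_comp _ _ _ fst (derive1n 1 b)); [exact: cvg_fst|exact: smooth1_cont].
  by apply: (@continuous_comp _ _ _ snd (derive1n 1 c)); [exact: cvg_snd|exact: smooth1_cont].
have /compact_bounded[D [_ bD]] : compact ((fun p => (G p)^-1) @` supp m).
  apply: continuous_compact => //; apply: continuous_in_subspaceT => p /set_mem /G0 h.
  by apply: cvgV => //; exact: cG.
have M0 : 0 < Num.max D 0 + 1 by rewrite ltr_wpDl// le_max lexx orbT.
exists (Num.max D 0 + 1)^-1; first by rewrite invr_gt0.
move=> p sp; have g0 : 0 < `|G p| by rewrite normr_gt0 G0.
rewrite -[leRHS]invrK lef_pV2 ?posrE ?invr_gt0// -normfV.
apply: (bD (Num.max D 0 + 1)); last by exists p.
by rewrite (le_lt_trans (_ : D <= Num.max D 0)) ?ltrDl// le_max lexx.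
Qed.

End Symbols.

Section Assembly.
Context (R : realType) (L kap kap1 : R) (a b c : R -> R) (m : R * R -> R * R).
Local Notation C := (R * R)%type.
Hypothesis L0 : 0 < L.
Hypothesis sa : smooth1 a.
Hypothesis sb : smooth1 b.
Hypothesis sc : smooth1 c.
Hypothesis k0 : 0 < kap.
Hypothesis ka : forall x, kap <= `|derive1n 2 a x|.
Hypothesis kb : forall x, kap <= `|derive1n 2 b x|.
Hypothesis kc : forall x, kap <= `|derive1n 2 c x|.
Hypothesis sm : symb L m.
Hypothesis k10 : 0 < kap1.
Hypothesis sub : forall p, supp m p -> `|p.1| <= L /\ `|p.2| <= L.
Hypothesis sep : forall p, supp m p ->
  kap1 <= `|derive1n 1 b p.1 - derive1n 1 c p.2|.
Variables (q : \bar R) (eta : R).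
Hypothesis q2 : (2%:E <= q)%E.
Hypothesis eta0 : 0 < eta.

Lemma weighted_estimate (s sg Tgt : R) : 0 <= sg -> sg <= s ->
  (forall mu1 mu2, 0 <= mu1 -> 0 <= mu2 -> pair_exp q eta mu1 mu2 - (mu1 + mu2) * sg <= Tgt) ->
  exists K : R, forall (t : R) (f g fh gh : R -> C), 1 <= t ->
    cmeasurable f -> cmeasurable g ->
    (wnorm s f < +oo)%E -> (wnorm s g < +oo)%E ->
    is_L2_fourier f fh -> is_L2_fourier g gh ->
    (uLq a b c m fh gh q t <= (K * t `^ Tgt)%:E * wnorm s f * wnorm s g)%E.
Proof.
move=> s0 ss hT.
have [K K0 bK] := core_estimate L0 sa sb sc k0 ka kb kc sm k10 sub sep q2 eta0 s0 hT.
exists (2 * K) => t f g fh gh t1 mf mg wf wg ff gg.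
have [-> Wf0 hf wbf] := wnorm_bounds s0 ss mf wf.
have [-> Wg0 hg wbg] := wnorm_bounds s0 ss mg wg.
set Wf := fine _ in Wf0 hf wbf *; set Wg := fine _ in Wg0 hg wbg *.
have t0 : 0 <= t by exact: le_trans t1.
pose A := K * t `^ Tgt * (Wf * Wg).
have A0 : 0 <= A by rewrite mulr_ge0// mulr_ge0// powR_ge0.
have bu := cbm_usol L0 sa sb sc sm mf mg hf hg ff gg t.
rewrite -!EFinM (_ : 2 * K * t `^ Tgt * Wf * Wg = 2 * A); last by rewrite /A; ring.
apply: Lnorm_Lqb => //; first by rewrite mulr_ge0.
apply: Lqb_limit => // e e0.
have [f' [g' [X [X0 [bf' lf' _] [bg' lg' _] h]]]] := usol_limit L0 sa sb sc sm mf mg hf hg ff gg t0 e0.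
exists (sol L a b c m `[0, t]%classic (Ftrunc f' X) (Ftrunc g' X) t); split; last exact: h.
- exact: (cbm_sol (ltW L0) sa sb sc sm t (finm_itv 0 t) (cbm_Ftrunc X bf') (cbm_Ftrunc X bg')).
- exact: (bK t X Wf Wg f' g' t1 X0 Wf0 Wg0 bf' bg' (wbf _ lf') (wbg _ lg')).
Qed.

Lemma pair_exp_bounds (mu1 mu2 sg : R) : 0 <= mu1 -> 0 <= mu2 ->
  let p := inv_exp q in
  (0 <= sg -> sg <= p -> pair_exp q eta mu1 mu2 - (mu1 + mu2) * sg
    <= p / 2 + 2^-1 - 3 / 2 * sg + 3 * eta) /\
  (p <= sg -> sg <= 1 - p -> pair_exp q eta mu1 mu2 - (mu1 + mu2) * sg <= 2^-1 - sg + 3 * eta).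
Proof.
move=> m1 m2 p; have /andP[p0 p1] := inv_exp_itv q2.
have -> : mu1 + mu2 = Num.max mu1 mu2 + Num.min mu1 mu2 by rewrite addr_max_min.
have [_ th1] := andP (pair_theta_ge0 eta0 mu2 m1).
have thM : pair_theta eta mu1 mu2 <= Num.max mu1 mu2 + 2 * eta by rewrite ge_min lexx orbT.
have g1 : pair_gain eta mu1 mu2 <= pair_theta eta mu1 mu2 / 2 by rewrite ge_min lexx.
have g2 : pair_gain eta mu1 mu2 <= Num.min mu1 mu2 + eta by rewrite ge_min lexx orbT.
have k1 : 0 <= Num.min mu1 mu2 by rewrite le_min m1.
split => h1 h2; rewrite /pair_exp.
  exact: (exponent_small_weight p0 p1 (ltW eta0) th1 thM g1 g2 k1).
exact: (exponent_large_weight p0 p1 (ltW eta0) th1 thM g1 g2 k1).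
Qed.

End Assembly.

Theorem theorem4p3 (R : realType) (a b c : R -> R) (m : R * R -> R * R)
  (q : \bar R) (s delta : R) :
  smooth1 a -> smooth1 b -> smooth1 c -> hypH a b c ->
  smooth2 m -> compact (supp m) ->
  no_space_res a b c m ->
  (2%:E <= q)%E -> 0 < delta -> 0 <= s ->
  let bound (e : R) :=
    exists C : R, forall (t : R) (f g fh gh : R -> R * R),
      1 <= t ->
      cmeasurable f -> cmeasurable g ->
      (wnorm s f < +oo)%E -> (wnorm s g < +oo)%E ->
      is_L2_fourier f fh -> is_L2_fourier g gh ->
      (uLq a b c m fh gh q t <= (C * t `^ e)%:E * wnorm s f * wnorm s g)%E in
  (s < inv_exp q -> bound (inv_exp q / 2 + 2^-1 - 3 / 2 * s + delta)) /\
  (inv_exp q < s < 1 - inv_exp q -> bound (2^-1 - s + delta)) /\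
  (1 - inv_exp q < s -> bound (inv_exp q - 2^-1 + delta)).
Proof.
move=> sa sb sc [kap [kap0 hk]] sm cm nr q2 d0 s0 bound.
have ka x : kap <= `|derive1n 2 a x| by case: (hk x).
have kb x : kap <= `|derive1n 2 b x| by case: (hk x) => _ [].
have kc x : kap <= `|derive1n 2 c x| by case: (hk x) => _ [].
have [L [L0 sL sub]] := compact_supp_symb sm cm.
have [k k10 sep] := separation sa sb sc cm nr.
(* The optimised exponents lose [3 eta]. *)
have eta0 : 0 < delta / 3 by rewrite divr_gt0.
have E : delta = 3 * (delta / 3) by rewrite mulrC divfK.
have W := weighted_estimate L0 sa sb sc kap0 ka kb kc sL k10 sub sep q2 eta0.
have /andP[p0 p1] := inv_exp_itv q2.
have H mu1 mu2 sg := @pair_exp_bounds R q _ q2 eta0 mu1 mu2 sg.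
split; [|split].
- move=> sp; apply: (W s s) => // mu1 mu2 m1 m2; rewrite {2}E.
  by apply: (proj1 (H mu1 mu2 s m1 m2)) => //; exact: ltW.
- move=> /andP[ps sp]; apply: (W s s) => // mu1 mu2 m1 m2; rewrite {2}E.
  by apply: (proj2 (H mu1 mu2 s m1 m2)) => //; exact: ltW.
- move=> ps; apply: (W s (1 - inv_exp q)) => //; [lra|exact: ltW|].
  move=> mu1 mu2 m1 m2.
  have -> : inv_exp q - 2^-1 + delta = 2^-1 - (1 - inv_exp q) + 3 * (delta / 3) by field.
  by apply: (proj2 (H mu1 mu2 _ m1 m2)) => //; lra.
Qed.
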